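(* Let $n\ge1$. Suppose that the strong version of the slicing conjecture for log-concave functions holds in dimension $n$, that is, $\widehat{L}_f\le \widehat{L}_{f_0}=1/e$ for every integrable log-concave function $f:\mathbb{R}^n\to[0,+\infty)$ with $\int f>0$. Then Mahler's conjecture for log-concave functions holds in dimension $n$, that is, $P(f)\ge P(f_0)=e^n$ for every integrable log-concave function $f:\mathbb{R}^n\to[0,+\infty)$ with $\int f>0$.
   Context: A function $f:\mathbb{R}^n\to[0,+\infty)$ is log-concave if $f=e^{-\varphi}$ with $\varphi:\mathbb{R}^n\to\mathbb{R}\cup\{+\infty\}$ convex. Here $f_0(x)=e^{-\sum_{i=1}^n x_i}\chi_{[-1,+\infty)^n}(x)$, where $\chi_A$ denotes the characteristic function of $A$. The polar of $f$ is $f^\circ(y)=\inf_{x}\frac{e^{-\langle x,y\rangle}}{f(x)}$ (points with $f(x)=0$ contribute $+\infty$ to the infimum). Set $M(f)=\int_{\mathbb{R}^n} f\int_{\mathbb{R}^n} f^\circ\in(0,+\infty]$ and $P(f)=\inf_{z\in\mathbb{R}^n}M(f_z)$, where $f_z(x)=f(x-z)$. Further, $$\mathrm{bar}(f)=\frac{\int xf(x)\,dx}{\int f},\quad \mathrm{Cov}(f)=\frac{\int xx^Tf(x)\,dx}{\int f}-\mathrm{bar}(f)\mathrm{bar}(f)^T,\quad h(f)=-\frac{\int f\log f}{\int f}$$ (with $0\log 0=0$), and the isotropic constant of $f$ is $$\widehat{L}_f=\left(\frac{e^{-h(f)}}{\int f}\right)^{1/n}\bigl(\det\mathrm{Cov}(f)\bigr)^{1/(2n)}.$$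 *)

(* Defs.v *)
From HB Require Import structures.
From mathcomp Require Import all_boot all_order all_algebra.
From mathcomp Require Import all_classical all_reals all_analysis.
From mathcomp Require Import measurable_realfun.

Set Implicit Arguments.
Unset Strict Implicit.
Unset Printing Implicit Defensive.
Import Order.TTheory GRing.Theory Num.Theory.
Import numFieldNormedType.Exports.

Local Open Scope classical_set_scope.
Local Open Scope ring_scope.

Definition measure_rV_display : measure_display.
Proof. exact. Qed.

Section measurable_rV.
Context {R : realType}.
Variable n : nat.

(* The product sigma-algebra, generated by the coordinates: since R is second
   countable it is the Borel sigma-algebra of R^n. *)
Definition coord_rV (i : 'I_n) (v : 'rV[R]_n) : R := v ord0 i.

Let rV_set0 : g_sigma_preimage coord_rV set0.
Proof. exact: sigma_algebra0. Qed.

Let rV_setC A : g_sigma_preimage coord_rV A -> g_sigma_preimage coord_rV (~` A).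
Proof. exact: sigma_algebraC. Qed.

Let rV_bigcup (F : _^nat) : (forall i, g_sigma_preimage coord_rV (F i)) ->
  g_sigma_preimage coord_rV (\bigcup_i (F i)).
Proof. exact: sigma_algebra_bigcup. Qed.

HB.instance Definition _ := @isMeasurable.Build measure_rV_display
  'rV[R]_n (g_sigma_preimage coord_rV) rV_set0 rV_setC rV_bigcup.

End measurable_rV.

Lemma measurable_coord_rV (R : realType) n (i : 'I_n) :
  measurable_fun [set: 'rV[R]_n] (coord_rV i).
Proof.
move=> _ Y mY; rewrite setTI; apply: sub_sigma_algebra => /=.
rewrite -bigcup_seq/=; exists i => /=; first by rewrite mem_index_enum.
by exists Y => //; rewrite setTI.
Qed.

Lemma measurable_fun_rVP d (T : measurableType d) (R : realType) n
    (f : T -> 'rV[R]_n) :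
  measurable_fun [set: T] f <->
  forall i, measurable_fun [set: T] (coord_rV i \o f).
Proof.
split=> [mf i|mf].
  by apply: measurableT_comp => //; exact: measurable_coord_rV.
apply: (@measurability _ _ T 'rV[R]_n setT f
  (\big[setU/set0]_(i < n)
     preimage_set_system setT (@coord_rV R n i) measurable)); first by [].
move=> _ [A + <-].
rewrite -bigcup_seq/= => -[i _ [B mB <-]].
by rewrite !setTI; move: (mf i measurableT B mB); rewrite setTI.
Qed.

Section cons_rV.
Context {R : realType}.
Variable n : nat.

Definition cons_rV (p : measurableTypeR R * 'rV[R]_n) : 'rV[R]_n.+1 :=
  row_mx (p.1 : R)%:M p.2 : 'rV[R]_(1 + n).

Definition uncons_rV (v : 'rV[R]_n.+1) : measurableTypeR R * 'rV[R]_n :=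
  (v ord0 ord0, rsubmx (v : 'rV[R]_(1 + n))).

Lemma cons_rV0 p : cons_rV p ord0 ord0 = p.1.
Proof.
rewrite /cons_rV (_ : @ord0 n = lshift n (@ord0 0)); last exact/val_inj.
by apply: (etrans (row_mxEl _ _ _ _)); rewrite mxE eqxx.
Qed.

Lemma cons_rVS p (i : 'I_n) : cons_rV p ord0 (lift ord0 i) = p.2 ord0 i.
Proof.
rewrite /cons_rV (_ : lift ord0 i = rshift 1 i); last exact/val_inj.
exact: row_mxEr.
Qed.

Lemma cons_rVK : cancel cons_rV uncons_rV.
Proof.
move=> [x v]; rewrite /uncons_rV cons_rV0/=; congr (_, _).
by rewrite /cons_rV row_mxKr.
Qed.

Lemma uncons_rVK : cancel uncons_rV cons_rV.
Proof.
move=> v; apply/rowP => i; case: (unliftP ord0 i) => [j|] ->.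
  rewrite cons_rVS mxE; congr (v _ _); exact/val_inj.
by rewrite cons_rV0.
Qed.

Lemma measurable_cons_rV : measurable_fun setT cons_rV.
Proof.
apply/measurable_fun_rVP => i; case: (unliftP ord0 i) => [j|] ->.
  rewrite (_ : _ \o _ = coord_rV j \o snd); last first.
    by apply/funext => p; rewrite /= /coord_rV cons_rVS.
  by apply: measurableT_comp => //; exact: measurable_coord_rV.
rewrite (_ : _ \o _ = fst); last first.
  by apply/funext => p; rewrite /= /coord_rV cons_rV0.
exact: measurable_fst.
Qed.

Lemma measurable_uncons_rV : measurable_fun setT uncons_rV.
Proof.
apply/measurable_fun_pairP; split.
  exact: (@measurable_coord_rV R n.+1 ord0).
apply/measurable_fun_rVP => i.
rewrite (_ : _ \o _ = coord_rV (lift ord0 i)); last first.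
  apply/funext => v; rewrite /= /coord_rV mxE; congr (v _ _); exact/val_inj.
exact: measurable_coord_rV.
Qed.

Variable mu : {sigma_finite_measure set 'rV[R]_n -> \bar R}.

Definition cons_measure : set 'rV[R]_n.+1 -> \bar R :=
  pushforward (lebesgue_measure \x mu)%E cons_rV.

Let cons_measure0 : cons_measure set0 = 0%E.
Proof. by rewrite /cons_measure /pushforward preimage_set0 measure0. Qed.

Let cons_measure_ge0 A : (0 <= cons_measure A)%E.
Proof. exact: (@measure_ge0 _ _ _ (lebesgue_measure \x mu)%E). Qed.

Let cons_measure_sigma_additive : semi_sigma_additive cons_measure.
Proof.
move=> F mF tF mUF; rewrite /cons_measure /pushforward preimage_bigcup.
apply: measure_semi_sigma_additive.
- by move=> k; rewrite -[X in measurable X]setTI; exact: measurable_cons_rV.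
- apply/trivIsetP => /= i j _ _ ij; rewrite -preimage_setI.
  by move/trivIsetP : tF => /(_ _ _ _ _ ij) ->//; rewrite preimage_set0.
- by rewrite -preimage_bigcup -[X in measurable X]setTI;
    exact: measurable_cons_rV.
Qed.

HB.instance Definition _ := isMeasure.Build _ _ _ cons_measure
  cons_measure0 cons_measure_ge0 cons_measure_sigma_additive.

Let cons_measure_sigma_finite : sigma_finite setT cons_measure.
Proof.
have /sigma_finiteP[F [TF ndF Foo]] := sigma_finiteT (@lebesgue_measure R).
have /sigma_finiteP[G [TG ndG Goo]] := sigma_finiteT mu.
exists (fun k => uncons_rV @^-1` (F k `*` G k)).
  apply/esym; rewrite -subTset => v _.
  have [i _ Fi] : (\bigcup_k F k) (uncons_rV v).1 by rewrite -TF.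
  have [j _ Gj] : (\bigcup_k G k) (uncons_rV v).2 by rewrite -TG.
  exists (maxn i j) => //; split.
  - by move: Fi; exact/subsetPset/ndF/leq_maxl.
  - by move: Gj; exact/subsetPset/ndG/leq_maxr.
move=> k; have [mF Fk] := Foo k; have [mG Gk] := Goo k; split.
  rewrite -[X in measurable X]setTI; apply: measurable_uncons_rV => //.
  exact: measurableX.
rewrite /cons_measure /pushforward -comp_preimage.
rewrite (_ : uncons_rV \o _ = id); last by apply/funext => p /=; rewrite cons_rVK.
by rewrite preimage_id product_measure1E// lte_mul_pinfty// ge0_fin_numE.
Qed.

HB.instance Definition _ := Measure_isSigmaFinite.Build _ _ _ cons_measure
  cons_measure_sigma_finite.

End cons_rV.

(* Lebesgue measure on the Borel sets of R^n, as an iterated product; the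
   measure on the one-point space R^0 is the unit mass. *)
Fixpoint lebesgue_rV (R : realType) (n : nat) :
    {sigma_finite_measure set 'rV[R]_n -> \bar R} :=
  match n with
  | 0 => \d_ (0 : 'rV[R]_0)
  | m.+1 => cons_measure (lebesgue_rV R m)
  end.

Lemma lebesgue_rV_box (R : realType) (n : nat) (A : 'I_n -> set R) :
  (forall i, measurable (A i)) ->
  (lebesgue_rV R n [set v : 'rV[R]_n | forall i, A i (v ord0 i)] =
   \prod_(i < n) lebesgue_measure (A i))%E.
Proof.
elim: n A => [|n IHn] A mA.
  by rewrite big_ord0 /= diracE mem_set//; case.
rewrite big_ord_recl -IHn//.
pose B := [set v : 'rV[R]_n | forall i, A (lift ord0 i) (v ord0 i)].
rewrite -/B; transitivity ((lebesgue_measure \x lebesgue_rV R n)%E (A ord0 `*` B)).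
  rewrite /= /cons_measure /pushforward; congr (_ _).
  apply/seteqP; split=> [p /= pA|p /= [p0 pS] i].
    split; first by rewrite -cons_rV0; exact: pA.
    by move=> i; rewrite -cons_rVS; exact: pA.
  by case: (unliftP ord0 i) => [j|] ->; rewrite ?cons_rVS ?cons_rV0.
rewrite product_measure1E//; first exact: mA.
rewrite (_ : B = \bigcap_(i in [set: 'I_n]) (coord_rV i @^-1` A (lift ord0 i))).
  apply: fin_bigcap_measurable => // i _.
  rewrite -[X in measurable X]setTI.
  exact: (measurable_coord_rV i measurableT (mA _)).
by apply/seteqP; split=> [v vA i _|v vA i]; exact: vA.
Qed.

Section integral_ae_eq.
Import HBSimple HBNNSimple.
Context d (T : measurableType d) (R : realType).
Variable mu : {measure set T -> \bar R}.
Implicit Types f g : T -> \bar R.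
Local Open Scope ereal_scope.

Lemma ge0_nonmeasurable_ae_le_integral f g :
  (forall x, 0 <= f x) -> (forall x, 0 <= g x) ->
  {ae mu, forall x, f x <= g x} -> \int[mu]_x f x <= \int[mu]_x g x.
Proof.
move=> f0 g0 [N [mN N0 fgN]]; rewrite !ge0_integralTE//.
apply: ge_ereal_sup => _ [h hf <-].
have mNC : measurable (~` N) by exact: measurableC.
have -> : sintegral mu h = sintegral mu (proj_nnsfun h mNC).
  rewrite -!integralT_nnsfun; apply: ae_eq_integral => //.
  - exact/measurable_EFinP/measurable_funPT.
  - exact/measurable_EFinP/measurable_funPT.
  - exists N; split=> // x /= /not_implyP[_ hx].
    apply: contrapT => Nx; apply: hx.
    by rewrite /= mindicE mem_set// mulr1.
apply: ereal_sup_ubound; exists (proj_nnsfun h mNC) => // x /=.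
rewrite mindicE; case: (pselect (N x)) => Nx.
  by rewrite memNset ?mulr0//=; apply.
rewrite mem_set//= mulr1 (le_trans (hf x))//.
by apply: contrapT => fgx; apply: Nx; exact: fgN.
Qed.

Lemma nonmeasurable_ae_eq_integral f g :
  {ae mu, forall x, f x = g x} -> \int[mu]_x f x = \int[mu]_x g x.
Proof.
move=> fg; rewrite [LHS]integralE [RHS]integralE; congr (_ - _); apply/eqP;
  rewrite eq_le; apply/andP; split;
  apply: ge0_nonmeasurable_ae_le_integral => //;
  by apply: filterS fg => x fgx; rewrite ?(funeposE, funenegE) fgx.
Qed.

End integral_ae_eq.

Section log_concave_functions.
Context {R : realType} {n : nat}.
Implicit Types (f : 'rV[R]_n -> R) (x y z : 'rV[R]_n).

Definition dotmul_rV x y : R := \sum_(i < n) x ord0 i * y ord0 i.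

(* phi takes no value -oo, and 0 * +oo = 0 in \bar R, so the endpoints t = 0
   and t = 1 are harmless. *)
Definition econvex (phi : 'rV[R]_n -> \bar R) : Prop :=
  forall x y (t : R), 0 <= t <= 1 ->
    (phi (t *: x + (1 - t) *: y)%R <= t%:E * phi x + (1 - t)%:E * phi y)%E.

Definition log_concave f : Prop :=
  exists phi : 'rV[R]_n -> \bar R,
    [/\ forall x, phi x != -oo%E, econvex phi
      & forall x, (f x)%:E = expeR (- phi x)%E].

(* A log-concave function is Lebesgue measurable but not always Borel (it may
   behave badly on the boundary of its support), whereas [integrable] asks for
   Borel measurability. Lebesgue integrability is therefore stated as equality
   almost everywhere to a Borel integrable function. The integral of the library
   makes sense for all functions, and nonmeasurable_ae_eq_integral shows that
   on f it is the Lebesgue integral. *)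
Definition lebesgue_integrable f : Prop :=
  exists2 g : 'rV[R]_n -> R,
    (lebesgue_rV R n).-integrable setT (EFin \o g)
    & {ae lebesgue_rV R n, forall x, f x = g x}.

Definition translate f z : 'rV[R]_n -> R := fun x => f (x - z).

(* The inverse of 0 is +oo in \bar R. *)
Definition polar f y : \bar R :=
  ereal_inf [set ((expR (- dotmul_rV x y))%:E / (f x)%:E)%E | x in setT].

Definition mahler_product f : \bar R :=
  (\int[lebesgue_rV R n]_x (f x)%:E * \int[lebesgue_rV R n]_y polar f y)%E.

Definition mahler_inf f : \bar R :=
  ereal_inf [set mahler_product (translate f z) | z in setT].

Definition bar f : 'rV[R]_n :=
  \row_i (\int[lebesgue_rV R n]_x (x ord0 i * f x)
          / \int[lebesgue_rV R n]_x f x).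

Definition cov f : 'M[R]_n :=
  \matrix_(i, j) (\int[lebesgue_rV R n]_x (x ord0 i * x ord0 j * f x)
                  / \int[lebesgue_rV R n]_x f x)
  - (bar f)^T *m bar f.

(* [ln 0 = 0], so that 0 log 0 = 0. *)
Definition entropy f : R :=
  - (\int[lebesgue_rV R n]_x (f x * ln (f x)) / \int[lebesgue_rV R n]_x f x).

Definition isotropic_constant f : R :=
  (expR (- entropy f) / \int[lebesgue_rV R n]_x f x) `^ n%:R^-1
  * (\det (cov f)) `^ (2 * n%:R)^-1.

Definition f0 x : R :=
  expR (- \sum_(i < n) x ord0 i) * \1_[set v : 'rV[R]_n | forall i, -1 <= v ord0 i] x.

End log_concave_functions.

(* Main.v *)
(* Let alpha and beta be convex and superlinear with
   <x, y> <= alpha x + beta y, and almost conjugate in the sense that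
   int e^(-t (alpha - <v, .>)) >= B t^(-n) e^(t beta v) for t >= 1, and likewise
   with alpha and beta exchanged. Then int e^(-alpha) * int e^(-beta) >= e^n.
   To see it, minimize over t >= 1 and v, u
     (n ln t + ln int e^(-t (alpha - <v, .>)) + ln int e^(-t (beta - <u, .>))
      - t <v, u> - n) / t,
   made coercive by a small multiple of the logarithms of the integrals. At a
   minimum, the second-order condition in (v, u) reads
     t <p, Cov p> + t <q, Cov' q> >= 2 <p, q> for all p, q
   for the covariances of the two tilted densities, whence
   det Cov * det Cov' >= t^(-2n). The slicing inequality turns this into a lower
   bound for the sum of the two entropies, while the derivative in t bounds that
   sum from above; together they make the minimum nonnegative, in particular the
   value at t = 1, v = u = 0.

   For a log-concave f = e^(-phi), this applies to the infimal convolution of phi,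
   restricted to the bounded set {f > 0, |x_i| <= j}, with A |x|^2 / 2, and to the
   conjugate of phi on that set plus |y|^2 / (2 A). One lets j, then A, tend to
   infinity; the exponential decay of f controls the integrals.

   For f0 translated by z, the polar is e^(-<z, y>) times the polar of f0, and f0
   has barycenter 0, so that e^s >= 1 + s gives M(f0_z) >= M(f0). *)
Require Import Defs.
From HB Require Import structures.
From mathcomp Require Import all_boot all_order all_algebra.
From mathcomp Require Import all_classical all_reals all_analysis.
From mathcomp Require Import measurable_realfun ring lra.
Set Implicit Arguments.
Unset Strict Implicit.
Unset Printing Implicit Defensive.
Import Order.TTheory GRing.Theory Num.Theory.
Import numFieldNormedType.Exports.
Local Open Scope classical_set_scope.
Local Open Scope ring_scope.

(** * Lebesgue measure on R^n *)

(** Write E for the sum of the two mean potentials and L for the sum of the two log-partition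
    functions. At an exact minimum in (v, u), without penalty, slicing gives t E + L >= 2 n - n ln
    t, which says precisely that the right derivative in t of the quotient is at most 0 there.
    Almost conjugacy and the Fenchel inequality bound the quotient below by a quantity tending to 0
    as t grows, so it should descend from its value at t = 1 to a nonnegative limit. A minimum over
    1 <= t yields the reverse sign of the derivative, so the two bounds meet without contradiction;
    adding d / t to the quotient makes them incompatible. The penalty costs an error eta n ln t,
    hence the minimizer is first confined to t <= T, with T chosen before eta. Every condition at
    the minimum comes from comparison with nearby values, so upper Taylor bounds on the
    log-partition functions suffice. Superlinear growth supplies the exponential moments in them;
    truncation and the quadratic terms make both members of the pair finite and superlinear. *)

Section lebesgue_rV_integral.
Context {R : realType}.
Local Notation leb := (@lebesgue_measure R).

Lemma ge0_integral_cons (n : nat) (F : 'rV[R]_n.+1 -> \bar R) :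
  measurable_fun setT F -> (forall v, 0 <= F v)%E ->
  (\int[lebesgue_rV R n.+1]_v F v =
   \int[leb]_x \int[lebesgue_rV R n]_v F (cons_rV (x, v)))%E.
Proof.
move=> mF F0.
rewrite /= /cons_measure ge0_integral_pushforward//=; last first.
  exact: measurable_cons_rV.
rewrite preimage_setT.
rewrite (@fubini_tonelli1 _ _ _ _ _ leb (lebesgue_rV R n) (F \o @cons_rV R n))//.
  by apply: measurableT_comp => //; exact: measurable_cons_rV.
by move=> x /=.
Qed.

Lemma measurable_fun_coord (n : nat) (g : R -> R) (i : 'I_n) :
  measurable_fun setT g ->
  measurable_fun setT (fun v : 'rV[R]_n => g (v ord0 i)).
Proof.
move=> mg.
exact: (@measurableT_comp _ _ _ _ _ _ g _ (@coord_rV R n i) mg (@measurable_coord_rV R n i)).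
Qed.

Lemma measurable_fun_prod_coord (n : nat) (g : 'I_n -> R -> R) :
  (forall i, measurable_fun setT (g i)) ->
  measurable_fun setT (fun v : 'rV[R]_n => \prod_(i < n) g i (v ord0 i)).
Proof.
by move=> mg; apply: measurable_prod => i _; exact: measurable_fun_coord.
Qed.

Lemma ge0_integral_prod_coord (n : nat) (g : 'I_n -> R -> R) :
  (forall i, measurable_fun setT (g i)) -> (forall i x, 0 <= g i x) ->
  (\int[lebesgue_rV R n]_v (\prod_(i < n) g i (v ord0 i))%:E =
   \prod_(i < n) \int[leb]_x (g i x)%:E)%E.
Proof.
elim: n g => [|n IH] g mg g0.
  rewrite big_ord0 /= integral_dirac//=; last first.
    by apply/measurable_EFinP; exact: measurable_fun_prod_coord.
  by rewrite diracT mul1e big_ord0.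
rewrite ge0_integral_cons//; last 2 first.
  by apply/measurable_EFinP; exact: measurable_fun_prod_coord.
  by move=> v; rewrite lee_fin prodr_ge0.
rewrite big_ord_recl -IH//.
transitivity (\int[leb]_x ((g ord0 x)%:E *
  (\int[lebesgue_rV R n]_v (\prod_(i < n) g (lift ord0 i) (v ord0 i))%:E)))%E.
  apply: eq_integral => x _; rewrite -ge0_integralZl_EFin//.
  - apply: eq_integral => v _; rewrite big_ord_recl cons_rV0 EFinM.
    by congr (_ * (_)%:E)%E; apply: eq_bigr => i _; rewrite cons_rVS.
  - by move=> v _; rewrite lee_fin prodr_ge0.
  - apply/measurable_EFinP.
    exact: (measurable_fun_prod_coord (g := fun i => g (lift ord0 i))).
rewrite ge0_integralZr//.
- exact: (proj2 (measurable_EFinP _ _) (mg ord0)).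
- by move=> x _; rewrite lee_fin.
- by apply: integral_ge0 => v _; rewrite lee_fin prodr_ge0.
Qed.

Lemma integrable_prod_coord (n : nat) (g : 'I_n -> R -> R) :
  (forall i, leb.-integrable setT (EFin \o g i)) ->
  (lebesgue_rV R n).-integrable setT
    (EFin \o (fun v : 'rV[R]_n => \prod_(i < n) g i (v ord0 i))).
Proof.
move=> ig; have mg i : measurable_fun setT (g i).
  by apply/measurable_EFinP; case/integrableP: (ig i).
apply/integrableP; split.
  by apply/measurable_EFinP; exact: measurable_fun_prod_coord.
rewrite (eq_integral (fun v : 'rV[R]_n => (\prod_(i < n) `|g i (v ord0 i)|)%:E)); last first.
  by move=> v _; rewrite /= normr_prod.
rewrite (ge0_integral_prod_coord (g := fun i x => `|g i x|))//; last first.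
  by move=> i; apply: measurableT_comp.
(* Nonnegativity is carried along because finiteness of a product in [\bar R] needs it. *)
suff /andP[] : (0 <= \prod_(i < n) \int[leb]_x `|g i x|%:E < +oo)%E by [].
elim/big_ind: _ => [|x y /andP[x0 xoo] /andP[y0 yoo]|i _].
- by rewrite lee_fin ler01 ltry.
- by rewrite mule_ge0//= lte_mul_pinfty// ge0_fin_numE.
- by rewrite integral_ge0//=; case/integrableP: (ig i).
Qed.

(** The signed version serves the moments of [f0], whose integrands change sign. Fubini then needs
    the integrability of the product, which comes from the nonnegative version applied to absolute
    values. *)
Lemma integral_prod_coord (n : nat) (g : 'I_n -> R -> R) :
  (forall i, leb.-integrable setT (EFin \o g i)) ->
  \int[lebesgue_rV R n]_v (\prod_(i < n) g i (v ord0 i)) =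
  \prod_(i < n) \int[leb]_x g i x.
Proof.
elim: n g => [|n IH] g ig.
  rewrite /Rintegral big_ord0 /= integral_dirac//=; last first.
    apply/measurable_EFinP; apply: measurable_fun_prod_coord; first by case.
  by rewrite indicT mul1r big_ord0.
have mg i : measurable_fun setT (g i).
  by apply/measurable_EFinP; case/integrableP: (ig i).
have iP := integrable_prod_coord ig.
have iP' := @integrable_prod_coord n (fun i => g (lift ord0 i)) (fun i => ig _).
rewrite /Rintegral /= /cons_measure.
have mc := measurable_cons_rV (R := R) (n := n).
pose H := fun v : 'rV[R]_n.+1 => (\prod_(i < n.+1) g i (v ord0 i))%:E.
have mH : measurable_fun setT H.
  by apply/measurable_EFinP; exact: measurable_fun_prod_coord.
have iH : (leb \x lebesgue_rV R n)%E.-integrable setT (H \o @cons_rV R n).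
  apply/integrableP; split; first exact: measurableT_comp.
  case/integrableP: iP => _; rewrite /= /cons_measure ge0_integral_pushforward//=.
  by do 2 apply: measurableT_comp => //; exact: measurable_fun_prod_coord.
rewrite -/H (integral_pushforward mc mH _ measurableT); last by rewrite preimage_setT.
rewrite preimage_setT -(integral12_prod_meas1 iH) big_ord_recl -IH//.
rewrite /Rintegral -fineM; last 2 first.
- exact: (integrable_fin_num measurableT (ig ord0)).
- exact: (integrable_fin_num measurableT iP').
congr fine.
rewrite -[X in (_ * X)%E]fineK; last exact: (integrable_fin_num measurableT iP').
rewrite -integralZr//; last exact: (ig ord0).
apply: eq_integral => x _; rewrite /fubini_F.
rewrite fineK; last exact: (integrable_fin_num measurableT iP').
rewrite -integralZl//; apply: eq_integral => v _.
rewrite /H /= big_ord_recl cons_rV0 EFinM.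
by congr (_ * (_)%:E)%E; apply: eq_bigr => i _; rewrite cons_rVS.
Qed.

End lebesgue_rV_integral.

(** * Homotheties and Lebesgue measure *)

Section affine_change_of_variables.
Context {R : realType}.
Local Notation leb := (@lebesgue_measure R).

Section dimension1.
Variables (a b : R).
Hypothesis a0 : a != 0.
Let aff (x : measurableTypeR R) : measurableTypeR R := a * x + b.

Let measurable_aff : measurable_fun setT aff.
Proof.
apply: (@measurable_funD _ (measurableTypeR R) R setT (fun x => a * x) (cst b)) => //.
exact: (@measurable_funM _ (measurableTypeR R) R setT (cst a) id).
Qed.

HB.instance Definition _ := isMeasurableFun.Build _ _ _ _ aff measurable_aff.

Let absa : {nonneg R} := NngNum (normr_ge0 a).

(** By uniqueness of Lebesgue measure it suffices to compare both sides on intervals ]c, d]. A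
    negative slope moves the closed end of the preimage to the left, which does not change its
    length. *)
Lemma lebesgue_measure_affine (A : set R) : measurable A ->
  leb A = (`|a|%:E * leb ((fun x => (a * x + b)%R) @^-1` A))%E.
Proof.
apply: (@lebesgue_measure_unique R (mscale absa (pushforward leb aff))).
move=> _ [[c d] _ <-]; change (leb `]c, d] = `|a|%:E * leb (aff @^-1` `]c, d]))%E.
have [a_gt0|] := ltP 0 a.
  rewrite (_ : aff @^-1` _ = `](c - b) / a, (d - b) / a]%classic); last first.
    apply/seteqP; split => x /=; rewrite !in_itv/= /aff;
      by rewrite ltr_pdivrMr// ler_pdivlMr// ltrBlDr lerBrDr (mulrC x a).
  rewrite !lebesgue_measure_itv/= !lte_fin ltr_pM2r ?invr_gt0// ltrD2r.
  case: ifPn => cd; last by rewrite mule0.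
  rewrite gtr0_norm// -!EFinB -EFinM; congr (_%:E).
  by field; rewrite gt_eqF.
rewrite le_eqVlt (negbTE a0)/= => a_lt0.
rewrite (_ : aff @^-1` _ = `[(d - b) / a, (c - b) / a[%classic); last first.
  apply/seteqP; split => x /=; rewrite !in_itv/= /aff;
    by rewrite ler_ndivrMr// ltr_ndivlMr// ltrBlDr lerBrDr (mulrC x a) andbC.
rewrite !lebesgue_measure_itv/= !lte_fin ltr_nM2r ?invr_lt0// ltrD2r.
case: ifPn => cd; last by rewrite mule0.
rewrite ltr0_norm// -!EFinB -EFinM; congr (_%:E).
by field; rewrite lt_eqF.
Qed.

Lemma ge0_integral_affine (F : R -> \bar R) :
  measurable_fun setT F -> (forall x, 0 <= F x)%E ->
  (\int[leb]_x F (a * x + b)%R = (`|a|^-1)%:E * \int[leb]_x F x)%E.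
Proof.
move=> mF F0.
rewrite [X in (_ * X)%E](eq_measure_integral (mscale absa (pushforward leb aff)));
  last by move=> A mA _; exact: lebesgue_measure_affine.
rewrite ge0_integral_mscale//.
rewrite ge0_integral_pushforward//= preimage_setT muleA -EFinM mulVf ?mul1e//.
by rewrite normr_eq0.
Qed.

End dimension1.

Lemma measurable_affine_rV (n : nat) (a : R) (b : 'rV[R]_n) :
  measurable_fun setT (fun v : 'rV[R]_n => a *: v + b).
Proof.
apply/measurable_fun_rVP => i.
rewrite (_ : _ \o _ = fun v : 'rV[R]_n => a * v ord0 i + b ord0 i); last first.
  by apply/funext => v; rewrite /= /coord_rV !mxE.
apply: (measurable_fun_coord (g := fun x => a * x + b ord0 i)).
by apply: measurable_funD => //; exact: measurable_funM.
Qed.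

(** Only homotheties composed with translations occur below: reflections, translations, dilations
    and the contraction towards a base point. Each coordinate contributes one factor [|a|^-1]. *)
Lemma ge0_integral_affine_rV (n : nat) (a : R) (b : 'rV[R]_n)
    (F : 'rV[R]_n -> \bar R) : a != 0 ->
  measurable_fun setT F -> (forall x, 0 <= F x)%E ->
  (\int[lebesgue_rV R n]_v F (a *: v + b)%R =
   ((`|a| ^+ n)^-1)%:E * \int[lebesgue_rV R n]_v F v)%E.
Proof.
move=> a0; elim: n b F => [|n IH] b F mF F0.
  rewrite expr0 invr1 mul1e; apply: eq_integral => v _; congr F.
  by apply/rowP; case.
have mFc x : measurable_fun setT (fun v : 'rV[R]_n => F (cons_rV (x, v))).
  apply: (measurableT_comp mF); apply: measurableT_comp.
    exact: measurable_cons_rV.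
  exact: pair1_measurable.
rewrite ge0_integral_cons//; last exact: (measurableT_comp mF (measurable_affine_rV _ _)).
pose b' : 'rV[R]_n := \row_i b ord0 (lift ord0 i).
pose G x := (\int[lebesgue_rV R n]_v F (cons_rV (x, v)))%E.
have mG : measurable_fun setT G.
  apply: (@measurable_fun_fubini_tonelli_F _ _ _ _ _ (lebesgue_rV R n)
    (F \o @cons_rV R n)) => [|x]; last exact: F0.
  by apply: (measurableT_comp mF); exact: measurable_cons_rV.
have G0 x : (0 <= G x)%E by exact: integral_ge0.
transitivity (\int[leb]_x (((`|a| ^+ n)^-1)%:E * G (a * x + b ord0 ord0)%R))%E.
  apply: eq_integral => x _; rewrite /G -(IH b')//.
  apply: eq_integral => v _; congr F; apply/rowP => i.
  rewrite [in LHS]mxE [X in X + _]mxE; case: (unliftP ord0 i) => [j|] ->.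
    by rewrite !cons_rVS [in RHS]mxE [in X in _ = X + _]mxE [in X in _ = _ + X]mxE.
  by rewrite !cons_rV0.
have mGa : measurable_fun setT (fun x => G (a * x + b ord0 ord0)).
  apply: (measurableT_comp mG).
  by apply: measurable_funD => //; exact: measurable_funM.
rewrite (ge0_integralZl_EFin _ _ _ _ _)//.
rewrite (ge0_integral_affine _ a0)// -ge0_integral_cons// muleA -EFinM.
by rewrite exprSr invfM.
Qed.

Lemma negligible_affine_rV (n : nat) (a : R) (b : 'rV[R]_n) (P : set 'rV[R]_n) :
  a != 0 -> {ae lebesgue_rV R n, forall x, P x} ->
  {ae lebesgue_rV R n, forall x, P (a *: x + b)}.
Proof.
move=> a0 [N [mN N0 PN]].
exists ((fun x => a *: x + b) @^-1` N); split.
- rewrite -[X in measurable X]setTI; exact: measurable_affine_rV.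
- have mN' : measurable ((fun x => a *: x + b) @^-1` N).
    by rewrite -[X in measurable X]setTI; exact: measurable_affine_rV.
  transitivity (\int[lebesgue_rV R n]_x (\1_N (a *: x + b))%:E)%E.
    by rewrite (integral_indic _ measurableT mN') ?setIT.
  rewrite (@ge0_integral_affine_rV n a b (fun x => (\1_N x)%:E))//.
  + by rewrite integral_indic// setIT [X in (_ * X)%E]N0 mule0.
  + by apply/measurable_EFinP.
- by move=> x /= Px; exact: PN.
Qed.

End affine_change_of_variables.

(** * A determinant inequality *)

Section determinant_uncertainty.
Variable F : realFieldType.

Definition bilin n (p : 'rV[F]_n) (M : 'M[F]_n) (q : 'rV[F]_n) : F :=
  (p *m M *m q^T) 0 0.

Lemma bilin_block n (p1 q1 : F) (p2 q2 : 'rV[F]_n) (m : F) b c (M : 'M[F]_n) :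
  bilin (row_mx p1%:M p2 : 'rV_(1 + n)) (block_mx m%:M b c M) (row_mx q1%:M q2) =
  p1 * m * q1 + p1 * (b *m q2^T) 0 0 + (p2 *m c) 0 0 * q1 + bilin p2 M q2.
Proof.
have E (A B : 'M[F]_1) : (A + B) 0 0 = A 0 0 + B 0 0 by rewrite mxE.
have S (a : F) (A : 'M[F]_1) : (a *: A) 0 0 = a * A 0 0 by rewrite mxE.
rewrite /bilin mul_row_block tr_row_mx mul_row_col !mulmxDl tr_scalar_mx.
rewrite !mul_mx_scalar !mul_scalar_mx -scalemxAl !E !S [p1%:M _ _]mxE eqxx mulr1n.
ring.
Qed.

(** For symmetric M and N this says that the block matrix with diagonal blocks M, N and off-diagonal
    blocks -1 is positive semidefinite, in other words N >= M^-1. *)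
Definition dual_pair n (M N : 'M[F]_n) :=
  forall p q, 2 * (p *m q^T) 0 0 <= bilin p M p + bilin q N q.

(** Induction on the dimension by Schur complements, which avoids eigenvalues. A congruence acting
    on M and the contragredient one acting on N preserve the pairing of p and q, so M may be reduced
    to block diagonal form. *)
Lemma det_dual_pair n (M N : 'M[F]_n) :
  M^T = M -> N^T = N -> dual_pair M N -> 0 < \det M /\ 1 <= \det M * \det N.
Proof.
elim: n M N => [|n IH] M N; first by rewrite !det_mx00 mulr1.
change (n.+1) with (1 + n)%N in M, N |- *.
rewrite -[M]submxK -[N]submxK.
rewrite [ulsubmx M]mx11_scalar [ulsubmx N]mx11_scalar.
set m := ulsubmx M 0 0; set k := ulsubmx N 0 0.
set b := ursubmx M; set b' := dlsubmx M; set M' := drsubmx M.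
set c := ursubmx N; set c' := dlsubmx N; set N' := drsubmx N.
move: m k b b' M' c c' N' => {M N} m k b b' M' c c' N'.
rewrite !tr_block_mx !tr_scalar_mx.
move=> /eq_block_mx[_ eb _ eM] /eq_block_mx[_ ec _ eN]; subst b c => MN.
(* Test on multiples of the first basis vector, by [|k| + 1] for p and 1 for q: if m were
   nonpositive, 2 ([|k|] + 1) <= k would follow. *)
have m_gt0 : 0 < m.
  rewrite ltNge; apply/negP => m_le0.
  have := MN (row_mx (`|k| + 1)%:M 0) (row_mx 1%:M 0).
  rewrite !bilin_block /bilin tr_row_mx mul_row_col !trmx0 !mulmx0 !mul0mx.
  rewrite tr_scalar_mx -scalar_mxM !mxE.
  rewrite eqxx mulr1n; have := ler_norm k; have k0 := normr_ge0 k.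
  have : (`|k| + 1) * m * (`|k| + 1) <= 0.
    by rewrite mulrAC mulr_ge0_le0// -expr2 sqr_ge0.
  lra.
have m_neq0 : m != 0 by rewrite gt_eqF.
(* P clears the first row and column of M outside the diagonal; Q is its inverse, so replacing p by
   p P and q by q Q^T leaves p q^T unchanged. *)
pose P : 'M[F]_(1 + n) := block_mx 1%:M 0 (- m^-1 *: b') 1%:M.
pose Q : 'M[F]_(1 + n) := block_mx 1%:M 0 (m^-1 *: b') 1%:M.
set M := block_mx m%:M _ _ _; set N := block_mx k%:M _ _ _.
have PQ : P *m Q = 1%:M.
  rewrite /P /Q mulmx_block !mul1mx !mulmx1 !mul0mx !mulmx0 !addr0 add0r.
  by rewrite scaleNr addNr -scalar_mx_block.
have dP : \det P = 1 by rewrite /P det_lblock !det1 mulr1.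
have dQ : \det Q = 1 by rewrite /Q det_lblock !det1 mulr1.
pose M2 := M' - m^-1 *: (b' *m b'^T).
have PMP : P *m M *m P^T = block_mx m%:M 0 0 M2.
  have -> : P *m M = block_mx m%:M b'^T 0 M2.
    rewrite /P /M mulmx_block !mul1mx !mul0mx !addr0 mul_mx_scalar scalerA.
    by rewrite mulrN mulfV// scaleN1r addNr -scalemxAl scaleNr addrC.
  rewrite /P tr_block_mx !trmx1 trmx0 linearZ/= mulmx_block !mulmx1 !mulmx0.
  rewrite !mul0mx !addr0 !add0r mul_scalar_mx scalerA mulrN mulfV// scaleN1r.
  by rewrite addNr.
have [k2 [c2 [N2 QNQ]]] : exists k2 c2 N2,
    Q^T *m N *m Q = block_mx k2%:M c2^T c2 N2 /\ N2^T = N2.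
  have sym : (Q^T *m N *m Q)^T = Q^T *m N *m Q.
    rewrite !trmx_mul trmxK mulmxA; congr (_ *m _ *m _).
    by rewrite /N tr_block_mx trmxK tr_scalar_mx eN.
  move: sym; set X := Q^T *m N *m Q => sym.
  exists (ulsubmx X 0 0), (dlsubmx X), (drsubmx X); split; last first.
    by rewrite trmx_drsub sym.
  by rewrite -mx11_scalar trmx_dlsub sym submxK.
case: QNQ => QNQ symN2.
have symM2 : M2^T = M2.
  by rewrite /M2 linearB/= linearZ/= trmx_mul trmxK eM.
have detM : \det M = m * \det M2.
  transitivity (\det (P *m M *m P^T)).
    by rewrite !det_mulmx det_tr dP mul1r mulr1.
  by rewrite PMP det_ublock det_scalar1.
have detN : \det N = \det (block_mx k2%:M c2^T c2 N2).
  by rewrite -QNQ !det_mulmx det_tr dQ mul1r mulr1.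
have MN2 : dual_pair (block_mx m%:M 0 0 M2) (block_mx k2%:M c2^T c2 N2).
  move=> p q; have := MN (p *m P) (q *m Q^T).
  rewrite /bilin !trmx_mul trmxK !mulmxA -(mulmxA p P Q) PQ mulmx1.
  by rewrite -(mulmxA p P) -(mulmxA p _ P^T) PMP -(mulmxA q Q^T) -(mulmxA q _ Q) QNQ.
have [dM2 dMN2] : 0 < \det M2 /\ 1 <= \det M2 * \det N2.
  apply: IH => // p q; have := MN2 (row_mx 0%:M p) (row_mx 0%:M q).
  rewrite !bilin_block tr_row_mx mul_row_col tr_scalar_mx -scalar_mxM !mxE.
  by rewrite !mul0r !mulr0 !add0r.
have N2u : N2 \in unitmx.
  rewrite unitmxE unitfE; apply/negP => /eqP d0; move: dMN2.
  by rewrite d0 mulr0 ler10.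
(* The Schur complement of N2 in the transformed N; the determinant of N is s times that of N2. *)
pose s := k2 - (c2^T *m invmx N2 *m c2) 0 0.
have detN2 : \det N = s * \det N2.
  pose E : 'M[F]_(1 + n) := block_mx 1%:M 0 (- (invmx N2 *m c2)) 1%:M.
  have dE : \det E = 1 by rewrite /E det_lblock !det1 mulr1.
  rewrite detN -[LHS]mulr1 -dE -det_mulmx mulmx_block.
  rewrite !mulmx1 !mulmx0 !add0r !mulmxN (mulmxA N2) mulmxV// mul1mx subrr.
  rewrite det_ublock mulmxA [X in \det X * _]mx11_scalar det_scalar1.
  by congr (_ * _); rewrite /s mxE [X in X + _]mxE [X in _ + X]mxE eqxx mulr1n.
(* The second block of q is the minimizer of the N-form once its first coordinate is m; the form
   then equals m^2 s, and the dual pair inequality becomes m <= m (m s). *)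
have ms : 1 <= m * s.
  pose w := c2^T *m invmx N2; pose x := (w *m c2) 0 0.
  have wT : w^T = invmx N2 *m c2 by rewrite trmx_mul trmxK trmx_inv symN2.
  have S (a : F) (A : 'M[F]_1) : (a *: A) 0 0 = a * A 0 0 by rewrite mxE.
  have := MN2 (row_mx 1%:M 0) (row_mx m%:M (- m *: w)).
  rewrite !bilin_block tr_row_mx mul_row_col tr_scalar_mx -scalar_mxM.
  rewrite /bilin linearZ/= wT -!scalemxAl -!scalemxAr.
  rewrite !mul0mx scaler0 addr0 (mulmxA c2^T) -/w.
  rewrite [w *m N2 *m _]mulmxA -[w *m N2 *m _]mulmxA mulmxV// mulmx1 !S -/x.
  have Z : (0 : 'M[F]_1) 0 0 = 0 by rewrite mxE.
  rewrite !Z mxE eqxx mulr1n => H.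
  have -> : s = k2 - x by [].
  have {}H : m <= m * (m * (k2 - x)) by lra.
  by rewrite -(ler_pM2l m_gt0) mulr1.
rewrite detM; split; first exact: mulr_gt0.
rewrite detN2 mulrACA; have : 0 < \det N2 by nra.
nra.
Qed.
End determinant_uncertainty.

(** * Gibbs measures of superlinear potentials *)

Section exponential_inequalities.
Context {R : realType}.
Implicit Types x y : R.

(** Termwise comparison of the tails: y^(i+3) / (i+3)! is at most [|y|]^3 times [|y|]^i / i!. *)
Lemma expR_le_taylor2 y :
  expR y <= 1 + y + y ^+ 2 / 2 + `|y| ^+ 3 * expR `|y|.
Proof.
have cv : (fun n => 1 + y + y ^+ 2 / 2 + `|y| ^+ 3 * series (exp_coeff `|y|) n)
    @ \oo --> 1 + y + y ^+ 2 / 2 + `|y| ^+ 3 * expR `|y|.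
  apply: cvgD; first exact: cvg_cst.
  by apply: cvgMr; exact: is_cvg_series_exp_coeff.
rewrite -(cvg_lim (@Rhausdorff R) cv) /expR.
apply: ler_lim; [exact: is_cvg_series_exp_coeff|by apply/cvg_ex; eexists; exact: cv|].
near=> n.
have [m ->] : exists m, n = (m + 3)%N.
  by exists (n - 3)%N; rewrite subnK//; near: n; exists 3%N.
rewrite /series /= (@big_cat_nat _ _ _ 3)//=; last by rewrite leq_addl.
apply: lerD.
  rewrite !big_nat_recl//= big_nil /exp_coeff /= expr0 expr1 !divr1 addr0 addrA.
  by rewrite (_ : 2`!%:R = 2).
rewrite -{1}[3%N]add0n big_addn addnK.
rewrite (@big_cat_nat _ _ _ m 0 (m + 3)%N)//=; last by rewrite leq_addr.
rewrite mulrDr -[leLHS]addr0; apply: lerD; last first.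
  apply: mulr_ge0; first by rewrite exprn_ge0.
  by apply: sumr_ge0 => i _; rewrite /exp_coeff /= divr_ge0// exprn_ge0.
rewrite mulr_sumr; apply: ler_sum => i _.
rewrite /exp_coeff /= mulrA -exprD.
apply: (le_trans (ler_norm _)); rewrite normrM normrX addnC.
rewrite normfV normr_nat ler_wpM2l ?exprn_ge0//.
by rewrite lef_pV2 ?posrE ?ltr0n ?fact_gt0// ler_nat leq_fact ?leq_addl.
Unshelve. all: by end_near. Qed.

(** For nonnegative y, e^(-y) <= 1 / (1 + y) <= 1 - y + y^2. For negative y, the inequality e^(-y)
    <= 1 - y e^(-y) is used twice, and -y <= C bounds the remaining exponential. Potentials bounded
    below fit this shape. *)
Lemma expRN_le_taylor1 C y : 0 <= C -> - C <= y ->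
  expR (- y) <= 1 - y + y ^+ 2 * expR C.
Proof.
move=> C0 Cy; have [y0|y0] := leP 0 y.
  apply: (@le_trans _ _ (1 - y + y ^+ 2)); last first.
    by rewrite lerD2l ler_peMr ?sqr_ge0// -expR0 ler_expR.
  have h := expR_ge1Dx y; rewrite expRN.
  apply: (@le_trans _ _ (1 + y)^-1).
    by rewrite lef_pV2// ?posrE ?expR_gt0//; lra.
  rewrite -[leLHS]mul1r ler_pdivrMr; last lra.
  by have := mulr_ge0 y0 (sqr_ge0 y); nra.
have h := expR_ge1Dx y.
have e : expR y * expR (- y) = 1 by rewrite -expRD subrr expR0.
have h1 : expR (- y) <= 1 - y * expR (- y).
  by have := expR_gt0 (- y); nra.
apply: (le_trans h1); rewrite -addrA lerD2l.
have h2 : expR (- y) <= 1 - y * expR C.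
  apply: (le_trans h1); rewrite lerD2l lerN2 ler_nM2l// ler_expR; lra.
have := ler_wpM2l (_ : 0 <= - y) h2; nra.
Qed.

Lemma normr_le_expR_half y : `|y| <= 2 * expR (`|y| / 2).
Proof. by have := expR_ge1Dx (`|y| / 2); lra. Qed.

Lemma sqr_le_expR_half y : y ^+ 2 <= 8 * expR (`|y| / 2).
Proof.
have := @expR_ge1Dxn R (`|y| / 2) 1 _.
rewrite divr_ge0// => /(_ isT); rewrite expr_div_n real_normK ?num_real//.
by rewrite (_ : 2`!%:R = 2 :> R)// => h; lra.
Qed.

End exponential_inequalities.

Section integrability.
Context {R : realType}.
Local Notation leb := (@lebesgue_measure R).

(** Dominated by the exponential density of rate 1 plus its reflection. *)
Lemma integrable_expR_normN : leb.-integrable setT (EFin \o (fun x : R => expR (- `|x|))).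
Proof.
have i1 := @integrable_exponential_pdf R 1 ltr01.
have i2 : leb.-integrable setT (EFin \o (fun x => exponential_pdf 1 (- x))).
  apply/integrableP; split.
    apply/measurable_EFinP; apply: measurableT_comp => //.
    exact: measurable_exponential_pdf.
  rewrite (_ : (\int[leb]_x _ = \int[leb]_x `|(exponential_pdf 1 x)%:E|)%E); last first.
    have N10 : (-1 : R) != 0 by rewrite oppr_eq0 oner_eq0.
    have mF : measurable_fun [set: R] (fun x => `|(exponential_pdf 1 x)%:E|)%E.
      apply: measurableT_comp => //; apply/measurable_EFinP.
      exact: measurable_exponential_pdf.
    have := ge0_integral_affine 0 N10 mF (fun x => abse_ge0 _).
    rewrite normrN1 invr1 mul1e => <-.
    by apply: eq_integral => x _; rewrite /= mulN1r addr0.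
  by case/integrableP: i1.
apply: (le_integrable _ _ _ (integrableD _ i1 i2)) => //.
  apply/measurable_EFinP; apply: measurableT_comp => //.
  by apply: measurableT_comp => //; exact: measurableT_comp.
move=> x _ /=; rewrite lee_fin [leLHS]ger0_norm ?expR_ge0// [leRHS]ger0_norm; last first.
  by rewrite addr_ge0// exponential_pdf_ge0.
have [x0|x0] := leP 0 x.
  rewrite ger0_norm// exponential_pdfE// mul1r mulN1r lerDl.
  by rewrite exponential_pdf_ge0.
rewrite ltr0_norm// addrC exponential_pdfE; last by rewrite oppr_ge0 ltW.
rewrite mul1r mulN1r lerDl.
by rewrite exponential_pdf_ge0.
Qed.

(** The l1 norm is chosen because [expR (- norm1 x)] is a product over the coordinates, so that its
    integrability reduces to dimension 1. *)
Definition norm1 n (x : 'rV[R]_n) : R := \sum_(i < n) `|x ord0 i|.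

Lemma norm1_ge0 n (x : 'rV[R]_n) : 0 <= norm1 x.
Proof. exact: sumr_ge0. Qed.

Lemma measurable_norm1 n : measurable_fun setT (@norm1 n).
Proof.
apply: measurable_sum => i; apply: measurableT_comp => //.
exact: measurable_coord_rV.
Qed.

Lemma integrable_expR_norm1 n :
  (lebesgue_rV R n).-integrable setT (EFin \o (fun x => expR (- norm1 x))).
Proof.
have := @integrable_prod_coord R n (fun=> fun x => expR (- `|x|)) (fun=> integrable_expR_normN).
apply: eq_integrable => //= x _; congr (_%:E).
by rewrite /norm1 -sumrN expR_sum.
Qed.

Variable n : nat.
Local Notation V := 'rV[R]_n.
Local Notation lam := (lebesgue_rV R n).
Implicit Types (F G P psi : V -> R) (p v x : V).

Lemma integrable_le_expR_norm1 F C : measurable_fun setT F ->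
  (forall x, `|F x| <= C * expR (- norm1 x)) ->
  lam.-integrable setT (EFin \o F).
Proof.
move=> mF FC; apply: (le_integrable measurableT _ _
  (integrableZl measurableT C (integrable_expR_norm1 n))) => //.
  exact/measurable_EFinP.
by move=> x _ /=; rewrite lee_fin (le_trans (FC x))// ler_norm.
Qed.

(** Growth faster than every multiple of the norm. The class is stable under positive factors and
    linear tilts, and its Gibbs weights have all exponential moments. *)
Definition superlinear psi := forall b, exists C, forall x, b * norm1 x - C <= psi x.

Lemma integrable_superlinear psi P C b : measurable_fun setT psi ->
  measurable_fun setT P -> superlinear psi ->
  (forall x, `|P x| <= C * expR (b * norm1 x)) ->
  lam.-integrable setT (EFin \o (fun x => P x * expR (- psi x))).
Proof.
move=> mpsi mP spsi PC; have [D psiD] := spsi (b + 1).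
apply: (@integrable_le_expR_norm1 _ (C * expR D)).
  by apply: measurable_funM => //; apply: measurableT_comp => //; exact: measurableT_comp.
move=> x; rewrite normrM [`|expR _|]ger0_norm ?expR_ge0//.
apply: (@le_trans _ _ (C * expR (b * norm1 x) * expR (- psi x))).
  by rewrite ler_wpM2r// expR_ge0.
have C0 : 0 <= C.
  rewrite -(@pmulr_lge0 _ (expR (b * norm1 (0 : V)))) ?expR_gt0//.
  exact: (le_trans _ (PC 0)).
rewrite -!mulrA ler_wpM2l// -!expRD ler_expR.
have := psiD x; lra.
Qed.

Lemma integrable_expRN psi : measurable_fun setT psi -> superlinear psi ->
  lam.-integrable setT (EFin \o (fun x => expR (- psi x))).
Proof.
move=> mpsi spsi.
have c1 (x : V) : `|cst (1 : R) x| <= 1 * expR (0 * norm1 x).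
  by rewrite /= normr1 mul0r expR0 mulr1.
have := integrable_superlinear mpsi (measurable_cst (1 : R)) spsi c1.
by apply: eq_integrable => // x _ /=; rewrite mul1r.
Qed.

Lemma superlinearZ psi a : 0 < a -> superlinear psi ->
  superlinear (fun x => a * psi x).
Proof.
move=> a0 spsi b; have [C H] := spsi (b / a).
exists (a * C) => x; have := ler_wpM2l (ltW a0) (H x).
by rewrite mulrBr mulrA (mulrC a) divfK// gt_eqF.
Qed.

Lemma normr_dotmul v x : `|dotmul_rV v x| <= norm1 v * norm1 x.
Proof.
rewrite /dotmul_rV (le_trans (ler_norm_sum _ _ _))// /norm1 mulr_suml.
apply: ler_sum => i _; rewrite normrM ler_wpM2l//.
by rewrite (bigD1 i)//= lerDl sumr_ge0.
Qed.

Lemma measurable_dotmul v : measurable_fun setT (fun x => dotmul_rV v x).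
Proof.
apply: measurable_sum => i; apply: measurable_funM => //.
exact: measurable_coord_rV.
Qed.

Lemma superlinear_dotmul psi v : superlinear psi ->
  superlinear (fun x => psi x - dotmul_rV v x).
Proof.
move=> spsi b; have [C H] := spsi (b + norm1 v).
exists C => x; have := H x; have := normr_dotmul v x.
by rewrite mulrDl ler_norml => /andP[_]; lra.
Qed.

Lemma lebesgue_rV_box_itv (a b : 'I_n -> R) : (forall i, a i <= b i) ->
  lam [set x : V | forall i, a i <= x ord0 i <= b i] = (\prod_(i < n) (b i - a i))%:E.
Proof.
move=> ab; have := @lebesgue_rV_box R n (fun i => `[a i, b i]%classic) _.
rewrite (_ : [set v | _] = [set x : V | forall i, a i <= x ord0 i <= b i]); last first.
  by apply/seteqP; split => x /= + i => /(_ i); rewrite in_itv.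
move=> ->; last by move=> i; exact: measurable_itv.
rewrite -prodEFin; apply: eq_bigr => i _.
rewrite lebesgue_measure_itv/= lte_fin.
by have [->|abi] := eqVneq (a i) (b i); rewrite ?ltxx ?subrr// lt_neqAle abi ab.
Qed.

Lemma lebesgue_rV_gt0 : (0 < lam setT)%E.
Proof.
apply: (@lt_le_trans _ _ (lam [set x : V | forall i, 0 <= x ord0 i <= 1])).
  rewrite (lebesgue_rV_box_itv (a := fun=> 0) (b := fun=> 1))//.
  by rewrite subr0 big1// lte_fin.
apply: le_measure => //; rewrite inE//.
rewrite (_ : mkset _ = \bigcap_(i in [set: 'I_n]) (@coord_rV R n i @^-1` `[0, 1]%classic)).
  apply: fin_bigcap_measurable => // i _.
  rewrite -[X in measurable X]setTI.
  exact: (measurable_coord_rV i measurableT (measurable_itv _)).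
apply/seteqP; split=> [v vA i _|v vA i] /=; first by rewrite in_itv; exact: vA.
by have := vA i I; rewrite /= in_itv.
Qed.

Lemma Rintegral_expRN_gt0 psi : measurable_fun setT psi -> superlinear psi ->
  0 < \int[lam]_x expR (- psi x).
Proof.
move=> mpsi spsi; have ipsi := integrable_expRN mpsi spsi.
rewrite lt_neqAle Rintegral_ge0 ?andbT; last by move=> x _; exact: expR_ge0.
apply/eqP => /esym psi0.
have : (\int[lam]_x `|(expR (- psi x))%:E| = 0)%E.
  rewrite (eq_integral (EFin \o (fun x => expR (- psi x)))); last first.
    by move=> x _ /=; rewrite ger0_norm ?expR_ge0.
  by rewrite -[LHS]fineK ?(integrable_fin_num measurableT ipsi)//; congr EFin.
move=> /(ae_eq_integral_abs _ measurableT _).1 -[|N [mN N0 NE]].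
  by case/integrableP: ipsi.
have NT : N = setT.
  apply/seteqP; split => // x _; apply: NE => /= /(_ I)/eqP.
  by rewrite eqe expR_eq0.
by have := lebesgue_rV_gt0; rewrite -NT N0 ltxx.
Qed.

End integrability.

(** * Upper Taylor bounds for log-partition functions *)

Section log_partition.
Context {R : realType}.
Variable n : nat.
Local Notation V := 'rV[R]_n.
Local Notation lam := (lebesgue_rV R n).
Local Notation integrableV F := (lam.-integrable setT (EFin \o F)).
Implicit Types (F G P psi phi alpha : V -> R) (p v x w : V).

Lemma RintegralDZ F G a : integrableV F -> integrableV G ->
  integrableV (fun x => F x + a * G x) /\
  \int[lam]_x (F x + a * G x) = \int[lam]_x F x + a * \int[lam]_x G x.
Proof.
move=> iF iG; have iaG : integrableV (fun x => a * G x).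
  by apply: eq_integrable (integrableZl measurableT a iG).
split; last by rewrite RintegralD// RintegralZl.
by apply: eq_integrable (integrableD measurableT iF iaG).
Qed.

Definition partition_function psi := \int[lam]_x expR (- psi x).

Definition mean psi P := (\int[lam]_x (P x * expR (- psi x))) / partition_function psi.

Lemma partition_gt0 psi : measurable_fun setT psi -> superlinear psi ->
  0 < partition_function psi.
Proof. exact: Rintegral_expRN_gt0. Qed.

Lemma RintegralME psi P : measurable_fun setT psi -> superlinear psi ->
  \int[lam]_x (P x * expR (- psi x)) = mean psi P * partition_function psi.
Proof.
by move=> mpsi spsi; rewrite divfK// gt_eqF// partition_gt0.
Qed.

(** Factor out e^(s m) and expand e^(s Y) to second order, where Y is the centred linear form: the
    first-order term integrates to 0, the second gives the variance, and ln (1 + w) <= w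
    concludes. *)
Lemma ln_partition_taylor2 psi p :
  measurable_fun setT psi -> superlinear psi ->
  let m := mean psi (dotmul_rV p) in
  let v := mean psi (fun x => (dotmul_rV p x - m) ^+ 2) in
  exists2 C, 0 <= C & forall s, `|s| <= 1 ->
    ln (partition_function (fun x => psi x - s * dotmul_rV p x)) <=
    ln (partition_function psi) + s * m + s ^+ 2 / 2 * v + C * `|s| ^+ 3.
Proof.
move=> mpsi spsi m v; pose Y x := dotmul_rV p x - m.
have Z0 := partition_gt0 mpsi spsi; set Z := partition_function psi in Z0.
have mY : measurable_fun setT Y by apply: measurable_funB => //; exact: measurable_dotmul.
(* The weight e^(2 [|Y|]) dominates Y, Y^2 and the cubic remainder alike, and it is itself at most
   exponential in [norm1 x]. *)
have Yle x : expR (2 * `|Y x|) <= expR (2 * `|m|) * expR (2 * norm1 p * norm1 x).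
  rewrite -expRD ler_expR /Y; have := normr_dotmul p x.
  have := ler_normB (dotmul_rV p x) m; lra.
have e1 x : `|Y x| <= expR (2 * `|Y x|).
  by have := expR_ge1Dx (2 * `|Y x|); have := normr_ge0 (Y x); lra.
have e2 x : `|Y x ^+ 2| <= expR (2 * `|Y x|).
  have := @expR_ge1Dxn R (2 * `|Y x|) 1; rewrite (_ : 2`!%:R = 2 :> R)//.
  rewrite normrX => /(_ (mulr_ge0 _ _))-/(_ _ (normr_ge0 _)) h.
  by have := h (ler0n _ 2); have := sqr_ge0 `|Y x|; rewrite exprMn; lra.
have e3 x : `|(`|Y x| ^+ 3 * expR `|Y x|)| <= 6 * expR (2 * `|Y x|).
  rewrite ger0_norm; last by rewrite mulr_ge0// ?exprn_ge0 ?expR_ge0.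
  rewrite (_ : 2 * `|Y x| = `|Y x| + `|Y x|); last ring.
  rewrite expRD mulrA ler_wpM2r ?expR_ge0//.
  have := @expR_ge1Dxn R `|Y x| 2 (normr_ge0 _).
  by rewrite (_ : 3`!%:R = 6 :> R)//; lra.
have i0 := integrable_expRN mpsi spsi.
have iYk P c : measurable_fun setT P -> 0 <= c -> (forall x, `|P x| <= c * expR (2 * `|Y x|)) ->
    integrableV (fun x => P x * expR (- psi x)).
  move=> mP c0 PY; apply: (@integrable_superlinear _ _ psi P (c * expR (2 * `|m|)) (2 * norm1 p)) => //.
  by move=> x; apply: (le_trans (PY x)); rewrite -[leRHS]mulrA ler_wpM2l.
have iY : integrableV (fun x => Y x * expR (- psi x)).
  by apply: (iYk _ 1) => // x; rewrite mul1r.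
have iY2 : integrableV (fun x => Y x ^+ 2 * expR (- psi x)).
  by apply: (iYk _ 1) => //; [exact: measurable_funX|move=> x; rewrite mul1r].
pose P3 x := `|Y x| ^+ 3 * expR `|Y x|.
have mP3 : measurable_fun setT P3.
  apply: measurable_funM; first by apply: measurable_funX; exact: measurableT_comp.
  by do 2 apply: measurableT_comp => //.
have iY3 : integrableV (fun x => P3 x * expR (- psi x)).
  exact: (iYk _ 6).
have iX : integrableV (fun x => dotmul_rV p x * expR (- psi x)).
  apply: (@integrable_superlinear _ _ psi _ 1 (norm1 p)) => //.
    exact: measurable_dotmul.
  move=> x; rewrite mul1r (le_trans (normr_dotmul p x))//.
  by have := expR_ge1Dx (norm1 p * norm1 x); lra.
have EY0 : \int[lam]_x (Y x * expR (- psi x)) = 0.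
  have [_] := RintegralDZ (- m) iX i0.
  rewrite (_ : \int[lam]_x (_ + _) = \int[lam]_x (Y x * expR (- psi x))); last first.
    by apply: eq_Rintegral => x _; rewrite /Y; ring.
  move=> ->; rewrite RintegralME// -/m -[X in - m * X]/Z -/Z; ring.
pose K := \int[lam]_x (P3 x * expR (- psi x)).
have K0 : 0 <= K.
  by apply: Rintegral_ge0 => x _; rewrite /P3 !mulr_ge0 ?exprn_ge0 ?expR_ge0.
exists (K / Z); first by rewrite divr_ge0// ltW.
move=> s s1.
pose Q := (fun x => ((expR (- psi x) + s * (Y x * expR (- psi x)))
  + (s ^+ 2 / 2) * (Y x ^+ 2 * expR (- psi x)))
  + (`|s| ^+ 3) * (P3 x * expR (- psi x))).
have [iQ1 EQ1] := RintegralDZ s i0 iY.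
have [iQ2 EQ2] := RintegralDZ (s ^+ 2 / 2) iQ1 iY2.
have [iQ EQ] := RintegralDZ (`|s| ^+ 3) iQ2 iY3.
have EQ' : \int[lam]_x Q x = Z * (1 + (s ^+ 2 / 2 * v + K / Z * `|s| ^+ 3)).
  rewrite EQ EQ2 EQ1 EY0 mulr0 addr0 RintegralME// -/K -/v -[X in X + _ + _]/Z -/Z.
  by field; rewrite gt_eqF.
have spsi' : superlinear (fun x => psi x - s * dotmul_rV p x).
  have := superlinear_dotmul (s *: p) spsi.
  rewrite (_ : (fun x => _ - _) = fun x => psi x - s * dotmul_rV p x)//.
  apply/funext => x; congr (_ - _); rewrite /dotmul_rV mulr_sumr.
  by apply: eq_bigr => i _; rewrite mxE mulrA.
have mpsi' : measurable_fun setT (fun x => psi x - s * dotmul_rV p x).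
  by apply: measurable_funB => //; apply: measurable_funM => //; exact: measurable_dotmul.
have Z'0 := partition_gt0 mpsi' spsi'.
have i' := integrable_expRN mpsi' spsi'.
have le1 : partition_function (fun x => psi x - s * dotmul_rV p x) <= expR (s * m) * \int[lam]_x Q x.
  rewrite -RintegralZl//; apply: le_Rintegral => //.
    by apply: eq_integrable (integrableZl measurableT (expR (s * m)) iQ).
  move=> x _.
  have -> : expR (- (psi x - s * dotmul_rV p x)) = expR (s * m) * (expR (s * Y x) * expR (- psi x)).
    by rewrite -!expRD; congr expR; rewrite /Y; ring.
  rewrite ler_wpM2l ?expR_ge0//.
  have -> : Q x = (1 + s * Y x + (s * Y x) ^+ 2 / 2 + `|s| ^+ 3 * P3 x) * expR (- psi x).
    by rewrite /Q; field.
  rewrite ler_wpM2r ?expR_ge0//; apply: (le_trans (expR_le_taylor2 _)).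
  rewrite lerD2l /P3 normrM exprMn -mulrA ler_wpM2l ?exprn_ge0//.
  rewrite ler_wpM2l ?exprn_ge0// ler_expR.
  by rewrite -[leRHS]mul1r ler_wpM2r.
have y0 : 0 < 1 + (s ^+ 2 / 2 * v + K / Z * `|s| ^+ 3).
  have : 0 < Z * (1 + (s ^+ 2 / 2 * v + K / Z * `|s| ^+ 3)).
    by have := lt_le_trans Z'0 le1; rewrite EQ' (pmulr_rgt0 _ (expR_gt0 _)).
  by rewrite pmulr_rgt0.
apply: (@le_trans _ _ (ln (expR (s * m) * \int[lam]_x Q x))).
  by rewrite ler_ln ?posrE// EQ' !mulr_gt0 ?expR_gt0.
rewrite EQ' lnM ?posrE ?expR_gt0 ?mulr_gt0// expRK lnM ?posrE//.
have := @le_ln1Dx R (s ^+ 2 / 2 * v + K / Z * `|s| ^+ 3); lra.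
Qed.

Lemma superlinear_bounded phi : superlinear phi -> exists2 D, 0 <= D & forall x, - D <= phi x.
Proof.
move=> sphi; have [C H] := sphi 0; exists `|C| => // x.
by have := H x; rewrite mul0r; have := ler_norm C; lra.
Qed.

(** No exponential upper bound on phi is at hand, so [integrable_superlinear] does not apply to the
    factor phi. Half of the exponent absorbs the power of phi, and the other half, e^(-t phi / 2),
    remains integrable. *)
Lemma integrable_id_superlinear phi t : measurable_fun setT phi -> superlinear phi ->
  0 < t ->
  integrableV (fun x => phi x * expR (- (t * phi x))) /\
  integrableV (fun x => phi x ^+ 2 * expR (- (t * phi x))).
Proof.
move=> mphi sphi t0; have [D D0 phiD] := superlinear_bounded sphi.
have st := superlinearZ (divr_gt0 t0 (ltr0n _ 2)) sphi.
have mt : measurable_fun setT (fun x => t / 2 * phi x) by exact: measurable_funM.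
have i0 := integrable_expRN mt st.
have mE : measurable_fun setT (fun x => expR (- (t * phi x))).
  by do 2 apply: measurableT_comp => //; exact: measurable_funM.
have key c P : measurable_fun setT P ->
  (forall x, `|P x| <= c * expR (`|t * phi x| / 2)) ->
  integrableV (fun x => P x * expR (- (t * phi x))).
  move=> mP Pc; apply: (le_integrable measurableT _ _
    (integrableZl measurableT (c * expR (t * D)) i0)).
    by apply/measurable_EFinP; exact: measurable_funM.
  move=> x _ /=; rewrite lee_fin normrM [`|expR _|]ger0_norm ?expR_ge0//.
  apply: le_trans (ler_norm _).
  have c0 : 0 <= c.
    rewrite -(@pmulr_lge0 _ (expR (`|t * phi x| / 2)))  ?expR_gt0//.
    exact: (le_trans _ (Pc x)).
  apply: (@le_trans _ _ (c * expR (`|t * phi x| / 2) * expR (- (t * phi x)))).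
    by rewrite ler_wpM2r// expR_ge0.
  rewrite -!mulrA ler_wpM2l// -!expRD ler_expR.
  have : `|t * phi x| <= t * phi x + 2 * (t * D).
    have tD : 0 <= t * D by rewrite mulr_ge0// ltW.
    have tp : - (t * D) <= t * phi x by rewrite -mulrN ler_pM2l.
    by rewrite ler_norml; apply/andP; split; lra.
  lra.
split.
  apply: (key (2 / t)) => // x.
  have := normr_le_expR_half (t * phi x); set e := expR _.
  by rewrite normrM gtr0_norm// mulrAC ler_pdivlMr// [_ * t]mulrC.
apply: (key (8 / t ^+ 2)); first exact: measurable_funX.
move=> x; have := sqr_le_expR_half (t * phi x); set e := expR _.
by rewrite ger0_norm ?sqr_ge0// mulrAC ler_pdivlMr ?exprn_gt0// exprMn [_ * t ^+ 2]mulrC.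
Qed.

(** Restricted to tau >= 0 because t will be minimized over 1 <= t, where only a right derivative is
    available. With tau <= 1, tau phi is bounded below by the same -D as phi, as [expRN_le_taylor1]
    requires. *)
Lemma ln_partition_taylor1 phi t : measurable_fun setT phi -> superlinear phi ->
  0 < t ->
  exists2 C, 0 <= C & forall tau, 0 <= tau <= 1 ->
    ln (partition_function (fun x => (t + tau) * phi x)) <=
    ln (partition_function (fun x => t * phi x)) -
    tau * mean (fun x => t * phi x) phi + C * tau ^+ 2.
Proof.
move=> mphi sphi t0; have [D D0 phiD] := superlinear_bounded sphi.
have [i1 i2] := integrable_id_superlinear mphi sphi t0.
have st := superlinearZ t0 sphi.
have mt a : measurable_fun setT (fun x => a * phi x) by exact: measurable_funM.
have i0 := integrable_expRN (mt t) st.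
have Z0 := partition_gt0 (mt t) st; set Z := partition_function _ in Z0 *.
set m := mean _ _.
pose K := expR D * \int[lam]_x (phi x ^+ 2 * expR (- (t * phi x))).
have K0 : 0 <= K.
  rewrite mulr_ge0 ?expR_ge0//.
  by apply: Rintegral_ge0 => x _; rewrite mulr_ge0 ?sqr_ge0 ?expR_ge0.
exists (K / Z); first by rewrite divr_ge0// ltW.
move=> tau /andP[tau0 tau1].
have [iQ1 EQ1] := RintegralDZ (- tau) i0 i1.
have [iQ EQ] := RintegralDZ (tau ^+ 2 * expR D) iQ1 i2.
set Q := (fun x => _) in iQ EQ.
have EQ' : \int[lam]_x Q x = Z * (1 + (- tau * m + K / Z * tau ^+ 2)).
  rewrite EQ EQ1 RintegralME// -/m -[X in X + _ + _]/Z -/Z /K.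
  by field; rewrite gt_eqF.
have tt0 : 0 < t + tau by lra.
have s' := superlinearZ tt0 sphi.
have Z'0 := partition_gt0 (mt _) s'.
have i' := integrable_expRN (mt _) s'.
have le1 : partition_function (fun x => (t + tau) * phi x) <= \int[lam]_x Q x.
  apply: le_Rintegral => // x _.
  have -> : expR (- ((t + tau) * phi x)) = expR (- (tau * phi x)) * expR (- (t * phi x)).
    by rewrite -expRD; congr expR; ring.
  have -> : Q x = (1 - (tau * phi x) + (tau * phi x) ^+ 2 * expR D) * expR (- (t * phi x)).
    by rewrite /Q; ring.
  rewrite ler_wpM2r ?expR_ge0//; apply: expRN_le_taylor1 => //.
  by have := phiD x; nra.
have y0 : 0 < 1 + (- tau * m + K / Z * tau ^+ 2).
  have := lt_le_trans Z'0 le1; rewrite EQ' pmulr_rgt0//.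
apply: (@le_trans _ _ (ln (\int[lam]_x Q x))).
  by rewrite ler_ln ?posrE// EQ' mulr_gt0.
rewrite EQ' lnM ?posrE//.
have := @le_ln1Dx R (- tau * m + K / Z * tau ^+ 2); lra.
Qed.

End log_partition.

Section continuity.
Context {R : realType}.
Variable n : nat.
Local Notation V := 'rV[R]_n.
Local Notation lam := (lebesgue_rV R n).
Local Notation integrableV F := (lam.-integrable setT (EFin \o F)).
Implicit Types (F G P psi phi alpha : V -> R) (p v x w : V).

Lemma expRN_lipschitz (p q : R) :
  `|expR (- p) - expR (- q)| <= `|p - q| * (expR (- p) + expR (- q)).
Proof.
wlog pq : p q / p <= q => [H|].
  have [pq|/ltW qp] := leP p q; first exact: H.
  by rewrite distrC [`|p - q|]distrC [X in _ * X]addrC; exact: H.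
rewrite ger0_norm; last by rewrite subr_ge0 ler_expR lerN2.
rewrite distrC ger0_norm ?subr_ge0//.
have h := expR_ge1Dx (p - q).
have -> : expR (- q) = expR (- p) * expR (p - q) by rewrite -expRD; congr expR; ring.
have e0 := expR_gt0 (- p).
have := ler_wpM2l (ltW e0) h.
have : 0 <= (q - p) * (expR (- p) * expR (p - q)).
  by rewrite !mulr_ge0 ?expR_ge0 ?subr_ge0.
lra.
Qed.

Lemma norm1N w : norm1 (- w) = norm1 w.
Proof. by apply: eq_bigr => i _; rewrite mxE normrN. Qed.

Lemma dotmul_rVDl v w x : dotmul_rV (v + w) x = dotmul_rV v x + dotmul_rV w x.
Proof. by rewrite -big_split; apply: eq_bigr => i _; rewrite mxE mulrDl. Qed.

Lemma dotmul_rVZl a v x : dotmul_rV (a *: v) x = a * dotmul_rV v x.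
Proof. by rewrite mulr_sumr; apply: eq_bigr => i _; rewrite mxE mulrA. Qed.

Lemma measurable_tilt alpha v t : measurable_fun setT alpha ->
  measurable_fun setT (fun x => t * (alpha x - dotmul_rV v x)).
Proof.
move=> ma; apply: measurable_funM => //; apply: measurable_funB => //.
exact: measurable_dotmul.
Qed.

Lemma superlinear_tilt alpha v t : superlinear alpha -> 0 < t ->
  superlinear (fun x => t * (alpha x - dotmul_rV v x)).
Proof. by move=> sa t0; apply: superlinearZ => //; exact: superlinear_dotmul. Qed.

(** For t within t0 / 2 of t0, both exponentials are bounded by e^(-t0 phi / 2) times an exponential
    of [norm1]. This exponent is split in two quarters of t0 phi: one absorbs the factor [|phi|] in
    P, the other keeps the product integrable. *)
Lemma partition_lipschitz alpha t0 v0 :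
  measurable_fun setT alpha -> superlinear alpha -> 0 < t0 ->
  exists2 C, 0 <= C & forall t w, `|t - t0| <= t0 / 2 -> norm1 w <= 1 ->
   `|partition_function (fun x => t * (alpha x - dotmul_rV (v0 + w) x)) -
     partition_function (fun x => t0 * (alpha x - dotmul_rV v0 x))| <=
   C * (`|t - t0| + norm1 w).
Proof.
move=> ma sa t0_gt0; pose phi x := alpha x - dotmul_rV v0 x.
have sphi : superlinear phi by exact: superlinear_dotmul.
have mphi : measurable_fun setT phi.
  by apply: measurable_funB => //; exact: measurable_dotmul.
have [D D0 phiD] := superlinear_bounded sphi.
pose A := 2 * expR (2 * t0 * D).
pose P x := (`|phi x| + 2 * t0 * norm1 x) * expR (- (t0 / 4 * phi x)) *
  (A * expR (2 * t0 * norm1 x)).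
have A0 : 0 <= A by rewrite mulr_ge0// expR_ge0.
have P0 x : 0 <= P x.
  by rewrite !mulr_ge0 ?expR_ge0// addr_ge0// !mulr_ge0 ?norm1_ge0// ltW.
have mP : measurable_fun setT P.
  have m1 := @measurable_norm1 R n.
  apply: measurable_funM.
    apply: measurable_funM.
      apply: measurable_funD; first exact: measurableT_comp.
      exact: measurable_funM.
    by do 2 apply: measurableT_comp => //; exact: measurable_funM.
  apply: measurable_funM => //.
  by apply: measurableT_comp => //; exact: measurable_funM.
have s4 : superlinear (fun x => t0 / 4 * phi x).
  by apply: superlinearZ => //; rewrite divr_gt0.
have m4 : measurable_fun setT (fun x => t0 / 4 * phi x) by exact: measurable_funM.
pose c1 := 4 / t0 * expR (t0 * D / 2) + 2 * t0 * expR (t0 * D / 4).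
have PC x : `|P x| <= (c1 * A) * expR ((2 * t0 + 1) * norm1 x).
  rewrite ger0_norm// /P.
  have n1 := norm1_ge0 x.
  apply: (@le_trans _ _ (c1 * expR (norm1 x) * (A * expR (2 * t0 * norm1 x)))); last first.
    have -> : (2 * t0 + 1) * norm1 x = 2 * t0 * norm1 x + norm1 x by ring.
    rewrite expRD; set e1 := expR _; set e2 := expR _.
    by rewrite le_eqVlt; apply/orP; left; apply/eqP; ring.
  rewrite ler_wpM2r ?mulr_ge0 ?expR_ge0//.
  have eN : expR (norm1 x) >= 1 by rewrite -expR0 ler_expR.
  rewrite /c1 [leLHS]mulrDl [leRHS]mulrDl; apply: lerD.
    apply: (@le_trans _ _ (4 / t0 * expR (t0 * D / 2))); last first.
      by rewrite ler_peMr// mulr_ge0 ?expR_ge0// divr_ge0// ltW.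
    have := normr_le_expR_half (t0 / 2 * phi x).
    rewrite normrM gtr0_norm ?divr_gt0// => h.
    have h2 : `|phi x| <= phi x + 2 * D by have := phiD x; rewrite ler_norml => ?; apply/andP; split; lra.
    have h3 : `|phi x| <= 4 / t0 * expR (t0 / 2 * `|phi x| / 2).
      by rewrite mulrAC ler_pdivlMr// mulrC; lra.
    apply: (@le_trans _ _ (4 / t0 * expR (t0 / 2 * `|phi x| / 2) * expR (- (t0 / 4 * phi x)))).
      by rewrite ler_wpM2r ?expR_ge0.
    rewrite -[leLHS]mulrA ler_wpM2l ?divr_ge0 ?(ltW t0_gt0)//.
    rewrite -expRD ler_expR; nra.
  rewrite (mulrAC _ (norm1 x)) -[leLHS]mulrA -[leRHS]mulrA.
  rewrite ler_wpM2l ?mulr_ge0 ?(ltW t0_gt0)//.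
  apply: ler_pM; rewrite ?expR_ge0//.
    by rewrite ler_expR; have := phiD x; nra.
  by have := expR_ge1Dx (norm1 x); lra.
have iG := integrable_superlinear m4 mP s4 PC.
pose C := \int[lam]_x (P x * expR (- (t0 / 4 * phi x))).
have C0 : 0 <= C by apply: Rintegral_ge0 => x _; rewrite mulr_ge0 ?expR_ge0.
exists C => // t w tt0 w1.
have t_gt0 : 0 < t by move: tt0; rewrite ler_norml => /andP[]; lra.
have tle : t0 / 2 <= t <= 2 * t0 by move: tt0; rewrite ler_norml => /andP[? ?]; apply/andP; split; lra.
set Z1 := partition_function _; set Z2 := partition_function _.
have i1 := integrable_expRN (measurable_tilt (v0 + w) t ma) (superlinear_tilt (v0 + w) sa t_gt0).
have i2 := integrable_expRN (measurable_tilt v0 t0 ma) (superlinear_tilt v0 sa t0_gt0).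
rewrite /Z1 /Z2 /partition_function -RintegralB//.
have iD : integrableV (fun x => expR (- (t * (alpha x - dotmul_rV (v0 + w) x))) -
    expR (- (t0 * (alpha x - dotmul_rV v0 x)))).
  by apply: eq_integrable (integrableB measurableT i1 i2).
apply: (le_trans (le_normr_Rintegral measurableT iD)).
rewrite mulrC -RintegralZl//; apply: le_Rintegral => //.
- by apply: eq_integrable (integrable_norm iD).
- by apply: eq_integrable (integrableZl measurableT (`|t - t0| + norm1 w) iG).
move=> x _; apply: (le_trans (expRN_lipschitz _ _)).
have -> : t * (alpha x - dotmul_rV (v0 + w) x) = t * phi x - t * dotmul_rV w x.
  by rewrite dotmul_rVDl /phi; ring.
rewrite -/(phi x).
have n1 := norm1_ge0 x; have nw := norm1_ge0 w.
have dw := normr_dotmul w x.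
have dw1 : `|t * dotmul_rV w x| <= 2 * t0 * norm1 x * norm1 w.
  rewrite normrM gtr0_norm// -[leRHS]mulrA; apply: ler_pM => //; first exact: ltW.
    by case/andP: tle.
  by rewrite mulrC.
have lhs : `|t * phi x - t * dotmul_rV w x - t0 * phi x| <=
    (`|t - t0| + norm1 w) * (`|phi x| + 2 * t0 * norm1 x).
  have -> : t * phi x - t * dotmul_rV w x - t0 * phi x = (t - t0) * phi x - t * dotmul_rV w x by ring.
  apply: (le_trans (ler_normB _ _)); rewrite normrM.
  have h1 : 0 <= norm1 w * `|phi x| by rewrite mulr_ge0.
  have h2 : 0 <= `|t - t0| * (2 * t0 * norm1 x) by rewrite !mulr_ge0// ltW.
  lra.
have e1 : expR (- (t * phi x - t * dotmul_rV w x)) + expR (- (t0 * phi x)) <=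
    expR (- (t0 / 2 * phi x)) * (A * expR (2 * t0 * norm1 x)).
  have -> : expR (- (t0 / 2 * phi x)) * (A * expR (2 * t0 * norm1 x)) =
    expR (- (t0 / 2 * phi x) + 2 * t0 * D + 2 * t0 * norm1 x) +
    expR (- (t0 / 2 * phi x) + 2 * t0 * D + 2 * t0 * norm1 x).
    by rewrite !expRD /A; ring.
  have pD := phiD x.
  have h3 : 2 * t0 * norm1 x * norm1 w <= 2 * t0 * norm1 x.
    by rewrite ler_piMr// !mulr_ge0// ltW.
  have h4 : 0 <= 2 * t0 * norm1 x by rewrite !mulr_ge0// ltW.
  case/andP: tle => t1 t2.
  apply: lerD; rewrite ler_expR.
    have : (t - t0 / 2) * (phi x + D) >= 0 by rewrite mulr_ge0//; lra.
    have : (2 * t0 - t) * D >= 0 by rewrite mulr_ge0//; lra.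
    have : 0 <= t0 * D by rewrite mulr_ge0// ltW.
    by move: dw1; rewrite ler_norml => /andP[]; lra.
  have : (t0 / 2) * (phi x + D) >= 0 by rewrite mulr_ge0//; lra.
  have : 0 <= t0 * D by rewrite mulr_ge0// ltW.
  lra.
have -> : (`|t - t0| + norm1 w) * (P x * expR (- (t0 / 4 * phi x))) =
  ((`|t - t0| + norm1 w) * (`|phi x| + 2 * t0 * norm1 x)) *
   (expR (- (t0 / 2 * phi x)) * (A * expR (2 * t0 * norm1 x))).
  have -> : expR (- (t0 / 2 * phi x)) = expR (- (t0 / 4 * phi x)) * expR (- (t0 / 4 * phi x)).
    by rewrite -expRD; congr expR; field.
  by rewrite /P; ring.
by apply: ler_pM => //; rewrite addr_ge0 ?expR_ge0.
Qed.

Lemma continuous_rV_coord (i : 'I_n) : continuous (fun v : V => v ord0 i).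
Proof. exact: coord_continuous. Qed.

Lemma continuous_ln_partition alpha (z : R * V) :
  measurable_fun setT alpha -> superlinear alpha -> 0 < z.1 ->
  {for z, continuous (fun y : R * V =>
    ln (partition_function (fun x => y.1 * (alpha x - dotmul_rV y.2 x))))}.
Proof.
move=> ma sa z0; have [C C0 H] := partition_lipschitz z.2 ma sa z0.
have Z0 := partition_gt0 (measurable_tilt z.2 z.1 ma) (superlinear_tilt z.2 sa z0).
pose f (y : R * V) : R := partition_function (fun x => y.1 * (alpha x - dotmul_rV y.2 x)).
suff : {for z, continuous f}.
  by move=> cf; exact: (continuous_comp cf (continuous_ln Z0)).
pose g (y : R * V) := `|y.1 - z.1| + norm1 (y.2 - z.2).
have gz : g z = 0.
  by rewrite /g !subrr normr0 add0r /norm1 big1// => i _; rewrite mxE normr0.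
have cg : g y @[y --> z] --> g z.
  apply: cvgD.
    apply: cvg_norm; apply: cvgB; [exact: cvg_fst|exact: cvg_cst].
  apply: cvg_big => [|i _]; first exact: add_continuous.
  rewrite (_ : (fun y : R * V => _) = fun y => `|y.2 ord0 i - z.2 ord0 i|); last first.
    by apply/funext => y; rewrite !mxE.
  rewrite !mxE; apply: cvg_norm; apply: cvgB; last exact: cvg_cst.
  apply: (@continuous_comp _ _ _ snd (fun v : V => v ord0 i)); first exact: cvg_snd.
  exact: continuous_rV_coord.
have B0 : 0 < C + 1 by lra.
apply/cvgrPdist_le => /= e e0.
have d0 : 0 < Num.min (z.1 / 2) (Num.min 1 (e / (C + 1))).
  by rewrite !lt_min divr_gt0//= ltr01 divr_gt0.
move/cvgrPdist_le: cg => /(_ _ d0); rewrite gz; apply: filterS => y.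
rewrite sub0r normrN !le_min.
have g1 : 0 <= `|y.1 - z.1| by [].
have g2 := norm1_ge0 (y.2 - z.2).
rewrite ger0_norm; last by rewrite addr_ge0.
rewrite /g => /and3P[y1 y2 y3].
have := H y.1 (y.2 - z.2).
have -> : z.2 + (y.2 - z.2) = y.2 by rewrite addrC subrK.
rewrite -/(f y) -/(f z) => h; rewrite distrC; apply: (le_trans (h _ _)); [lra|lra|].
by move: y3; rewrite ler_pdivlMr//; nra.
Qed.

End continuity.

(** * Slicing and the free energy *)

Section covariance.
Context {R : realType}.
Variable n : nat.
Local Notation V := 'rV[R]_n.
Local Notation lam := (lebesgue_rV R n).
Local Notation integrableV F := (lam.-integrable setT (EFin \o F)).
Implicit Types (F G P psi phi alpha : V -> R) (p v x w : V).

Lemma mean_sum psi (I : Type) (r : seq I) (a : I -> R) (F : I -> V -> R) :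
  measurable_fun setT psi -> superlinear psi ->
  (forall i, integrableV (fun x => F i x * expR (- psi x))) ->
  integrableV (fun x => (\sum_(i <- r) a i * F i x) * expR (- psi x)) /\
  mean psi (fun x => \sum_(i <- r) a i * F i x) = \sum_(i <- r) a i * mean psi (F i).
Proof.
move=> mpsi spsi iF; have Z0 := partition_gt0 mpsi spsi.
elim: r => [|i r [IH1 IH2]].
  split.
    apply: eq_integrable (integrable0 lam setT) => //.
    by move=> x _ /=; rewrite big_nil mul0r.
  rewrite big_nil /mean.
  rewrite (_ : \int[lam]_x _ = \int[lam]_x 0); last first.
    by apply: eq_Rintegral => x _; rewrite big_nil mul0r.
  by rewrite /Rintegral integral0 mul0r.
have [j1 j2] := RintegralDZ (a i) IH1 (iF i).
split.
  apply: eq_integrable j1 => // x _ /=; congr (_%:E).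
  by rewrite big_cons; ring.
rewrite big_cons -IH2 {1}/mean.
rewrite (_ : \int[lam]_x _ = \int[lam]_x
    ((\sum_(j <- r) a j * F j x) * expR (- psi x) + a i * (F i x * expR (- psi x)))); last first.
  by apply: eq_Rintegral => x _; rewrite big_cons; ring.
by rewrite j2 /mean; field; rewrite gt_eqF.
Qed.

Lemma integrable_coord2 psi i j : measurable_fun setT psi -> superlinear psi ->
  integrableV (fun x => (x ord0 i * x ord0 j) * expR (- psi x)).
Proof.
move=> mpsi spsi; apply: (@integrable_superlinear _ _ psi _ 1 2) => //.
  by apply: measurable_funM; exact: measurable_coord_rV.
move=> x; rewrite mul1r normrM.
have h k : `|x ord0 k| <= expR (norm1 x).
  apply: (@le_trans _ _ (norm1 x)); last by have := expR_ge1Dx (norm1 x); lra.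
  by rewrite /norm1 (bigD1 k)//= lerDl sumr_ge0.
rewrite (_ : 2 * norm1 x = norm1 x + norm1 x); last ring.
by rewrite expRD ler_pM.
Qed.

Lemma integrable_coord psi i : measurable_fun setT psi -> superlinear psi ->
  integrableV (fun x => x ord0 i * expR (- psi x)).
Proof.
move=> mpsi spsi; apply: (@integrable_superlinear _ _ psi _ 1 1) => //.
  exact: measurable_coord_rV.
move=> x; rewrite !mul1r.
apply: (@le_trans _ _ (norm1 x)); last by have := expR_ge1Dx (norm1 x); lra.
by rewrite /norm1 (bigD1 i)//= lerDl sumr_ge0.
Qed.

Lemma bar_expRN psi : bar (fun x => expR (- psi x)) = \row_i mean psi (fun x => x ord0 i).
Proof. by apply/rowP => i; rewrite !mxE. Qed.

Lemma cov_expRN psi i j : cov (fun x => expR (- psi x)) i j =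
  mean psi (fun x => x ord0 i * x ord0 j) -
  mean psi (fun x => x ord0 i) * mean psi (fun x => x ord0 j).
Proof. by rewrite /cov bar_expRN !mxE big_ord1 !mxE. Qed.

Lemma tr_cov_expRN psi : (cov (fun x => expR (- psi x)))^T = cov (fun x => expR (- psi x)).
Proof.
apply/matrixP => i j; rewrite mxE !cov_expRN mulrC; congr (_ - _).
by congr mean; apply/funext => x; rewrite mulrC.
Qed.

(** Identifies the second-order coefficient of the log-partition function, a variance, with the
    covariance matrix that enters the isotropic constant. *)
Lemma bilin_cov psi p : measurable_fun setT psi -> superlinear psi ->
  bilin p (cov (fun x => expR (- psi x))) p =
  mean psi (fun x => (dotmul_rV p x - mean psi (dotmul_rV p)) ^+ 2).
Proof.
move=> mpsi spsi; have Z0 := partition_gt0 mpsi spsi.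
have iX i := integrable_coord i mpsi spsi.
have iXX i j := integrable_coord2 i j mpsi spsi.
have [iD mD] := mean_sum (index_enum 'I_n) (fun i => p ord0 i) mpsi spsi iX.
have iG i := (mean_sum (index_enum 'I_n) (fun j => p ord0 j) mpsi spsi (iXX i)).1.
have mG i := (mean_sum (index_enum 'I_n) (fun j => p ord0 j) mpsi spsi (iXX i)).2.
have [iDD mDD] := mean_sum (index_enum 'I_n) (fun i => p ord0 i) mpsi spsi iG.
rewrite -/(dotmul_rV p) in iD mD *.
set m := mean psi (dotmul_rV p).
have i0 := integrable_expRN mpsi spsi.
have E2 x : \sum_i p ord0 i * (\sum_j p ord0 j * (x ord0 i * x ord0 j)) = dotmul_rV p x ^+ 2.
  rewrite expr2 {1}/dotmul_rV mulr_suml; apply: eq_bigr => i _.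
  by rewrite -mulrA /dotmul_rV; congr (_ * _); rewrite mulr_sumr; apply: eq_bigr => j _; ring.
have [j1 j2] := RintegralDZ (- 2 * m) iDD iD.
have [k1 k2] := RintegralDZ (m ^+ 2) j1 i0.
transitivity (\sum_i p ord0 i * (\sum_j p ord0 j * mean psi (fun x => x ord0 i * x ord0 j)) - m ^+ 2).
  rewrite /bilin mxE.
  under eq_bigr do rewrite mxE.
  rewrite expr2 {1 2}/m mD mulr_suml -sumrB.
  under [RHS]eq_bigr do rewrite -mulrA -mulrBr mulr_sumr -sumrB.
  under eq_bigr do rewrite mulr_suml.
  rewrite exchange_big; apply: eq_bigr => i _.
  rewrite mulr_sumr; apply: eq_bigr => j _; rewrite !mxE big_ord1 !mxE.
  rewrite -!/(mean _ _); ring.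
under eq_bigr do rewrite -mG.
rewrite -mDD.
apply: (mulIf (negbT (gt_eqF Z0))).
rewrite mulrBl /mean !divfK ?(gt_eqF Z0)//.
have -> : \int[lam]_x ((dotmul_rV p x - m) ^+ 2 * expR (- psi x)) =
   \int[lam]_x ((\sum_i p ord0 i * (\sum_j p ord0 j * (x ord0 i * x ord0 j))) * expR (- psi x)
    + - 2 * m * (dotmul_rV p x * expR (- psi x)) + m ^+ 2 * expR (- psi x)).
  by apply: eq_Rintegral => x _; rewrite E2; ring.
rewrite k2 j2 (@RintegralME _ _ psi (dotmul_rV p) mpsi spsi) -/m -[\int[lam]_x expR _]/(partition_function psi).
ring.
Qed.

End covariance.

Section slicing.
Context {R : realType}.
Variable n : nat.
Local Notation V := 'rV[R]_n.
Local Notation lam := (lebesgue_rV R n).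
Local Notation integrableV F := (lam.-integrable setT (EFin \o F)).
Implicit Types (F G P psi phi alpha : V -> R) (p v x w : V).

Definition convex_rV alpha := forall x y (s : R), 0 <= s <= 1 ->
  alpha (s *: x + (1 - s) *: y) <= s * alpha x + (1 - s) * alpha y.

Lemma log_concave_expRN psi : convex_rV psi -> log_concave (fun x => expR (- psi x)).
Proof.
move=> cpsi; by exists (EFin \o psi).
Qed.

Lemma lebesgue_integrable_measurable F : integrableV F -> lebesgue_integrable F.
Proof. by move=> iF; exists F => //; exact: aeW. Qed.

Lemma entropy_expRN psi : measurable_fun setT psi -> superlinear psi ->
  entropy (fun x => expR (- psi x)) = mean psi psi.
Proof.
move=> mpsi spsi; have [i1 _] := integrable_id_superlinear mpsi spsi ltr01.
rewrite /entropy /mean -mulNr; congr (_ / _).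
rewrite -mulN1r -RintegralZl//; last first.
  apply: eq_integrable (integrableZl measurableT (-1) i1) => // x _ /=.
  by rewrite expRK mul1r -EFinM; congr EFin; ring.
by apply: eq_Rintegral => x _; rewrite expRK; ring.
Qed.

Definition strong_slicing := forall f : V -> R,
  log_concave f -> lebesgue_integrable f -> 0 < \int[lam]_x f x ->
  isotropic_constant f <= (expR 1)^-1.

(** This is n times the logarithm of the slicing inequality for e^(-psi), whose entropy is the mean
    of psi. Positivity of the determinant makes the logarithm of its power legitimate. *)
Lemma slicing_expRN psi : (1 <= n)%N -> strong_slicing ->
  measurable_fun setT psi -> superlinear psi -> convex_rV psi ->
  0 < \det (cov (fun x => expR (- psi x))) ->
  n%:R + ln (\det (cov (fun x => expR (- psi x)))) / 2 <=
  mean psi psi + ln (partition_function psi).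
Proof.
move=> n1 slice mpsi spsi cpsi; set D := \det _ => D0.
have Z0 := partition_gt0 mpsi spsi.
have := slice _ (log_concave_expRN cpsi)
  (lebesgue_integrable_measurable (integrable_expRN mpsi spsi)) Z0.
rewrite /isotropic_constant entropy_expRN// -/D -[\int[lam]_x _]/(partition_function psi).
set Z := partition_function psi in Z0 *; set h := mean psi psi.
have n0 : 0 < n%:R :> R by rewrite ltr0n.
have a0 : 0 < expR (- h) / Z by rewrite divr_gt0 ?expR_gt0.
rewrite -ler_ln ?posrE ?mulr_gt0 ?powR_gt0 ?invr_gt0 ?expR_gt0//.
rewrite lnM ?posrE ?powR_gt0// !ln_powR lnM ?posrE ?expR_gt0 ?invr_gt0//.
rewrite expRK !lnV ?posrE ?expR_gt0// expRK invfM.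
rewrite -(ler_pM2l n0) mulrDr mulrA mulfV ?gt_eqF// mul1r.
have -> : n%:R * (2^-1 / n%:R * ln D) = ln D / 2 by field; rewrite gt_eqF.
lra.
Qed.

End slicing.

(** * Conditions at a minimum of the free energy *)

Section mahler_core.
Context {R : realType}.
Variable n : nat.
Local Notation V := 'rV[R]_n.
Local Notation lam := (lebesgue_rV R n).
Implicit Types (alpha beta : V -> R) (p q u v x y : V) (s t : R).

(** Extracts first- and second-order conditions from Taylor inequalities by letting s tend to 0. For
    negative x, an s of at most -x / (2 C) leaves a total of at most x / 2. *)
Lemma le0_of_linear_bound (x C : R) :
  (forall s, 0 < s <= 1 -> 0 <= x + C * s) -> 0 <= x.
Proof.
move=> H; rewrite leNgt; apply/negP => x0.
have C0 : 0 < C by have := H 1; rewrite ltr01 lexx => /(_ isT); lra.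
have s0 : 0 < - x / (2 * C) by rewrite divr_gt0 ?mulr_gt0//; lra.
have m0 : 0 < Num.min 1 (- x / (2 * C)) by rewrite lt_min ltr01.
have := H (Num.min 1 (- x / (2 * C))); rewrite m0 ge_min lexx/= => /(_ isT).
have : C * Num.min 1 (- x / (2 * C)) <= - x / 2.
  rewrite -ler_pdivlMl//; apply: (@le_trans _ _ (- x / (2 * C))).
    by rewrite ge_min lexx orbT.
  by rewrite le_eqVlt; apply/orP; left; apply/eqP; field; rewrite gt_eqF.
lra.
Qed.

(** The parameter t multiplies the linear term too, like an inverse temperature: by Laplace
    asymptotics, [logpart alpha t v / t] approaches the convex conjugate of alpha at v for large
    t. *)
Definition logpart alpha t v :=
  ln (partition_function (fun x => t * (alpha x - dotmul_rV v x))).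

Definition tilt alpha t v (x : V) : R := t * (alpha x - dotmul_rV v x).

Lemma convex_tilt alpha t v : convex_rV alpha -> 0 <= t -> convex_rV (tilt alpha t v).
Proof.
move=> ca t0 x y s s01; rewrite /tilt.
have := ler_wpM2l t0 (ca x y s s01).
have -> : dotmul_rV v (s *: x + (1 - s) *: y) = s * dotmul_rV v x + (1 - s) * dotmul_rV v y.
  rewrite /dotmul_rV !mulr_sumr -big_split; apply: eq_bigr => i _.
  by rewrite !mxE /=; ring.
lra.
Qed.

Lemma logpart_taylor2 alpha t v p : measurable_fun setT alpha -> superlinear alpha ->
  0 < t -> exists m C, 0 <= C /\ forall s, `|s| <= 1 ->
    logpart alpha t (v + s *: p) <= logpart alpha t v + s * m +
      s ^+ 2 / 2 * (t ^+ 2 * bilin p (cov (fun x => expR (- tilt alpha t v x))) p) + C * `|s| ^+ 3.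
Proof.
move=> ma sa t0.
have mpsi := measurable_tilt v t ma; have spsi := superlinear_tilt v sa t0.
have [C C0 H] := ln_partition_taylor2 (t *: p) mpsi spsi.
set m := mean _ _ in H.
exists m, C; split => // s s1; have := H s s1.
rewrite (_ : (fun x => _ - _) = (fun x => t * (alpha x - dotmul_rV (v + s *: p) x))); last first.
  by apply/funext => x; rewrite dotmul_rVDl !dotmul_rVZl; ring.
rewrite -(bilin_cov (t *: p) mpsi spsi).
rewrite (_ : bilin (t *: p) _ _ = t ^+ 2 * bilin p (cov (fun x => expR (- tilt alpha t v x))) p)//.
have S (a : R) (A : 'M[R]_1) : (a *: A) 0 0 = a * A 0 0 by rewrite mxE.
rewrite /bilin [(t *: p)^T]linearZ/= -!scalemxAl -scalemxAr !S; ring.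
Qed.

Lemma logpart_taylor1 alpha t v : measurable_fun setT alpha -> superlinear alpha ->
  0 < t -> exists E C, [/\ 0 <= C,
   t * E = mean (tilt alpha t v) (tilt alpha t v) &
   forall s, 0 <= s <= 1 ->
    logpart alpha (t + s) v <= logpart alpha t v - s * E + C * s ^+ 2].
Proof.
move=> ma sa t0.
have mphi : measurable_fun setT (fun x => alpha x - dotmul_rV v x).
  by apply: measurable_funB => //; exact: measurable_dotmul.
have sphi := superlinear_dotmul v sa.
have [C C0 H] := ln_partition_taylor1 mphi sphi t0.
exists (mean (tilt alpha t v) (fun x => alpha x - dotmul_rV v x)), C; split => //.
have [i1 _] := integrable_id_superlinear mphi sphi t0.
rewrite /mean mulrA; congr (_ / _); rewrite -RintegralZl//.
by apply: eq_Rintegral => x _; rewrite /tilt mulrA.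
Qed.

Lemma logpart_slicing alpha t v : (1 <= n)%N -> strong_slicing (R := R) n ->
  measurable_fun setT alpha -> superlinear alpha -> convex_rV alpha -> 0 < t ->
  0 < \det (cov (fun x => expR (- tilt alpha t v x))) ->
  n%:R + ln (\det (cov (fun x => expR (- tilt alpha t v x)))) / 2 <=
  mean (tilt alpha t v) (tilt alpha t v) + logpart alpha t v.
Proof.
move=> n1 sl ma sa ca t0 D0; apply: slicing_expRN => //.
- exact: measurable_tilt.
- exact: superlinear_tilt.
- exact/convex_tilt/ltW.
Qed.

Lemma det_dual_pair_scale (A C : 'M[R]_n) a : A^T = A -> C^T = C -> 0 < a ->
  (forall p q, 2 * dotmul_rV p q <= a * bilin p A p + a * bilin q C q) ->
  [/\ 0 < \det A, 0 < \det C & - (2 * n%:R * ln a) <= ln (\det A) + ln (\det C)].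
Proof.
move=> At Ct a0 H.
have [||p q|] := @det_dual_pair R n (a *: A) (a *: C).
- by rewrite linearZ/= At.
- by rewrite linearZ/= Ct.
- have -> : (p *m q^T) 0 0 = dotmul_rV p q.
    by rewrite mxE; apply: eq_bigr => i _; rewrite mxE.
  by apply: (le_trans (H p q)); rewrite /bilin -!scalemxAr -!scalemxAl !mxE.
rewrite !detZ => d1 d2.
have an : 0 < a ^+ n by rewrite exprn_gt0.
have Da : 0 < \det A by rewrite pmulr_rgt0 in d1.
have Db : 0 < \det C.
  have h : 0 < a ^+ n * \det A * (a ^+ n * \det C) by apply: lt_le_trans d2.
  by move: h; rewrite !pmulr_rgt0 ?mulr_gt0.
split => //.
have : 0 <= ln (a ^+ n * \det A * (a ^+ n * \det C)) by rewrite ln_ge0.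
rewrite lnM ?posrE ?mulr_gt0// lnM ?posrE// lnM ?posrE// lnXn// -mulr_natl.
lra.
Qed.

(* [E1] and [E2] are the mean potentials at the minimum, which control the
   derivative in t; [D1] and [D2] are the logarithms of the covariance
   determinants. *)
Lemma minimum_bound (m eta d t L1 L2 A E1 E2 C1 C2 D1 D2 : R) (M1 M2 : R -> R) :
  0 <= m -> 0 < eta <= 1 -> 1 <= t ->
  (forall s, 0 <= s <= 1 -> M1 s <= L1 - s * E1 + C1 * s ^+ 2) ->
  (forall s, 0 <= s <= 1 -> M2 s <= L2 - s * E2 + C2 * s ^+ 2) ->
  m + D1 / 2 <= t * E1 + L1 -> m + D2 / 2 <= t * E2 + L2 ->
  - (2 * m * ln ((1 + eta) * t)) <= D1 + D2 ->
  (forall s, 0 <= s -> (m * ln t + (1 + eta) * (L1 + L2) - t * A - m + d) / t <=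
    (m * ln (t + s) + (1 + eta) * (M1 s + M2 s) - (t + s) * A - m + d) / (t + s)) ->
  d <= eta * m * ln t.
Proof.
move=> n0 /andP[eta0 eta1] t1 H1 H2 Sa Sb Dab Hmin; have t0 : 0 < t by lra.
pose N := m * ln t + (1 + eta) * (L1 + L2) - t * A; rewrite -/N in Hmin.
have e1eta : 0 < 1 + eta by lra.
(* The numerator of the right derivative at s = 0 of the quotient, obtained from the Taylor bounds
   as s tends to 0. *)
have tder : 0 <= m - (1 + eta) * (t * E1 + t * E2) - t * A - (N - m + d).
  apply: (@le0_of_linear_bound _ (t * (1 + eta) * (C1 + C2))) => s /andP[s0 s1].
  have ts0 : 0 < t + s by lra.
  have s01 : 0 <= s <= 1 by rewrite (ltW s0).
  have lnts : ln (t + s) <= ln t + s / t.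
    have -> : t + s = t * (1 + s / t) by field; rewrite gt_eqF.
    have st : 0 < s / t by rewrite divr_gt0.
    rewrite lnM ?posrE//; last lra.
    by rewrite lerD2l le_ln1Dx//; lra.
  have := Hmin s (ltW s0); rewrite ler_pdivrMr// mulrAC ler_pdivlMr//.
  have := H1 s s01; have := H2 s s01.
  move: (M1 s) (M2 s) => x y HM2 HM1.
  have h : (1 + eta) * (x + y) <=
      (1 + eta) * ((L1 - s * E1 + C1 * s ^+ 2) + (L2 - s * E2 + C2 * s ^+ 2)).
    by rewrite ler_wpM2l ?lerD// ltW.
  have h2 : m * ln (t + s) <= m * (ln t + s / t) by rewrite ler_wpM2l.
  have NN : m * ln (t + s) + (1 + eta) * (x + y) - (t + s) * A <= N + m * (s / t) +
     (1 + eta) * (- s * (E1 + E2) + (C1 + C2) * s ^+ 2) - s * A.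
    by rewrite /N; move: h h2; lra.
  move: NN; set F := _ - (t + s) * A; move: F => F NN h3.
  rewrite -(pmulr_rge0 _ s0).
  have h4 : t * F <= t * N + m * s +
     t * ((1 + eta) * (- s * (E1 + E2) + (C1 + C2) * s ^+ 2) - s * A).
    apply: (le_trans (ler_wpM2l (ltW t0) NN)).
    by rewrite le_eqVlt; apply/orP; left; apply/eqP; field; rewrite gt_eqF.
  by move: h3 h4; lra.
have lnta : ln ((1 + eta) * t) <= eta + ln t.
  by rewrite lnM ?posrE// lerD2r le_ln1Dx//; lra.
(* The two slicing inequalities added. Combined with [tder] they leave d <= eta m ln t - m eta + m
   eta^2, and eta <= 1 disposes of the last two terms. *)
have S2 : (1 + eta) * (2 * m - m * (eta + ln t)) <=
  (1 + eta) * (t * E1 + t * E2 + (L1 + L2)).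
  rewrite ler_pM2l//.
  have h : m * ln ((1 + eta) * t) <= m * (eta + ln t) by rewrite ler_wpM2l.
  by move: h Sa Sb Dab; lra.
have h5 : m * eta * eta <= m * eta by rewrite ler_piMr ?mulr_ge0// ltW.
by move: tder S2 h5; rewrite /N; lra.
Qed.

Section free_energy.
Variables (alpha beta : V -> R).
Hypothesis n1 : (1 <= n)%N.
Hypothesis slicing : strong_slicing (R := R) n.
Hypotheses (ma : measurable_fun setT alpha) (mb : measurable_fun setT beta).
Hypotheses (sa : superlinear alpha) (sb : superlinear beta).
Hypotheses (ca : convex_rV alpha) (cb : convex_rV beta).

(* [eta] makes the quotient [(free_energy - n) / t] coercive on [1 <= t]. *)
Definition free_energy eta t v u : R :=
  n%:R * ln t + (1 + eta) * (logpart alpha t v + logpart beta t u) - t * dotmul_rV v u.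

(** The minimum is compared with its neighbours in the directions (p, q) and (-p, -q). The resulting
    quadratic form inequality holds with the scale (1 + eta) t, which the determinant inequality
    turns into the logarithmic term. *)
Lemma det_cov_at_minimum eta t v u : 0 < eta -> 0 < t ->
  (forall v' u', free_energy eta t v u <= free_energy eta t v' u') ->
  let Ca := cov (fun x => expR (- tilt alpha t v x)) in
  let Cb := cov (fun x => expR (- tilt beta t u x)) in
  [/\ 0 < \det Ca, 0 < \det Cb &
    - (2 * n%:R * ln ((1 + eta) * t)) <= ln (\det Ca) + ln (\det Cb)].
Proof.
move=> eta0 t0 Hmin Ca Cb; pose a := (1 + eta) * t.
have e1eta : 0 <= 1 + eta by lra.
have a0 : 0 < a by rewrite mulr_gt0//; lra.
apply: det_dual_pair_scale => //; [exact: tr_cov_expRN|exact: tr_cov_expRN|].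
  move=> p q.
  have [m1 [C1 [C10 H1]]] := logpart_taylor2 v p ma sa t0.
  have [m2 [C2 [C20 H2]]] := logpart_taylor2 u q mb sb t0.
  rewrite -/Ca in H1; rewrite -/Cb in H2.
  move: H1 H2; move: (bilin p Ca p) (bilin q Cb q) => b1 b2 H1 H2.
  have dotE s : dotmul_rV (v + s *: p) (u + s *: q) =
      dotmul_rV v u + s * (dotmul_rV p u + dotmul_rV v q) + s ^+ 2 * dotmul_rV p q.
    rewrite /dotmul_rV -big_split/= !mulr_sumr -!big_split/=.
    by apply: eq_bigr => i _; rewrite !mxE; ring.
  suff : 0 <= t ^+ 2 * (1 + eta) * (b1 + b2) - 2 * t * dotmul_rV p q.
    rewrite -[X in 0 <= X](_ : t * (a * b1 + a * b2 - 2 * dotmul_rV p q) = _); last by rewrite /a; ring.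
    by rewrite pmulr_rge0// subr_ge0.
  apply: (@le0_of_linear_bound _ (2 * (1 + eta) * (C1 + C2))) => s /andP[s0 s1].
  have nrm : `|s| = s by rewrite gtr0_norm.
  have Hs' r : `|r| <= 1 -> 0 <= (1 + eta) * (r * (m1 + m2) + r ^+ 2 / 2 * (t ^+ 2 * (b1 + b2)) + (C1 + C2) * `|r| ^+ 3)
      - t * (r * (dotmul_rV p u + dotmul_rV v q) + r ^+ 2 * dotmul_rV p q).
    move=> r1; have := Hmin (v + r *: p) (u + r *: q).
    rewrite /free_energy dotE.
    have h : (1 + eta) * (logpart alpha t (v + r *: p) + logpart beta t (u + r *: q)) <=
      (1 + eta) * ((logpart alpha t v + r * m1 + r ^+ 2 / 2 * (t ^+ 2 * b1) + C1 * `|r| ^+ 3)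
        + (logpart beta t u + r * m2 + r ^+ 2 / 2 * (t ^+ 2 * b2) + C2 * `|r| ^+ 3)).
      by apply: ler_wpM2l; [exact: e1eta|apply: lerD; [exact: H1|exact: H2]].
    move: h; move: (logpart alpha t (v + r *: p)) (logpart beta t (u + r *: q))
      (logpart alpha t v) (logpart beta t u) (dotmul_rV v u)
      (dotmul_rV p u + dotmul_rV v q) (dotmul_rV p q) => A1 A2 A3 A4 A5 A6 A7.
    lra.
  move: Hs'; move: (dotmul_rV p u + dotmul_rV v q) (dotmul_rV p q) => A6 A7 Hs'.
  (* Adding the comparisons at s and -s cancels the first-order terms; division by s^2 leaves the
     second-order condition with an error linear in s. *)
  have hp := Hs' s; have hn := Hs' (- s).
  rewrite normrN nrm in hn; rewrite nrm in hp.
  have s2 : 0 < s ^+ 2 by rewrite exprn_gt0.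
  rewrite -(pmulr_rge0 _ s2).
  have := hp s1; have := hn s1.
  rewrite !sqrrN; lra.
Qed.

Lemma free_energy_at_minimum eta d t v u : 0 < eta <= 1 -> 1 <= t ->
  (forall t' v' u', 1 <= t' -> (free_energy eta t v u - n%:R + d) / t <=
                               (free_energy eta t' v' u' - n%:R + d) / t') ->
  d <= eta * n%:R * ln t.
Proof.
move=> /andP[eta0 eta1] t1 Hmin; have t0 : 0 < t by lra.
have ts1 s : 0 <= s -> 1 <= t + s by lra.
have [|Da Db Dab] := @det_cov_at_minimum eta t v u eta0 t0.
  move=> v' u'; have := Hmin t v' u' t1; rewrite ler_pM2r ?invr_gt0//.
  by move: (free_energy _ _ _ _) (free_energy _ _ _ _) => x y; lra.
have Sa := logpart_slicing n1 slicing ma sa ca t0 Da.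
have Sb := logpart_slicing n1 slicing mb sb cb t0 Db.
have [E1 [C1 [C10 e1 H1]]] := logpart_taylor1 v ma sa t0.
have [E2 [C2 [C20 e2 H2]]] := logpart_taylor1 u mb sb t0.
rewrite -e1 in Sa; rewrite -e2 in Sb.
apply: (@minimum_bound n%:R eta d t _ _ (dotmul_rV v u) E1 E2 C1 C2 _ _
  (fun s => logpart alpha (t + s) v) (fun s => logpart beta (t + s) u) _ _ _ H1 H2 Sa Sb Dab).
- exact: ler0n.
- by rewrite eta0.
- exact: t1.
- by move=> s s0; exact: (Hmin _ v u (ts1 s s0)).
Qed.

End free_energy.

End mahler_core.

Section mahler_constants.
Context {R : realType}.
Implicit Types t : R.

Lemma ln_le_sqrt t : 1 <= t -> ln t <= 2 * Num.sqrt t.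
Proof.
move=> t1; have t0 : 0 < t by lra.
have q0 : 0 < Num.sqrt t by rewrite sqrtr_gt0.
have -> : ln t = 2 * ln (Num.sqrt t).
  by rewrite mulr_natl -lnXn// sqr_sqrtr// ltW.
rewrite ler_pM2l//.
exact/ltW/ln_sublinear.
Qed.

(** S will be the sum of the two log-integrals, supposed less than m = n; b is [|ln B|] and C comes
    from the lower bound on alpha + beta. The order of choice matters: d from the gap m - S, then T
    from d, then eta with eta m ln T < d, and last W, which depends on eta. *)
Lemma penalization_constants (m b C S : R) : 0 < m -> 0 <= b -> 0 <= C -> S < m ->
  exists d T W eta, [/\ 0 < d, 1 <= T, 0 <= W & 0 < eta <= 1] /\
    [/\ (1 + eta) * S - m + d <= - d, eta * m * ln T < d &
    forall t M, 1 <= t -> 0 <= M -> T <= t \/ W <= M ->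
      - d < eta * (M - C) - (3 * m * ln t + 4 * b) / t - (m - d) / t].
Proof.
move=> n0 b0 C0 Sn.
(* Then S = m - 3 d, so the value at the base point is -2 d + eta S, which leaves a margin d for the
   penalty. *)
pose d := (m - S) / 3; have d0 : 0 < d by rewrite divr_gt0// subr_gt0.
(* From ln t <= 2 sqrt t and 1 <= sqrt t, the loss 3 m ln t + 4 b + m is at most (6 m + 4 b + m)
   sqrt t. *)
pose M := 7 * m + 4 * b.
have M0 : 0 < M by rewrite /M; lra.
have HM t : 1 <= t -> (3 * m * ln t + 4 * b + m) / t <= M / Num.sqrt t.
  move=> t1; have t0 : 0 < t by lra.
  have q0 : 0 < Num.sqrt t by rewrite sqrtr_gt0.
  have q1 : 1 <= Num.sqrt t by rewrite -[leLHS]sqrtr1; exact: ler_wsqrtr.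
  rewrite ler_pdivrMr// -[X in _ <= _ * X](sqr_sqrtr (ltW t0)) expr2 mulrA divfK ?gt_eqF//.
  have := ln_le_sqrt t1 => h.
  have h1 : 3 * m * ln t <= 3 * m * (2 * Num.sqrt t).
    by rewrite ler_wpM2l// mulr_ge0// ltW.
  have h2 : (4 * b + m) <= (4 * b + m) * Num.sqrt t by rewrite ler_peMr//; lra.
  rewrite /M; lra.
pose q := Num.max 1 (4 * M / d).
have q1 : 1 <= q by rewrite le_max lexx.
have q0 : 0 < q by lra.
pose T := q ^+ 2.
have T1 : 1 <= T by rewrite -(expr1n _ 2) ler_pXn2r// ?nnegrE//; lra.
have sT : Num.sqrt T = q by rewrite sqrtr_sqr ger0_norm// ltW.
have HT t : T <= t -> (3 * m * ln t + 4 * b + m) / t <= d / 4.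
  move=> Tt; have t1 : 1 <= t by lra.
  apply: (le_trans (HM t t1)).
  have qt : q <= Num.sqrt t by rewrite -sT; exact: ler_wsqrtr.
  have qd : 4 * M / d <= q by rewrite le_max lexx orbT.
  have qt0 : 0 < Num.sqrt t by lra.
  rewrite ler_pdivrMr//.
  have : 4 * M / d <= Num.sqrt t by lra.
  rewrite ler_pdivrMr//; lra.
have HM1 t : 1 <= t -> (3 * m * ln t + 4 * b + m) / t <= M.
  move=> t1; apply: (le_trans (HM t t1)).
  have qq : 1 <= Num.sqrt t by rewrite -[leLHS]sqrtr1; exact: ler_wsqrtr.
  have qq0 : 0 < Num.sqrt t by lra.
  by rewrite ler_pdivrMr// ler_peMr// ltW.
have lnT0 : 0 <= ln T by exact: ln_ge0.
(* A common majorant of C, [|S|] and m ln T, so that eta times each of them is at most d / 4. *)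
pose D := C + `|S| + m * ln T + 1.
have nT0 : 0 <= m * ln T by rewrite mulr_ge0// ltW.
have S0 : 0 <= `|S| by [].
have D0 : 0 < D by rewrite /D; lra.
pose eta := Num.min 1 (d / (4 * D)).
have eta0 : 0 < eta by rewrite lt_min ltr01 divr_gt0// mulr_gt0.
have eta1 : eta <= 1 by rewrite ge_min lexx.
have etaD : eta * D <= d / 4.
  rewrite -ler_pdivlMr//; apply: (@le_trans _ _ (d / (4 * D))).
    by rewrite ge_min lexx orbT.
  by rewrite invfM mulrA.
have etaC : eta * C <= d / 4.
  by apply: le_trans etaD; rewrite ler_pM2l// /D; lra.
have etaS : eta * `|S| <= d / 4.
  by apply: le_trans etaD; rewrite ler_pM2l// /D; lra.
have etaT : eta * (m * ln T) <= d / 4.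
  by apply: le_trans etaD; rewrite ler_pM2l// /D; lra.
(* A penalty of M + d outweighs the loss, which is at most M for every t >= 1. *)
pose W := (M + d) / eta.
have W0 : 0 < W by rewrite divr_gt0//; lra.
have etaW : eta * W = M + d by rewrite mulrC divfK// gt_eqF.
exists d, T, W, eta; split.
  by split => //; [exact: ltW|rewrite eta0].
have mS : m = S + 3 * d by rewrite /d; field.
split.
- have := ler_norm S; have : eta * S <= eta * `|S| by rewrite ler_pM2l// ler_norm.
  lra.
- by rewrite -mulrA; lra.
move=> t N t1 N0 far.
have t0 : 0 < t by lra.
have dt : 0 < d / t by rewrite divr_gt0.
have split3 : (3 * m * ln t + 4 * b + m) / t = (3 * m * ln t + 4 * b) / t + m / t.
  by rewrite mulrDl.
rewrite (mulrBl t^-1 m d).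
have eN : 0 <= eta * N by rewrite mulr_ge0// ltW.
case: far => [Tt|WN].
  by have := HT t Tt; rewrite split3; lra.
have eW : eta * W <= eta * N by rewrite ler_pM2l.
by have := HM1 t t1; rewrite split3; lra.
Qed.

End mahler_constants.

Section mahler_superlinear_pair.
Context {R : realType}.
Variable n : nat.
Local Notation V := 'rV[R]_n.
Local Notation lam := (lebesgue_rV R n).
Implicit Types (p q u v x y : V) (s t : R).
Variables (alpha beta : V -> R).
Hypothesis n1 : (1 <= n)%N.
Hypothesis slicing : strong_slicing (R := R) n.
Hypotheses (ma : measurable_fun setT alpha) (mb : measurable_fun setT beta).
Hypotheses (sa : superlinear alpha) (sb : superlinear beta).
Hypotheses (ca : convex_rV alpha) (cb : convex_rV beta).

Lemma continuous_free_energy_form (T : topologicalType) (eta : R) (z : T)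
    (l1 l2 l3 l4 l5 : T -> R) :
  {for z, continuous l1} -> {for z, continuous l2} -> {for z, continuous l3} ->
  {for z, continuous l4} -> {for z, continuous l5} ->
  {for z, continuous (fun y : T => n%:R * l1 y + (1 + eta) * (l2 y + l3 y) - l4 y * l5 y)}.
Proof.
move=> c1 c2 c3 c4 c5; apply: (@cvgB _ R^o).
  apply: (@cvgD _ R^o); first by apply: cvgM; [exact: cvg_cst|exact: c1].
  by apply: cvgM; [exact: cvg_cst|apply: (@cvgD _ R^o); [exact: c2|exact: c3]].
by apply: cvgM; [exact: c4|exact: c5].
Qed.

Lemma continuous_free_energy eta (z : (R * V) * V) : 0 < z.1.1 ->
  {for z, continuous (fun z => free_energy alpha beta eta z.1.1 z.1.2 z.2)}.
Proof.
move=> z0; rewrite /free_energy.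
have c1 : {for z, continuous (fun z : (R * V) * V => z.1.1)}.
  have c0 : {for z, continuous (@fst (R * V) V)} by exact: cvg_fst.
  have c0' : {for z.1, continuous (@fst R V)} by exact: cvg_fst.
  exact: (continuous_comp c0 c0').
have c2 : {for z, continuous (fun z : (R * V) * V => z.1.2)}.
  have c0 : {for z, continuous (@fst (R * V) V)} by exact: cvg_fst.
  have c0' : {for z.1, continuous (@snd R V)} by exact: cvg_snd.
  exact: (continuous_comp c0 c0').
have c3 : {for z, continuous (fun z : (R * V) * V => z.2)} by exact: cvg_snd.
have cl : {for z, continuous (fun z : (R * V) * V => ln z.1.1)}.
  exact: (continuous_comp c1 (continuous_ln z0)).
have ca' : {for z, continuous (fun z : (R * V) * V => logpart alpha z.1.1 z.1.2)}.
  have c12 : {for z, continuous (fun z : (R * V) * V => z.1)} by exact: cvg_fst.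
  exact: (continuous_comp c12 (continuous_ln_partition ma sa z0)).
have cb' : {for z, continuous (fun z : (R * V) * V => logpart beta z.1.1 z.2)}.
  have c12 : {for z, continuous (fun z : (R * V) * V => (z.1.1, z.2))} by exact: (cvg_pair c1 c3).
  exact: (continuous_comp c12 (@continuous_ln_partition _ _ _ (z.1.1, z.2) mb sb z0)).
have cd : {for z, continuous (fun z : (R * V) * V => dotmul_rV z.1.2 z.2)}.
  apply: cvg_big => [|i _]; first exact: add_continuous.
  have d1 : {for z, continuous (fun z : (R * V) * V => z.1.2 ord0 i)}.
    exact: (continuous_comp c2 (@continuous_rV_coord _ _ i _)).
  have d2 : {for z, continuous (fun z : (R * V) * V => z.2 ord0 i)}.
    exact: (continuous_comp c3 (@continuous_rV_coord _ _ i _)).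
  exact: (continuousM d1 d2).
exact: (@continuous_free_energy_form _ eta z _ _ _ _ _ cl ca' cb' c1 cd).
Qed.

Hypothesis fenchel : forall x y, dotmul_rV y x <= alpha x + beta y.
Variable B : R.
Hypothesis B0 : 0 < B.
Hypothesis lower_a : forall t v, 1 <= t ->
  expR (t * beta v) * (B / t ^+ n) <= partition_function (tilt alpha t v).
Hypothesis lower_b : forall t u, 1 <= t ->
  expR (t * alpha u) * (B / t ^+ n) <= partition_function (tilt beta t u).

(** The hypotheses [lower_a] and [lower_b] replace the log-partition functions by t (alpha u + beta
    v) up to logarithmic losses. One copy of alpha u + beta v pays for the pairing by [fenchel]; the
    extra eta copies give growth in v and u, which [fenchel] alone would not. *)
Let free_energy_lower eta t v u C : 0 < eta <= 1 -> 1 <= t ->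
  (forall x y, norm1 x + norm1 y - C <= alpha x + beta y) ->
  eta * (norm1 v + norm1 u - C) - (3 * n%:R * ln t + 4 * `|ln B|) / t <=
  free_energy alpha beta eta t v u / t.
Proof.
move=> /andP[eta0 eta1] t1 HC; have t0 : 0 < t by lra.
have tn0 : 0 < t ^+ n by rewrite exprn_gt0.
have lnt0 : 0 <= ln t by exact: ln_ge0.
have key (f : V -> R) g (w : V) : measurable_fun setT f -> superlinear f ->
    expR (t * g) * (B / t ^+ n) <= partition_function (tilt f t w) ->
    t * g + ln B - n%:R * ln t <= logpart f t w.
  move=> mf sf h.
  have Z0 := partition_gt0 (measurable_tilt w t mf) (superlinear_tilt w sf t0).
  have : ln (expR (t * g) * (B / t ^+ n)) <= logpart f t w.
    by rewrite ler_ln ?posrE// mulr_gt0 ?expR_gt0// divr_gt0.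
  rewrite lnM ?posrE ?expR_gt0 ?divr_gt0// expRK ln_div ?posrE// lnXn//.
  by rewrite -[ln t *+ n]mulr_natl addrA.
have ka := key _ _ v ma sa (lower_a v t1).
have kb := key _ _ u mb sb (lower_b u t1).
rewrite ler_pdivlMr// mulrBl divfK ?gt_eqF// /free_energy.
have n0 : 0 <= n%:R :> R by [].
have b1 := ler_norm (ln B); have b2 := ler_norm (- ln B); rewrite normrN in b2.
move: ka kb (fenchel u v) (HC u v) lnt0 n0 b1 b2.
move: (logpart alpha t v) (logpart beta t u) (alpha u) (beta v) (dotmul_rV v u).
rewrite (addrC (norm1 v)); move: (norm1 u + norm1 v) (ln B) `|ln B| (ln t) n%:R.
move=> M lB aB lt m L1 L2 a b D ka kb ab Mab lt0 m0 b1 b2.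
(* The constants 3 and 4 of the statement arise from 2 (1 + eta) - 1 <= 3 copies of n ln t and 2 (1
   + eta) <= 4 copies of [|ln B|]. *)
have h1 : (1 + eta) * (t * b + lB - m * lt + (t * a + lB - m * lt)) <= (1 + eta) * (L1 + L2).
  by apply: ler_wpM2l; [lra|exact: lerD].
have h2 : t * D <= t * (a + b) by rewrite ler_pM2l.
have h3 : eta * t * (M - C) <= eta * t * (a + b).
  by rewrite ler_pM2l ?mulr_gt0.
have h4 : eta * (m * lt) <= m * lt by rewrite ler_piMl// mulr_ge0.
have h5 : - aB <= eta * lB.
  have : eta * - lB <= aB.
    apply: (@le_trans _ _ (eta * aB)); first by rewrite ler_pM2l.
    by rewrite ler_piMl//; lra.
  lra.
lra.
Qed.

(** If the inequality failed, the quotient shifted by d / t would attain its minimum over 1 <= t at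
    some t <= T, and [free_energy_at_minimum] would give d <= eta n ln t <= eta n ln T < d. *)
Lemma mahler_superlinear :
  n%:R <= ln (partition_function alpha) + ln (partition_function beta).
Proof.
have logpart1 f : logpart f 1 (0 : V) = ln (partition_function f).
  rewrite /logpart; congr (ln (partition_function _)); apply/funext => x.
  by rewrite mul1r /dotmul_rV big1 ?subr0// => i _; rewrite mxE mul0r.
rewrite leNgt; apply/negP; rewrite -!logpart1.
move=> Sn; have [Ca HCa] := sa 1; have [Cb HCb] := sb 1.
have HC x y : norm1 x + norm1 y - (`|Ca| + `|Cb|) <= alpha x + beta y.
  have /(_ x)/le_trans := HCa; have /(_ y)/le_trans := HCb => h1 h2.
  rewrite opprD addrACA; apply: lerD; [apply: (le_trans _ (HCa x))|apply: (le_trans _ (HCb y))];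
    by rewrite mul1r lerD2l lerN2 ler_norm.
have n0 : 0 < n%:R :> R by rewrite ltr0n.
have [d [T [W [eta [[d0 T1 Wgt0 eta01] [HS HT far]]]]]] := penalization_constants n0
  (normr_ge0 (ln B)) (addr_ge0 (normr_ge0 Ca) (normr_ge0 Cb)) Sn.
have eta0 : 0 < eta by case/andP: eta01.
pose K (z : (R * V) * V) := (free_energy alpha beta eta z.1.1 z.1.2 z.2 - n%:R + d) / z.1.1.
have K0 : K ((1, 0), 0) <= - d.
  apply: le_trans HS; rewrite /K /= divr1 /free_energy ln1 mulr0 add0r.
  have -> : dotmul_rV (0 : V) 0 = 0 by rewrite /dotmul_rV big1// => i _; rewrite mxE mul0r.
  by rewrite mulr0 subr0.
have Kfar t v u : 1 <= t -> T <= t \/ W <= norm1 v + norm1 u -> - d < K ((t, v), u).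
  move=> t1 tvu.
  apply: (lt_le_trans (far t (norm1 v + norm1 u) t1 (addr_ge0 (norm1_ge0 v) (norm1_ge0 u)) tvu)).
  have -> : K ((t, v), u) = free_energy alpha beta eta t v u / t - (n%:R - d) / t.
    by rewrite /K /= -mulrBl; congr (_ / _); rewrite opprB addrA addrAC.
  rewrite lerD2r; exact: free_energy_lower.
pose A : set ((R * V) * V) :=
  (`[1, T]%classic `*` [set v : V | forall i, `[- W, W]%classic (v ord0 i)])
  `*` [set v : V | forall i, `[- W, W]%classic (v ord0 i)].
have cA : compact A.
  have cV : compact [set v : V | forall i, `[- W, W]%classic (v ord0 i)].
    exact: (@rV_compact _ n (fun=> `[- W, W]%classic) (fun=> @segment_compact R _ _)).
  by apply: compact_setX => //; apply: compact_setX => //; exact: segment_compact.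
have A0 : A ((1, 0), 0).
  split; first split => /=; rewrite ?in_itv/= ?lexx// => i; rewrite mxE in_itv/=;
  by rewrite oppr_le0 Wgt0.
have cK : {within A, continuous K}.
  apply: continuous_in_subspaceT => z; rewrite inE => -[[/= + _] _].
  rewrite in_itv/= => /andP[z1 _].
  have z0 : 0 < z.1.1 by exact: lt_le_trans z1.
  have c11 : {for z, continuous (fun z : (R * V) * V => z.1.1)}.
    have c0 : {for z, continuous (@fst (R * V) V)} by exact: cvg_fst.
    have c0' : {for z.1, continuous (@fst R V)} by exact: cvg_fst.
    exact: (continuous_comp c0 c0').
  have cF := @continuous_free_energy eta z z0.
  apply: cvgM; last by apply: cvgV; [rewrite gt_eqF|exact: c11].
  apply: (@cvgD _ R^o); last exact: cvg_cst.
  by apply: (@cvgB _ R^o); [exact: cF|exact: cvg_cst].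
have [c cA' Hc] := compact_EVT_min (ex_intro _ _ A0) cA cK.
move: cA' Hc; rewrite inE; case: c => [[t v] u] [[/= t1T _] _] Hc.
move: t1T; rewrite in_itv/= => /andP[t1 tT].
have Kc : K ((t, v), u) <= - d by apply: le_trans K0; apply: Hc; rewrite inE.
have := @free_energy_at_minimum R n alpha beta n1 slicing ma mb sa sb ca cb eta d t v u eta01 t1 _.
(* Outside the compact box the quotient exceeds -d, which bounds its value at the base point (1, 0,
   0) from above; the minimum over the box is therefore global. *)
have Hmin t' v' u' : 1 <= t' -> K ((t, v), u) <= K ((t', v'), u').
  move=> t'1; have [t'T|t'T] := leP T t'.
    by apply: (le_trans Kc); apply/ltW/Kfar => //; left.
  have coord (w : V) : norm1 w <= W -> forall i, `[- W, W]%classic (w ord0 i).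
    move=> wW i; rewrite /= in_itv/= -ler_norml; apply: le_trans wW.
    by rewrite /norm1 (bigD1 i)//= lerDl sumr_ge0.
  have [vu|vu] := leP W (norm1 v' + norm1 u').
    by apply: (le_trans Kc); apply/ltW/Kfar => //; right.
  apply: Hc; rewrite inE; split; first split => /=.
  - by rewrite in_itv/= t'1 ltW.
  - by apply: coord; apply: le_trans (ltW vu); rewrite lerDl norm1_ge0.
  - by apply: coord; apply: le_trans (ltW vu); rewrite lerDr norm1_ge0.
move=> /(_ Hmin); apply/negP; rewrite -ltNge.
apply: le_lt_trans HT; rewrite ler_wpM2l//.
  by rewrite mulr_ge0// ltW.
by rewrite ler_ln// posrE; apply: lt_le_trans _ t1 || apply: lt_le_trans _ T1.
Qed.

End mahler_superlinear_pair.

(** * Quadratic regularization *)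

Section quadratic.
Context {R : realType}.
Variable n : nat.
Local Notation V := 'rV[R]_n.
Implicit Types (u v x y z : V) (a b t : R).

Lemma dotmul_rVC x y : dotmul_rV x y = dotmul_rV y x.
Proof. by apply: eq_bigr => i _; rewrite mulrC. Qed.

Lemma dotmul_rVDr v x y : dotmul_rV v (x + y) = dotmul_rV v x + dotmul_rV v y.
Proof. by rewrite dotmul_rVC dotmul_rVDl !(dotmul_rVC v). Qed.

Lemma dotmul_rVZr a v x : dotmul_rV v (a *: x) = a * dotmul_rV v x.
Proof. by rewrite dotmul_rVC dotmul_rVZl (dotmul_rVC v). Qed.

Lemma dotmul_rVNl v x : dotmul_rV (- v) x = - dotmul_rV v x.
Proof. by rewrite -scaleN1r dotmul_rVZl mulN1r. Qed.

Lemma dotmul_rVNr v x : dotmul_rV v (- x) = - dotmul_rV v x.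
Proof. by rewrite -scaleN1r dotmul_rVZr mulN1r. Qed.

Definition halfsq x : R := dotmul_rV x x / 2.

Lemma halfsqD x y : halfsq (x + y) = halfsq x + dotmul_rV x y + halfsq y.
Proof. by rewrite /halfsq !(dotmul_rVDl, dotmul_rVDr) (dotmul_rVC y x); field. Qed.

Lemma halfsqZ a x : halfsq (a *: x) = a ^+ 2 * halfsq x.
Proof. by rewrite /halfsq dotmul_rVZl dotmul_rVZr; field. Qed.

Lemma halfsqN x : halfsq (- x) = halfsq x.
Proof. by rewrite -scaleN1r halfsqZ sqrrN expr1n mul1r. Qed.

Lemma halfsqE x : halfsq x = \sum_(i < n) (x ord0 i ^+ 2 / 2).
Proof. by rewrite /halfsq /dotmul_rV mulr_suml. Qed.

Lemma halfsq_ge0 x : 0 <= halfsq x.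
Proof. by rewrite halfsqE sumr_ge0// => i _; rewrite divr_ge0// sqr_ge0. Qed.

Lemma dotmul_le_halfsq a x y : 0 < a -> dotmul_rV x y <= a * halfsq x + halfsq y / a.
Proof.
move=> a0; have := halfsq_ge0 (a *: x - y).
rewrite halfsqD halfsqN halfsqZ dotmul_rVZl dotmul_rVNr => h.
rewrite -(ler_pM2l a0) mulrDr (mulrCA a _ a^-1) mulfV ?gt_eqF// mulr1.
move: h; rewrite expr2 -mulrA; move: (dotmul_rV x y) (halfsq x) (halfsq y) => d p q.
by move=> h; lra.
Qed.

Lemma halfsq_superlinear a b : 0 < a -> exists C, forall x, b * norm1 x - C <= a * halfsq x.
Proof.
move=> a0; exists (n%:R * (b ^+ 2 / (2 * a))) => z.
rewrite halfsqE /norm1 !mulr_sumr -[X in X%:R * _]card_ord -sum1_card natr_sum mulr_suml -sumrB.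
apply: ler_sum => i _; rewrite mul1r.
have := sqr_ge0 (a * `|z ord0 i| - b).
rewrite sqrrB => h.
rewrite -(ler_pM2l a0) -(real_normK (num_real (z ord0 i))).
have -> : a * (b * `|z ord0 i| - b ^+ 2 / (2 * a)) = a * b * `|z ord0 i| - b ^+ 2 / 2.
  by field; rewrite gt_eqF.
move: h; rewrite exprMn; move: `|_| => w h; lra.
Qed.

Lemma measurable_halfsq : measurable_fun setT halfsq.
Proof.
apply: measurable_funM => //; apply: measurable_sum => i.
by apply: measurable_funM; exact: measurable_coord_rV.
Qed.

Lemma halfsq_convex x y t : 0 <= t <= 1 ->
  halfsq (t *: x + (1 - t) *: y) <= t * halfsq x + (1 - t) * halfsq y.
Proof.
move=> /andP[t0 t1]; rewrite !halfsqE !mulr_sumr -big_split/=.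
apply: ler_sum => i _; rewrite !mxE.
move: (x ord0 i) (y ord0 i) => a b.
have : 0 <= t * (1 - t) * (a - b) ^+ 2 by rewrite mulr_ge0 ?sqr_ge0// mulr_ge0// subr_ge0.
nra.
Qed.

Lemma norm1D x y : norm1 (x + y) <= norm1 x + norm1 y.
Proof.
by rewrite -big_split; apply: ler_sum => i _; rewrite mxE ler_normD.
Qed.

(** The sigma-algebra is generated by coordinates, not by open sets. The set where g < a is a
    countable union, over rational points p, of the sets where g p + L' [norm1] (x - p) < a, and
    these are measurable because [norm1] is. *)
Lemma measurable_lipschitz (g : V -> R) (L : R) :
  (forall x y, g x <= g y + L * norm1 (x - y)) -> measurable_fun setT g.
Proof.
move=> gL mD; apply: (measurability _ (RGenInftyO.measurableE R)) => //.
move=> _ [_ [a ->] <-]; rewrite setTI.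
pose Q (p : 'rV[rat]_n) : V := map_mx ratr p.
have L0 : exists2 L', 0 < L' & forall x y, g x <= g y + L' * norm1 (x - y).
  exists (`|L| + 1); first by rewrite ltr_pwDr.
  move=> x y; apply: (le_trans (gL x y)); rewrite lerD2l ler_wpM2r ?norm1_ge0//.
  by have := ler_norm L; lra.
have [L' L'0 gL'] := L0.
rewrite [X in measurable X](_ : _ = \bigcup_(p in [set: 'rV[rat]_n])
   [set x | g (Q p) + L' * norm1 (x - Q p) < a]); last first.
  apply/seteqP; split => x /=; rewrite in_itv/=; last first.
    by move=> [p _ /=]; apply: le_lt_trans; exact: gL'.
  (* A rational point within e of x in each coordinate costs at most 2 L' n e, which is less than a
     - g x; [n.+1] makes this strict and avoids a division by 0. *)
  move=> gxa; pose e := (a - g x) / (2 * L' * n.+1%:R).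
  have n0 : 0 < n.+1%:R :> R by rewrite ltr0n.
  have e0 : 0 < e by rewrite divr_gt0 ?subr_gt0// !mulr_gt0.
  have ex i : exists q : rat, ratr q \in `]x ord0 i - e, x ord0 i + e[.
    by apply: rat_in_itvoo; lra.
  pose p : 'rV[rat]_n := \row_i xchoose (ex i).
  have xp : norm1 (x - Q p) <= n%:R * e.
    rewrite /norm1 -[X in X%:R * _]card_ord -sum1_card natr_sum mulr_suml.
    apply: ler_sum => i _; rewrite mul1r !mxE.
    have := xchooseP (ex i); rewrite in_itv/= => /andP[h1 h2].
    by rewrite ler_norml; apply/andP; split; lra.
  have nn : n%:R * e < n.+1%:R * e by rewrite ltr_pM2r// ltr_nat.
  have ee : 2 * (L' * (n.+1%:R * e)) = a - g x.
    by rewrite /e; field; rewrite !gt_eqF.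
  exists p => //=.
  have h := gL' (Q p) x; rewrite -(norm1N (Q p - x)) opprB in h.
  have h2 : L' * norm1 (x - Q p) < L' * (n.+1%:R * e) by rewrite ltr_pM2l//; lra.
  lra.
apply: countable_bigcupT_measurable => [|p]; first exact: countableP.
rewrite [X in measurable X](_ : _ = (fun x => g (Q p) + L' * norm1 (x - Q p)) @^-1` `]-oo, a[%classic); last first.
  by apply/seteqP; split => x /=; rewrite in_itv.
rewrite -[X in measurable X]setTI; apply: (_ : measurable_fun setT _) => //.
apply: measurable_funD => //; apply: measurable_funM => //.
apply: measurableT_comp; first exact: measurable_norm1.
have := @measurable_affine_rV R n 1 (- Q p); congr measurable_fun.
by apply/funext => x; rewrite scale1r.
Qed.

End quadratic.

(** * Conjugates on a bounded set and Moreau envelopes *)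

Section conjugate.
Context {R : realType}.
Variable n : nat.
Local Notation V := 'rV[R]_n.
Implicit Types (u v x y z k : V) (a b s t : R) (rho : V -> R).

Variables (K : set V) (r : R) (k0 : V).
Hypothesis r0 : 0 <= r.
Hypothesis Kk0 : K k0.
Hypothesis Kr : forall k i, K k -> `|k ord0 i| <= r.

(** The Legendre conjugate of the function equal to rho on K and to +oo elsewhere. With K bounded
    and nonempty and rho bounded below on K, the supremum is a genuine real number. *)
Definition conj_on rho y : R := sup [set dotmul_rV k y - rho k | k in K].

Lemma dotmul_le_bounded k y : K k -> dotmul_rV k y <= r * norm1 y.
Proof.
move=> Kk; rewrite /dotmul_rV /norm1 mulr_sumr; apply: ler_sum => i _.
by apply: (le_trans (ler_norm _)); rewrite normrM ler_wpM2r// Kr.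
Qed.

Section conj_on.
Variables (rho : V -> R) (c : R).
Hypothesis rhoc : forall k, K k -> c <= rho k.

Lemma has_sup_conj y : has_sup [set dotmul_rV k y - rho k | k in K].
Proof.
split; first by exists (dotmul_rV k0 y - rho k0); exists k0.
exists (r * norm1 y - c) => _ [k Kk <-].
by apply: lerB; [exact: dotmul_le_bounded|exact: rhoc].
Qed.

Lemma conj_on_ge k y : K k -> dotmul_rV k y - rho k <= conj_on rho y.
Proof. by move=> Kk; apply: ub_le_sup; [case: (has_sup_conj y)|exists k]. Qed.

Lemma conj_on_approx y e : 0 < e ->
  exists2 k, K k & conj_on rho y - e < dotmul_rV k y - rho k.
Proof.
move=> e0; have [_ [k Kk <-] h] := sup_adherent e0 (has_sup_conj y).
by exists k.
Qed.

Lemma conj_on_le y b : (forall k, K k -> dotmul_rV k y - rho k <= b) ->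
  conj_on rho y <= b.
Proof.
move=> H; apply: ge_sup; first by case: (has_sup_conj y).
by move=> _ [k Kk <-]; exact: H.
Qed.

(** A supremum of affine functions whose slopes lie in the box of radius r. This yields
    measurability, and later the growth bound around a near-minimizer of the tilted conjugate. *)
Lemma conj_on_lipschitz y z : conj_on rho y <= conj_on rho z + r * norm1 (y - z).
Proof.
apply: conj_on_le => k Kk.
have h := conj_on_ge z Kk; have h2 := dotmul_le_bounded (y - z) Kk.
rewrite dotmul_rVDr dotmul_rVNr in h2.
move: h h2; move: (dotmul_rV k y) (dotmul_rV k z) (conj_on rho z) (rho k) => p q w l; lra.
Qed.

Lemma measurable_conj_on : measurable_fun setT (conj_on rho).
Proof. exact: measurable_lipschitz conj_on_lipschitz. Qed.

Lemma conj_on_convex : convex_rV (conj_on rho).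
Proof.
move=> x y s /andP[s0 s1]; apply: conj_on_le => k Kk.
have h1 := ler_wpM2l s0 (conj_on_ge x Kk).
have s1' : 0 <= 1 - s by lra.
have h2 := ler_wpM2l s1' (conj_on_ge y Kk).
rewrite dotmul_rVDr !dotmul_rVZr.
move: h1 h2; move: (dotmul_rV k x) (dotmul_rV k y) (conj_on rho x) (conj_on rho y) (rho k) => p q w w' l; lra.
Qed.

End conj_on.

Variables (phi : V -> R) (c A : R).
Hypothesis phic : forall k, K k -> c <= phi k.
Hypothesis A0 : 0 < A.
Hypothesis convK : forall x y s, K x -> K y -> 0 <= s <= 1 -> K (s *: x + (1 - s) *: y).
Hypothesis convphi : forall x y s, K x -> K y -> 0 <= s <= 1 ->
  phi (s *: x + (1 - s) *: y) <= s * phi x + (1 - s) * phi y.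

Let rho k := phi k + A * halfsq k.

Let rhoc k : K k -> c <= rho k.
Proof.
move=> Kk; rewrite /rho; have := phic Kk.
have : 0 <= A * halfsq k by rewrite mulr_ge0 ?halfsq_ge0// ltW.
move: (halfsq k) (phi k) => p q; lra.
Qed.

(* Equal to [inf_(k in K) phi k + A * halfsq (x - k)] (see envelope_le and
   envelope_approx); this form makes its measurability evident. *)
Definition envelope x : R := A * halfsq x - conj_on rho (A *: x).

Definition envelope_conj y : R := conj_on phi y + halfsq y / A.

Let envelopeE k x : phi k + A * halfsq (x - k) =
  A * halfsq x - (dotmul_rV k (A *: x) - rho k).
Proof.
rewrite halfsqD halfsqN dotmul_rVNr dotmul_rVZr (dotmul_rVC k) /rho.
move: (dotmul_rV x k) (halfsq x) (halfsq k) => p q w; ring.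
Qed.

Lemma envelope_le k x : K k -> envelope x <= phi k + A * halfsq (x - k).
Proof. by move=> Kk; rewrite envelopeE lerD2l lerN2; exact: (conj_on_ge rhoc). Qed.

Lemma envelope_approx x e : 0 < e ->
  exists2 k, K k & phi k + A * halfsq (x - k) < envelope x + e.
Proof.
move=> e0; have [k Kk h] := conj_on_approx rhoc (A *: x) e0.
exists k => //; rewrite envelopeE /envelope.
move: h; move: (conj_on rho _) (dotmul_rV k (A *: x) - rho k) => p q; lra.
Qed.

Lemma measurable_envelope : measurable_fun setT envelope.
Proof.
apply: measurable_funB; first by apply: measurable_funM => //; exact: measurable_halfsq.
apply: (measurableT_comp (measurable_conj_on rhoc)).
have := @measurable_affine_rV R n A 0; congr measurable_fun.
by apply/funext => x; rewrite addr0.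
Qed.

Lemma measurable_envelope_conj : measurable_fun setT envelope_conj.
Proof.
apply: measurable_funD; first exact: (measurable_conj_on phic).
by apply: measurable_funM => //; exact: measurable_halfsq.
Qed.

(** Partial minimization of a jointly convex function of (x, k): near-minimizers k and l for x and y
    are combined with the same weights, and K is convex. *)
Lemma convex_envelope : convex_rV envelope.
Proof.
move=> x y s /andP[s0 s1]; apply/ler_addgt0Pr => e e0.
have [k Kk hk] := envelope_approx x e0; have [l Kl hl] := envelope_approx y e0.
have s01 : 0 <= s <= 1 by rewrite s0.
apply: (le_trans (envelope_le _ (convK Kk Kl s01))).
have -> : s *: x + (1 - s) *: y - (s *: k + (1 - s) *: l) =
   s *: (x - k) + (1 - s) *: (y - l) by rewrite !scalerBr opprD addrACA.
have h1 := convphi Kk Kl s01.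
have h2 := ler_wpM2l (ltW A0) (halfsq_convex (x - k) (y - l) s01).
have h3 := ler_wpM2l s0 (ltW hk).
have s1' : 0 <= 1 - s by lra.
have h4 := ler_wpM2l s1' (ltW hl).
move: h1 h2 h3 h4; move: (phi _) (halfsq (s *: _ + _)) (phi k) (phi l) (halfsq (x - k))
  (halfsq (y - l)) (envelope x) (envelope y) => p1 p2 p3 p4 p5 p6 p7 p8; lra.
Qed.

Lemma convex_envelope_conj : convex_rV envelope_conj.
Proof.
move=> x y s s01; have h1 := conj_on_convex phic x y s01.
have h2 := halfsq_convex x y s01.
have iA : 0 <= A^-1 by rewrite invr_ge0 ltW.
have {}h2 := ler_wpM2r iA h2.
rewrite /envelope_conj; move: h1 h2.
move: (conj_on phi (s *: x + (1 - s) *: y)) (conj_on phi x) (conj_on phi y).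
move: (halfsq (s *: x + (1 - s) *: y)) (halfsq x) (halfsq y) (A^-1).
move=> *; lra.
Qed.

Lemma superlinear_envelope : superlinear envelope.
Proof.
move=> b; have [C HC] := halfsq_superlinear n `|b| A0.
exists (C + `|b| * (n%:R * r) + 1 - c) => x.
have [k Kk hk] := envelope_approx x ltr01.
have h1 := HC (x - k); have h2 := phic Kk.
have h3 : norm1 x <= norm1 (x - k) + n%:R * r.
  rewrite -{1}(subrK k x); apply: (le_trans (norm1D _ _)); rewrite lerD2l.
  rewrite /norm1 -[X in X%:R * _]card_ord -sum1_card natr_sum mulr_suml.
  by apply: ler_sum => i _; rewrite mul1r Kr.
have h4 := ler_wpM2l (normr_ge0 b) h3.
have h5 : b * norm1 x <= `|b| * norm1 x by rewrite ler_wpM2r ?norm1_ge0// ler_norm.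
move: hk h1 h2 h4 h5; move: (halfsq _) (norm1 (x - k)) (norm1 x) (phi k) (envelope x) `|b|.
move=> p1 p2 p3 p4 p5 p6; lra.
Qed.

Lemma superlinear_envelope_conj : superlinear envelope_conj.
Proof.
move=> b; have iA : 0 < A^-1 by rewrite invr_gt0.
have [C HC] := halfsq_superlinear n (b + norm1 k0) iA.
exists (C + phi k0) => y.
have h1 := conj_on_ge phic y Kk0.
have h2 := HC y; have := normr_dotmul k0 y; rewrite ler_norml => /andP[h3 _].
rewrite /envelope_conj; move: h1 h2 h3.
move: (dotmul_rV k0 y) (conj_on phi y) (phi k0) (halfsq y) (norm1 y) (norm1 k0) (A^-1).
move=> p1 p2 p3 p4 p5 p6 p7; lra.
Qed.

(** Split x as k + (x - k) for a near-minimizer k: the conjugate bounds the pairing of k with y, and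
    Young's inequality bounds that of x - k with y. *)
Lemma envelope_fenchel x y : dotmul_rV y x <= envelope x + envelope_conj y.
Proof.
apply/ler_addgt0Pr => e e0; have [k Kk hk] := envelope_approx x e0.
have h1 := conj_on_ge phic y Kk.
have h2 := dotmul_le_halfsq (x - k) y A0.
rewrite dotmul_rVDl dotmul_rVNl in h2.
rewrite /envelope_conj (dotmul_rVC y); move: hk h1 h2.
move: (dotmul_rV x y) (dotmul_rV k y) (conj_on phi y) (phi k) (halfsq (x - k)) (halfsq y / A) (envelope x).
move=> p1 p2 p3 p4 p5 p6 p7; lra.
Qed.

(* The prox argument: an almost optimal [p] for the envelope at [u] yields the
   approximate subgradient [A *: (u - p)], by comparing [p] with the points of
   the segment from [p] to [k]. *)
Lemma envelope_biconj u e : 0 < e ->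
  exists y, envelope_conj y - dotmul_rV u y <= - envelope u + e.
Proof.
(* D bounds A [halfsq (k - p)] for all k and p in K, the second-order cost of moving along a segment
   in K. *)
move=> e0; pose D := A * (n%:R * (2 * r ^+ 2)) + 1.
have D0 : 0 < D by rewrite ltr_wpDl// !mulr_ge0 ?(ltW A0) ?sqr_ge0.
pose s := Num.min 1 (e / (2 * D)).
have s0 : 0 < s by rewrite lt_min ltr01 divr_gt0// mulr_gt0.
have s1 : s <= 1 by rewrite ge_min lexx.
have sD : s * D <= e / 2.
  rewrite -ler_pdivlMr//; apply: (@le_trans _ _ (e / (2 * D))).
    by rewrite ge_min lexx orbT.
  by rewrite invfM mulrA.
(* The first-order comparison is divided by s: a tolerance s e / 2 becomes e / 2, and the
   second-order cost s^2 D becomes s D <= e / 2. *)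
have e' : 0 < s * e / 2 by rewrite divr_gt0// mulr_gt0.
have [p Kp hp] := envelope_approx u e'.
pose y := A *: (u - p); exists y.
have main : conj_on phi y <= dotmul_rV p y - phi p + e.
  apply: (conj_on_le phic) => k Kk.
  have s01 : 0 <= s <= 1 by rewrite ltW.
  have h1 := envelope_le u (convK Kk Kp s01).
  have h2 := convphi Kk Kp s01.
  have eqk : u - (s *: k + (1 - s) *: p) = (u - p) - s *: (k - p).
    by apply/rowP => i; rewrite !mxE; ring.
  rewrite eqk halfsqD halfsqN halfsqZ dotmul_rVNr dotmul_rVZr in h1.
  have hq : A * halfsq (k - p) <= D.
    apply: (@le_trans _ _ (A * (n%:R * (2 * r ^+ 2)))); last by rewrite lerDl.
    rewrite ler_pM2l// halfsqE -[X in X%:R * _]card_ord -sum1_card natr_sum mulr_suml.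
    apply: ler_sum => i _; rewrite mul1r !mxE.
    have hk := Kr i Kk; have hp' := Kr i Kp.
    have := ler_normB (k ord0 i) (p ord0 i); rewrite -(real_normK (num_real (_ - _))).
    have : 0 <= `|k ord0 i - p ord0 i| by [].
    move: `|k ord0 i - p ord0 i| `|k ord0 i| `|p ord0 i| hk hp' => w a b ha hb w0 wab.
    have w2 : w <= 2 * r by lra.
    have : w ^+ 2 <= (2 * r) ^+ 2 by rewrite ler_pXn2r// nnegrE mulr_ge0.
    rewrite exprMn; lra.
  have dy : dotmul_rV (k - p) y = A * dotmul_rV (u - p) (k - p).
    by rewrite /y dotmul_rVZr dotmul_rVC.
  rewrite dotmul_rVDl dotmul_rVNl in dy.
  have hq2 := ler_wpM2l (ltW s0) hq.
  have : s * (dotmul_rV k y - phi k) <= s * (dotmul_rV p y - phi p + e).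
    have hq3 := ler_wpM2l (ltW s0) hq2.
    have hsD := ler_wpM2l (ltW s0) sD.
    have dys : s * (dotmul_rV k y + - dotmul_rV p y) = s * (A * dotmul_rV (u - p) (k - p)) by rewrite dy.
    move: h1 h2 hp hq3 hsD dys.
    move: (phi (_ + _)) (dotmul_rV k y) (dotmul_rV p y) (dotmul_rV (u - p) (k - p)).
    move: (envelope u) (phi k) (phi p) (halfsq (u - p)) (halfsq (k - p)).
    move=> E pk pp h1 h2 ps dk dp dd *; lra.
  by rewrite ler_pM2l.
rewrite /envelope_conj.
have e1 : halfsq y / A = A * halfsq (u - p).
  by rewrite /y halfsqZ; field; rewrite gt_eqF.
have e2 : dotmul_rV u y - dotmul_rV p y = 2 * (A * halfsq (u - p)).
  by rewrite -dotmul_rVNl -dotmul_rVDl /y dotmul_rVZr /halfsq; field.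
have h3 := envelope_le u Kp.
rewrite e1; move: main e2 h3; move: (conj_on phi y) (dotmul_rV u y) (dotmul_rV p y).
move: (halfsq _) (phi p) (envelope u) => h pp E w d1 d2 *; lra.
Qed.

End conjugate.

(** * Lower bounds from cubes of size 1 / t *)

Section box_lower_bound.
Context {R : realType}.
Variable n : nat.
Local Notation V := 'rV[R]_n.
Local Notation lam := (lebesgue_rV R n).
Implicit Types (u v x y z c g : V) (a b s t : R).

Definition cube c a : set V := [set x | forall i, c ord0 i - a <= x ord0 i <= c ord0 i + a].

Lemma measurable_cube c a : measurable (cube c a).
Proof.
rewrite (_ : cube c a = \bigcap_(i in [set: 'I_n])
    (@coord_rV R n i @^-1` `[c ord0 i - a, c ord0 i + a]%classic)).
  apply: fin_bigcap_measurable => // i _.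
  rewrite -[X in measurable X]setTI.
  exact: (measurable_coord_rV i measurableT (measurable_itv _)).
apply/seteqP; split=> [v vA i _|v vA i] /=; first by rewrite in_itv; exact: vA.
by have := vA i I; rewrite /= in_itv.
Qed.

Lemma lebesgue_rV_cube c a : 0 <= a -> lam (cube c a) = ((2 * a) ^+ n)%:E.
Proof.
move=> a0; rewrite /cube lebesgue_rV_box_itv; last by move=> i; lra.
congr EFin; rewrite (eq_bigr (fun=> 2 * a)); last by move=> i _; ring.
by rewrite prodr_const card_ord.
Qed.

Lemma le_of_double (I : \bar R) a : (0 <= I -> 2%:E * a%:E <= I + I -> a%:E <= I)%E.
Proof.
case: I => [w _| _ _|]; [|exact: leey|by rewrite leNgt ltNy0].
by rewrite -EFinM -EFinD !lee_fin; lra.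
Qed.

(** The bound must not depend on the slope g, which is unbounded in the applications; averaging over
    the symmetry of the cube removes the linear term. *)
Lemma integral_cube_expR c a g : 0 <= a ->
  (((2 * a) ^+ n)%:E <= \int[lam]_x (\1_(cube c a) x * expR (dotmul_rV g (x - c)))%:E)%E.
Proof.
move=> a0; set F := fun x => (_ * _)%:E.
have mC := measurable_cube c a.
have mE h : measurable_fun setT (fun x => expR (dotmul_rV h (x - c))).
  apply: measurableT_comp => //; apply: measurableT_comp; first exact: measurable_dotmul.
  have := @measurable_affine_rV R n 1 (- c); congr measurable_fun.
  by apply/funext => x; rewrite scale1r.
have mF h : measurable_fun setT (fun x => (\1_(cube c a) x * expR (dotmul_rV h (x - c)))%:E).
  by apply/measurable_EFinP; apply: measurable_funM => //; exact: mE.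
have F0 h x : (0 <= (\1_(cube c a) x * expR (dotmul_rV h (x - c)))%:E)%E.
  by rewrite lee_fin mulr_ge0 ?expR_ge0.
(* The cube is symmetric about [c], and e^s + e^(-s) >= 2. *)
have refl : (\int[lam]_x F x = \int[lam]_x (\1_(cube c a) x * expR (dotmul_rV (- g) (x - c)))%:E)%E.
  have N10 : (-1 : R) != 0 by rewrite oppr_eq0 oner_eq0.
  have := ge0_integral_affine_rV (2 *: c) N10 (mF g) (F0 g).
  rewrite normrN1 expr1n invr1 mul1e => <-; apply: eq_integral => x _.
  have -> : -1 *: x + 2 *: c - c = - (x - c) by apply/rowP => i; rewrite !mxE; ring.
  rewrite dotmul_rVNr dotmul_rVNl; congr ((_ * _)%:E); rewrite !indicE; congr ((nat_of_bool _)%:R).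
  apply/idP/idP; rewrite !inE => H i; have := H i; rewrite !mxE => /andP[? ?]; apply/andP; split; lra.
have e2 : (\int[lam]_x F x + \int[lam]_x F x =
    \int[lam]_x (F x + (\1_(cube c a) x * expR (dotmul_rV (- g) (x - c)))%:E))%E.
  by rewrite {2}refl (ge0_integralD lam measurableT (fun x _ => F0 g x) (mF g) (fun x _ => F0 (- g) x) (mF (- g))).
have le2 : (2%:E * ((2 * a) ^+ n)%:E <= \int[lam]_x F x + \int[lam]_x F x)%E.
  have vol : (\int[lam]_x (\1_(cube c a) x)%:E = ((2 * a) ^+ n)%:E)%E.
    by rewrite (integral_indic lam measurableT mC) setIT; exact: lebesgue_rV_cube.
  rewrite e2 -vol.
  have mI : measurable_fun setT (fun x => (\1_(cube c a) x)%:E : \bar R).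
    by apply/measurable_EFinP.
  have I0 (x : V) : setT x -> (0 <= (\1_(cube c a) x)%:E :> \bar R)%E by rewrite lee_fin.
  rewrite -(ge0_integralZl_EFin lam measurableT I0 mI (ler0n R 2)).
  apply: (ge0_le_integral lam measurableT).
  - by move=> x _; rewrite mule_ge0 ?lee_fin.
  - exact: measurable_funeM.
  - by apply: emeasurable_funD; exact: mF.
  move=> x _; rewrite /F -EFinM -EFinD lee_fin -mulrDr (mulrC 2) ler_wpM2l//.
  rewrite dotmul_rVNl; have := expR_ge1Dx (dotmul_rV g (x - c)).
  have := expR_ge1Dx (- dotmul_rV g (x - c)).
  by move: (dotmul_rV g (x - c)) (expR _) (expR _) => p q w; lra.
apply: le_of_double le2; apply: integral_ge0 => x _; exact: F0.
Qed.

(** Restrict the integral to the cube of half-side 1 / t about c. There t times the l1 and quadratic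
    terms is bounded independently of t, and the linear term is neutralized by symmetry; the volume
    gives (2 / t)^n. *)
Lemma partition_lower (h : V -> R) e0 c g L A t :
  measurable_fun setT h -> superlinear h -> 1 <= t -> 0 <= L -> 0 <= A ->
  (forall x, h x <= e0 + dotmul_rV g (x - c) + L * norm1 (x - c) + A * halfsq (x - c)) ->
  expR (- (t * e0)) * (expR (- (L * n%:R + A * n%:R / 2)) * 2 ^+ n / t ^+ n) <=
  partition_function (fun x => t * h x).
Proof.
move=> mh sh t1 L0 A0 H; have t0 : 0 < t by lra.
have it := integrable_expRN (measurable_funM (measurable_cst t) mh) (superlinearZ t0 sh).
pose B := expR (- (L * n%:R + A * n%:R / 2)).
rewrite -/B -lee_fin /partition_function fineK; last exact: (integrable_fin_num measurableT it).
have mC := measurable_cube c t^-1.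
have ti0 : 0 <= t^-1 by rewrite invr_ge0 ltW.
have mE h' : measurable_fun setT (fun x => expR (dotmul_rV h' (x - c))).
  apply: measurableT_comp => //; apply: measurableT_comp; first exact: measurable_dotmul.
  have := @measurable_affine_rV R n 1 (- c); congr measurable_fun.
  by apply/funext => x; rewrite scale1r.
have mF : measurable_fun setT (fun x => (\1_(cube c t^-1) x * expR (dotmul_rV (- t *: g) (x - c)))%:E).
  by apply/measurable_EFinP; apply: measurable_funM => //; exact: mE.
have F0 x : (0 <= (\1_(cube c t^-1) x * expR (dotmul_rV (- t *: g) (x - c)))%:E)%E.
  by rewrite lee_fin mulr_ge0 ?expR_ge0.
have B0 : 0 <= expR (- (t * e0)) * B by rewrite mulr_ge0 ?expR_ge0.
apply: (@le_trans _ _ ((expR (- (t * e0)) * B)%:E *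
  \int[lam]_x (\1_(cube c t^-1) x * expR (dotmul_rV (- t *: g) (x - c)))%:E)%E).
  rewrite (_ : expR _ * _ = (expR (- (t * e0)) * B) * (2 * t^-1) ^+ n); last first.
    by rewrite exprMn exprVn !mulrA.
  by rewrite EFinM; apply: lee_wpmul2l; [rewrite lee_fin|exact: integral_cube_expR].
rewrite -(ge0_integralZl_EFin lam measurableT (fun x _ => F0 x) mF B0).
apply: (ge0_le_integral lam measurableT).
- by move=> x _; rewrite mule_ge0// lee_fin.
- exact: measurable_funeM.
- by case/integrableP: it.
move=> x _; rewrite -EFinM lee_fin indicE.
have [|xC] := boolP (x \in cube c t^-1); last by rewrite mul0r mulr0 expR_ge0.
rewrite inE => xC; rewrite mul1r /B -!expRD ler_expR.
have hx := ler_wpM2l (ltW t0) (H x).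
have xi i : t * `|(x - c) ord0 i| <= 1.
  rewrite -ler_pdivlMl// mulr1 ler_norml !mxE.
  by have /andP[? ?] := xC i; apply/andP; split; lra.
have n1 : t * norm1 (x - c) <= n%:R.
  rewrite /norm1 mulr_sumr -[X in _ <= X%:R]card_ord -sum1_card natr_sum.
  by apply: ler_sum => i _; exact: xi.
have n2 : t * halfsq (x - c) <= n%:R / 2.
  rewrite halfsqE mulr_sumr -[X in _ <= X%:R / _]card_ord -sum1_card natr_sum mulr_suml.
  apply: ler_sum => i _; rewrite -(real_normK (num_real _)).
  have := xi i; have : 0 <= `|(x - c) ord0 i| by [].
  move: `|(x - c) ord0 i| => w w0 tw.
  (* Here t >= 1 enters: t w <= 1 also bounds w itself, hence t w^2. *)
  have w1 : w <= 1 by apply: le_trans tw; rewrite ler_peMl.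
  have : t * w * w <= 1 by apply: le_trans tw; rewrite ler_piMr// mulr_ge0// ltW.
  rewrite expr2; lra.
have {n1}n1 := ler_wpM2l L0 n1; have {n2}n2 := ler_wpM2l A0 n2.
rewrite dotmul_rVZl; move: hx n1 n2.
move: (dotmul_rV g (x - c)) (norm1 (x - c)) (halfsq (x - c)) (h x) n%:R => p1 p2 p3 p4 p5.
lra.
Qed.

End box_lower_bound.

Section mahler_envelope.
Context {R : realType}.
Variable n : nat.
Local Notation V := 'rV[R]_n.
Implicit Types (u v x y z k : V) (s t : R).
Variables (K : set V) (r : R) (k0 : V) (phi : V -> R) (c A : R).
Hypothesis n1 : (1 <= n)%N.
Hypothesis slicing : strong_slicing (R := R) n.
Hypothesis r0 : 0 <= r.
Hypothesis Kk0 : K k0.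
Hypothesis Kr : forall k i, K k -> `|k ord0 i| <= r.
Hypothesis phic : forall k, K k -> c <= phi k.
Hypothesis A0 : 0 < A.
Hypothesis convK : forall x y s, K x -> K y -> 0 <= s <= 1 -> K (s *: x + (1 - s) *: y).
Hypothesis convphi : forall x y s, K x -> K y -> 0 <= s <= 1 ->
  phi (s *: x + (1 - s) *: y) <= s * phi x + (1 - s) * phi y.

(** Extremal points for the conjugate and the envelope are available only up to e, and the lower
    bounds pass to the limit in e. *)
Lemma expR_le_limit b C P t : 0 <= t -> 0 <= C ->
  (forall e, 0 < e <= 1 -> expR (- (t * (- b + e))) * C <= P) -> expR (t * b) * C <= P.
Proof.
move=> t0 C0 H; rewrite -subr_ge0.
apply: (@le0_of_linear_bound R _ (expR (t * b) * C * t)) => e e01.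
have h := H e e01.
have h2 : expR (t * b) * C * (1 - t * e) <= expR (- (t * (- b + e))) * C.
  have -> : - (t * (- b + e)) = t * b - t * e by ring.
  rewrite expRD mulrAC ler_wpM2r// ler_wpM2l ?expR_ge0//.
  by have := expR_ge1Dx (- (t * e)); lra.
move: h h2; move: (expR (t * b)) (expR _) => p q; lra.
Qed.

Lemma mahler_envelope :
  n%:R <= ln (partition_function (envelope K phi A)) +
          ln (partition_function (envelope_conj K phi A)).
Proof.
have ma := measurable_envelope Kk0 Kr phic A0.
have mb := measurable_envelope_conj Kk0 Kr A phic.
have sa := superlinear_envelope Kk0 Kr phic A0.
have sb := superlinear_envelope_conj Kk0 Kr phic A0.
have ca := convex_envelope Kk0 Kr phic A0 convK convphi.
have cb := convex_envelope_conj Kk0 Kr phic A0.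
(* One constant for both directions: r is the Lipschitz constant of the conjugate, A the curvature
   of the envelope and A^-1 that of the quadratic part of [envelope_conj]. *)
pose B := expR (- (r * n%:R + (A + A^-1) * n%:R / 2)) * 2 ^+ n.
have B0 : 0 < B by rewrite mulr_gt0 ?expR_gt0 ?exprn_gt0.
have iA0 : 0 <= A^-1 by rewrite invr_ge0 ltW.
have AA0 : 0 <= A + A^-1 by rewrite addr_ge0// ltW.
have BB t : 1 <= t -> 0 <= B / t ^+ n.
  by move=> t1; rewrite divr_ge0 ?(ltW B0)// exprn_ge0//; lra.
apply: (mahler_superlinear n1 slicing ma mb sa sb ca cb _ B0).
- exact: (envelope_fenchel Kk0 Kr phic A0).
- move=> t v t1; apply: expR_le_limit => [| |e /andP[e0 e1]]; [lra|exact: BB|].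
  have [k Kk hk] := conj_on_approx Kk0 Kr phic v e0.
  (* The centre minimizes A [halfsq (x - k)] minus the pairing with v; completing the square leaves
     no linear term, hence the slope 0. *)
  apply: (@partition_lower _ _ _ _ (k + A^-1 *: v) 0) => //.
  + by apply: measurable_funB => //; exact: measurable_dotmul.
  + exact: superlinear_dotmul.
  move=> x; have h1 := envelope_le Kk0 Kr phic A0 x Kk.
  have -> : dotmul_rV 0 (x - (k + A^-1 *: v)) = 0.
    by rewrite /dotmul_rV big1// => i _; rewrite mxE mul0r.
  have hs : A * halfsq (x - k) - dotmul_rV v x =
     A * halfsq (x - (k + A^-1 *: v)) - dotmul_rV k v - halfsq v / A.
    have -> : x - (k + A^-1 *: v) = (x - k) - A^-1 *: v.
      by apply/rowP => i; rewrite !mxE; ring.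
    rewrite (halfsqD (x - k)) halfsqN halfsqZ dotmul_rVNr dotmul_rVZr dotmul_rVDl dotmul_rVNl.
    by rewrite (dotmul_rVC v x); field; rewrite gt_eqF.
  have h2 : 0 <= r * norm1 (x - (k + A^-1 *: v)) by rewrite mulr_ge0// norm1_ge0.
  have h3 : 0 <= A^-1 * halfsq (x - (k + A^-1 *: v)) by rewrite mulr_ge0// halfsq_ge0.
  rewrite /envelope_conj; move: h1 hs h2 h3 hk.
  move: (halfsq (x - k)) (halfsq (x - (k + A^-1 *: v))) (dotmul_rV k v) (dotmul_rV v x).
  move: (A^-1) (norm1 _) (halfsq v) (conj_on K phi v) (envelope K phi A x) (phi k).
  move=> p1 p2 p3 p4 p5 p6 p7 p8 p9 p10; lra.
- move=> t u t1; apply: expR_le_limit => [| |e /andP[e0 e1]]; [lra|exact: BB|].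
  have [y0 hy0] := envelope_biconj r0 Kk0 Kr phic A0 convK convphi u e0.
  (* The slope is the gradient at y0 of the quadratic part minus the pairing with u; the remaining
     part, [conj_on], is controlled by its Lipschitz constant r. *)
  apply: (@partition_lower _ _ _ _ y0 (A^-1 *: y0 - u)) => //.
  + by apply: measurable_funB => //; exact: measurable_dotmul.
  + exact: superlinear_dotmul.
  move=> y; have h1 := conj_on_lipschitz Kk0 Kr phic y y0.
  have hs : halfsq y / A = halfsq y0 / A + A^-1 * dotmul_rV y0 (y - y0) + A^-1 * halfsq (y - y0).
    have -> : halfsq y = halfsq y0 + dotmul_rV y0 (y - y0) + halfsq (y - y0).
      by rewrite -halfsqD addrC subrK.
    by move: (halfsq y0) (dotmul_rV y0 _) (halfsq (y - y0)) => p q w; ring.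
  have hu : dotmul_rV u y = dotmul_rV u y0 + dotmul_rV u (y - y0).
    by rewrite -dotmul_rVDr addrC subrK.
  have h3 : 0 <= A * halfsq (y - y0) by rewrite mulr_ge0 ?halfsq_ge0// ltW.
  rewrite (dotmul_rVDl (A^-1 *: y0)) dotmul_rVNl dotmul_rVZl.
  move: hy0; rewrite /envelope_conj hs hu; move: h1 h3.
  move: (dotmul_rV y0 (y - y0)) (dotmul_rV u (y - y0)) (dotmul_rV u y0) (halfsq (y - y0)) (norm1 (y - y0)).
  move: (A^-1) (conj_on K phi y) (conj_on K phi y0) (envelope K phi A u) (halfsq y0).
  move=> p1 p2 p3 p4 p5 p6 p7 p8 p9 p10; lra.
Qed.

End mahler_envelope.

(** * Log-concave functions *)

Section convex_sets.
Context {R : realType}.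

Definition convex_subset_rV n (C : set 'rV[R]_n) := forall x y (s : R), C x -> C y ->
  0 <= s <= 1 -> C (s *: x + (1 - s) *: y).

Lemma cons_rV_comb n (s x1 x2 : R) (v1 v2 : 'rV[R]_n) :
  cons_rV (s * x1 + (1 - s) * x2, s *: v1 + (1 - s) *: v2) =
  s *: cons_rV (x1, v1) + (1 - s) *: cons_rV (x2, v2).
Proof.
apply/rowP => i; rewrite [in RHS]mxE [X in _ = X + _]mxE [X in _ = _ + X]mxE.
case: (unliftP ord0 i) => [j|] ->; last by rewrite !cons_rV0.
by rewrite !cons_rVS/= !mxE.
Qed.

Lemma lebesgue_rV_sections n (D : set 'rV[R]_n.+1) : measurable D ->
  (lebesgue_rV R n.+1 D =
   \int[@lebesgue_measure R]_x lebesgue_rV R n [set v | D (cons_rV (x, v))])%E.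
Proof.
move=> mD.
have mI : measurable_fun setT (fun v : 'rV[R]_n.+1 => (\1_D v)%:E : \bar R).
  by apply/measurable_EFinP.
transitivity (\int[lebesgue_rV R n.+1]_v (\1_D v)%:E)%E.
  by rewrite (integral_indic (lebesgue_rV R n.+1) measurableT mD) setIT.
rewrite ge0_integral_cons//; apply: eq_integral => x _.
have mDx : measurable [set v : 'rV[R]_n | D (cons_rV (x, v))].
  rewrite -[X in measurable X]setTI.
  apply: (_ : measurable_fun setT (fun v : 'rV[R]_n => cons_rV (x, v))) => //.
  by apply: measurableT_comp; [exact: measurable_cons_rV|exact: pair1_measurable].
rewrite -[X in lebesgue_rV R n X]setIT -(integral_indic (lebesgue_rV R n) measurableT mDx).
by apply: eq_integral => v _; rewrite !indicE; congr ((nat_of_bool _)%:R%:E); apply/idP/idP; rewrite !inE.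
Qed.

(** Otherwise the measure of the sections would vanish except perhaps at one abscissa, and Tonelli
    would make D negligible. *)
Lemma two_thick_sections n (D : set 'rV[R]_n.+1) : measurable D ->
  (0 < lebesgue_rV R n.+1 D)%E ->
  exists x1 x2 : R, [/\ x1 < x2,
    (0 < lebesgue_rV R n [set v | D (cons_rV (x1, v))])%E &
    (0 < lebesgue_rV R n [set v | D (cons_rV (x2, v))])%E].
Proof.
move=> mD D0; pose g (x : R) := lebesgue_rV R n [set v | D (cons_rV (x, v))].
have thick : exists x, (0 < g x)%E.
  apply: contrapT => nx; move: D0; rewrite lebesgue_rV_sections//.
  rewrite integral0_eq ?ltxx// => x _; apply/eqP; rewrite eq_le measure_ge0 andbT leNgt.
  by apply/negP => gx; apply: nx; exists x.
have [x0 gx0] := thick.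
have [x gx xx0] : exists2 x, (0 < g x)%E & x != x0.
  apply: contrapT => nx; move: D0; rewrite lebesgue_rV_sections//.
  rewrite (@nonmeasurable_ae_eq_integral _ _ _ (@lebesgue_measure R) _ (cst 0%E)).
    by rewrite integral0 ltxx.
  exists [set x0]; split => //; first exact: lebesgue_measure_set1.
  move=> y /= gy; apply: contrapT => yx0; apply: nx; exists y; last exact/eqP.
  by rewrite lt_neqAle measure_ge0 andbT eq_sym; apply/eqP.
have [lt|gt|eq] := ltgtP x x0.
- by exists x, x0.
- by exists x0, x.
- by rewrite eq eqxx in xx0.
Qed.

(** C need not be Borel, hence the measurable subset D. Two parallel sections contain cubes by
    induction, and the convex hull of these contains a cube about the midpoint of their centres. *)
Lemma convex_contains_cube n (C D : set 'rV[R]_n) : convex_subset_rV C ->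
  measurable D -> D `<=` C -> (0 < lebesgue_rV R n D)%E ->
  exists c a, 0 < a /\ cube c a `<=` C.
Proof.
elim: n C D => [|n IH] C D cC mD DC D0.
  have [x Dx] : D !=set0.
    by apply/set0P; apply/eqP => De; move: D0; rewrite De measure0 ltxx.
  exists x, 1; split => // y _; apply: DC.
  by rewrite (_ : y = x)//; apply/rowP; case.
have [x1 [x2 [x12 D1 D2]]] := two_thick_sections mD D0.
pose Cx x := [set v : 'rV[R]_n | C (cons_rV (x, v))].
have sec x : (0 < lebesgue_rV R n [set v | D (cons_rV (x, v))])%E ->
    exists c a, 0 < a /\ cube c a `<=` Cx x.
  apply: IH.
  - move=> v w s Cv Cw s01; rewrite /Cx /=.
    have -> : x = s * x + (1 - s) * x by ring.
    by rewrite cons_rV_comb; exact: cC.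
  - rewrite -[X in measurable X]setTI.
    apply: (_ : measurable_fun setT (fun v : 'rV[R]_n => cons_rV (x, v))) => //.
    by apply: measurableT_comp; [exact: measurable_cons_rV|exact: pair1_measurable].
  - by move=> v; exact: DC.
have [c1 [a1 [a10 H1]]] := sec _ D1; have [c2 [a2 [a20 H2]]] := sec _ D2.
pose L := x2 - x1; have L0 : 0 < L by rewrite subr_gt0.
pose M := norm1 (c1 - c2); have M0 : 0 <= M := norm1_ge0 _.
pose a := Num.min a1 a2; have a0 : 0 < a by rewrite lt_min a10.
have ML : 0 < 1 + M / L by rewrite ltr_pwDl// divr_ge0// ltW.
(* The bound L / 2 keeps the cube between the two sections. A shift of rho across them moves the
   interpolated centre by at most (rho / L) M per coordinate, and rho + (rho / L) M <= a keeps the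
   offset in both cubes. *)
pose rho := Num.min (L / 2) (a / (1 + M / L)).
have rho0 : 0 < rho by rewrite lt_min !divr_gt0.
have rhoL : rho <= L / 2 by rewrite ge_min lexx.
have rhoa : rho + rho / L * M <= a.
  have -> : rho + rho / L * M = rho * (1 + M / L) by ring.
  by rewrite -ler_pdivlMr// ge_min lexx orbT.
exists (cons_rV ((x1 + x2) / 2, 2^-1 *: (c1 + c2))), rho; split => // y yc.
have y0 := yc ord0; rewrite cons_rV0/= in y0.
have yS i : `|y ord0 (lift ord0 i) - (c1 ord0 i + c2 ord0 i) / 2| <= rho.
  have := yc (lift ord0 i); rewrite cons_rVS/= !mxE => /andP[? ?].
  by rewrite ler_norml; apply/andP; split; lra.
pose x := y ord0 ord0; pose th := (x2 - x) / L.
have xE : x = th * x1 + (1 - th) * x2.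
  by rewrite /th /L; field; rewrite subr_eq0 gt_eqF.
have th2 : `|th - 1 / 2| <= rho / L.
  rewrite (_ : th - 1 / 2 = ((x1 + x2) / 2 - x) / L); last first.
    by rewrite /th /L; field; rewrite subr_eq0 gt_eqF.
  rewrite normrM [`|L^-1|]gtr0_norm ?invr_gt0// ler_pM2r ?invr_gt0//.
  by case/andP: y0; rewrite -/x ler_norml => ? ?; apply/andP; split; lra.
have th01 : 0 <= th <= 1.
  have rL : rho / L <= 1 / 2 by rewrite ler_pdivrMr//; lra.
  by move: th2; rewrite ler_norml => /andP[? ?]; apply/andP; split; lra.
pose v : 'rV[R]_n := \row_i y ord0 (lift ord0 i).
(* The offset of v from the interpolated centre; added to both centres, it exhibits y as a convex
   combination of points of the two cubes. *)
pose e := v - (th *: c1 + (1 - th) *: c2).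
have ei i : `|e ord0 i| <= a.
  have ME : `|c1 ord0 i - c2 ord0 i| <= M.
    by rewrite /M /norm1 (bigD1 i)//= !mxE lerDl sumr_ge0.
  have -> : e ord0 i = (y ord0 (lift ord0 i) - (c1 ord0 i + c2 ord0 i) / 2) -
      (th - 1 / 2) * (c1 ord0 i - c2 ord0 i) by rewrite !mxE; field.
  apply: le_trans rhoa; apply: (le_trans (ler_normB _ _)); apply: lerD => //.
  by rewrite normrM ler_pM.
have -> : y = cons_rV (x, th *: (c1 + e) + (1 - th) *: (c2 + e)).
  apply/rowP => i; case: (unliftP ord0 i) => [j|] ->; last by rewrite cons_rV0.
  by rewrite cons_rVS/= !mxE; ring.
rewrite xE cons_rV_comb; apply: cC => //.
  apply: H1 => i; rewrite mxE; have := ei i.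
  have : a <= a1 by rewrite ge_min lexx.
  by rewrite ler_norml => ? /andP[? ?]; apply/andP; split; lra.
apply: H2 => i; rewrite mxE; have := ei i.
have : a <= a2 by rewrite ge_min lexx orbT.
by rewrite ler_norml => ? /andP[? ?]; apply/andP; split; lra.
Qed.

End convex_sets.

Section log_concave_decay.
Context {R : realType}.
Variable n : nat.
Local Notation V := 'rV[R]_n.
Local Notation lam := (lebesgue_rV R n).
Implicit Types (x y b : V) (s t c r : R).
Variable f : V -> R.
Hypothesis lcf : log_concave f.

Lemma log_concave_ge0 x : 0 <= f x.
Proof. by case: lcf => phi [_ _ fE]; rewrite -lee_fin fE expeR_ge0. Qed.

Lemma log_concave_ln x y t : 0 < f x -> 0 < f y -> 0 <= t <= 1 ->
  0 < f (t *: x + (1 - t) *: y) /\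
  t * ln (f x) + (1 - t) * ln (f y) <= ln (f (t *: x + (1 - t) *: y)).
Proof.
case: lcf => phi [phiNy cphi fE].
have fin z : 0 < f z -> phi z = (- ln (f z))%:E.
  move=> fz; have := fE z; have := phiNy z; case: (phi z) => [w _|_|//] /=.
    by move=> [->]; rewrite expRK opprK.
  by move=> e; move: fz; rewrite -lte_fin e ltxx.
move=> fx fy t01; have := cphi x y t t01.
rewrite (fin x fx) (fin y fy) -!EFinM -EFinD.
set z := t *: x + _; have := phiNy z; have := fE z.
case: (phi z) => [w| |] /= => [e _|_ _|_]; [|by rewrite leNgt ltry|by []].
have {e}-> : f z = expR (- w) by apply: EFin_inj.
by rewrite lee_fin expRK => h; split; [exact: expR_gt0|lra].
Qed.

Hypothesis intf : lebesgue_integrable f.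
Hypothesis f_gt0 : 0 < \int[lam]_x f x.

Lemma log_concave_EFin : (\int[lam]_x (f x)%:E = (\int[lam]_x f x)%:E)%E.
Proof.
have [g ig fg] := intf; rewrite /Rintegral fineK//.
rewrite (@nonmeasurable_ae_eq_integral _ _ _ lam _ (EFin \o g)).
  exact: (integrable_fin_num measurableT ig).
by apply: filterS fg => x /= ->.
Qed.

Lemma measure_superlevel (E : set V) (m : R) : measurable E -> 0 <= m ->
  (forall x, E x -> m <= f x) -> (m%:E * lam E <= (\int[lam]_x f x)%:E)%E.
Proof.
move=> mE m0 H; rewrite -log_concave_EFin.
have mI : measurable_fun setT (fun v : V => (\1_E v)%:E : \bar R).
  by apply/measurable_EFinP.
rewrite -[E]setIT -(integral_indic lam measurableT mE).
rewrite -(ge0_integralZl_EFin lam measurableT (fun x _ => _) mI m0); last first.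
  by move=> x _; rewrite lee_fin.
apply: ge0_nonmeasurable_ae_le_integral.
- by move=> x; rewrite mule_ge0// lee_fin.
- by move=> x; rewrite lee_fin log_concave_ge0.
apply: aeW => x; rewrite -EFinM lee_fin indicE.
have [|_] := boolP (x \in E); last by rewrite mulr0 log_concave_ge0.
by rewrite inE mulr1 => /H.
Qed.

Lemma convex_superlevel c : 0 < c -> convex_subset_rV [set x | c <= f x].
Proof.
move=> c0 x y s /= cx cy s01.
have fx : 0 < f x by exact: lt_le_trans cx.
have fy : 0 < f y by exact: lt_le_trans cy.
have [fz h] := log_concave_ln fx fy s01.
rewrite -ler_ln ?posrE//; apply: le_trans h.
have hx : ln c <= ln (f x) by rewrite ler_ln ?posrE.
have hy : ln c <= ln (f y) by rewrite ler_ln ?posrE.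
case/andP: s01 => s0 s1; have s1' : 0 <= 1 - s by lra.
have := ler_wpM2l s0 hx; have := ler_wpM2l s1' hy; lra.
Qed.

(** Some level set of the Borel representative g has positive measure since the integral of f is
    positive. Removing the exceptional null set N makes it a Borel subset of a convex superlevel set
    of f. *)
Lemma superlevel_contains_cube :
  exists c b r, [/\ 0 < c, 0 < r & forall x, cube b r x -> c <= f x].
Proof.
have [g ig [N [mN N0 fgN]]] := intf.
have mg : measurable_fun setT g by apply/measurable_EFinP; case/integrableP: ig.
pose D m := [set x | m.+1%:R^-1 <= g x] `\` N.
have mD m : measurable (D m).
  apply: measurableD => //; rewrite (_ : mkset _ = g @^-1` `[m.+1%:R^-1, +oo[%classic).
    by rewrite -[X in measurable X]setTI; apply: mg => //; exact: measurable_itv.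
  by apply/seteqP; split => x /=; rewrite in_itv/= andbT.
have fgE x : ~ N x -> f x = g x.
  by move=> Nx; apply: contrapT => fg; apply: Nx; exact: fgN.
have [m Dm] : exists m, (0 < lam (D m))%E.
  apply: contrapT => nD; move: f_gt0; rewrite -lte_fin -log_concave_EFin.
  rewrite (@nonmeasurable_ae_eq_integral _ _ _ lam _ (cst 0%E)).
    by rewrite integral0 ltxx.
  exists (N `|` \bigcup_m D m); split.
  - by apply: measurableU => //; exact: bigcupT_measurable.
  - apply: null_set_setU => //; first exact: bigcupT_measurable.
    apply/eqP; rewrite -measure_le0.
    apply: (le_trans (measure_sigma_subadditive lam mD _ (subset_refl _))).
      exact: bigcupT_measurable.
      by move=> x; exact.
    rewrite eseries0// => i _ _; apply/eqP; rewrite eq_le measure_ge0 andbT leNgt.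
    by apply/negP => Di; apply: nD; exists i.
  move=> x /= fx0; have [Nx|Nx] := pselect (N x); first by left.
  right; have gx : 0 < g x.
    rewrite -fgE// lt_neqAle log_concave_ge0 andbT; apply/eqP => fx; apply: fx0.
    by rewrite -fx.
  have [m mgx] := @ltr_add_invr R 0 (g x) gx.
  by exists m => //; split => //=; rewrite add0r in mgx; exact: ltW.
pose c : R := m.+1%:R^-1; have c0 : 0 < c by rewrite invr_gt0.
have [|b [r [r0 H]]] := @convex_contains_cube R n [set x | c <= f x] (D m)
  (convex_superlevel c0) (mD m) _ Dm.
  by move=> x [/= cx Nx]; rewrite fgE.
by exists c, b, r; split.
Qed.

Section decay.
Variables (c r : R) (b : V).
Hypotheses (c0 : 0 < c) (r0 : 0 < r).
Hypothesis cubef : forall x, cube b r x -> c <= f x.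
Local Notation I := (\int[lam]_x f x).

(** Such a y lies on the segment from x to a point z of the cube: dividing the offset, at most r /
    2, by 1 - th >= 1 / 2 gives at most r. *)
Lemma log_concave_interp x y th : 0 < f x -> 0 <= th <= 1 / 2 ->
  (forall i, `|y ord0 i - (b ord0 i + th * (x ord0 i - b ord0 i))| <= r / 2) ->
  0 < f y /\ th * ln (f x) + (1 - th) * ln c <= ln (f y).
Proof.
move=> fx /andP[th0 th1] H.
pose z : V := b + (1 - th)^-1 *: (y - (b + th *: (x - b))).
have th1' : 0 < 1 - th by lra.
have cz : c <= f z.
  apply: cubef => i; have := H i; rewrite !mxE.
  move: (y ord0 i - _) => w; rewrite ler_norml => /andP[w1 w2].
  have i2 : (1 - th)^-1 <= 2 by rewrite -[leRHS]invrK lef_pV2 ?posrE ?invr_gt0//; lra.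
  have i0 : 0 < (1 - th)^-1 by rewrite invr_gt0.
  by apply/andP; split; nra.
have fz : 0 < f z by exact: lt_le_trans cz.
have -> : y = th *: x + (1 - th) *: z.
  by apply/rowP => i; rewrite !mxE; field; rewrite gt_eqF.
have th01 : 0 <= th <= 1 by apply/andP; split; lra.
have [fy h] := log_concave_ln fx fz th01; split => //; apply: le_trans h.
by rewrite lerD2l ler_wpM2l ?(ltW th1')// ler_ln ?posrE.
Qed.

(** On the cube of side r about the midpoint of x and b, f is at least the geometric mean of f x and
    c. Comparison with the integral I gives f x <= (I / r^n)^2 / c. *)
Lemma log_concave_bounded : exists2 S, 0 < S & forall x, f x <= S.
Proof.
exists (expR (2 * ln (I / r ^+ n) - ln c)); first exact: expR_gt0.
move=> x; have [fx|fx] := ltP 0 (f x); last by rewrite (le_trans fx)// expR_ge0.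
have rn : 0 < r ^+ n by rewrite exprn_gt0.
pose m := expR ((ln (f x) + ln c) / 2).
have : (m%:E * lam (cube (2^-1 *: (x + b)) (r / 2)) <= I%:E)%E.
  apply: measure_superlevel; [exact: measurable_cube|exact: expR_ge0|].
  move=> y yc; have [||fy h] := @log_concave_interp x y 2^-1 fx.
  - by apply/andP; split; lra.
  - move=> i; have := yc i; rewrite !mxE => /andP[? ?].
    by rewrite ler_norml; apply/andP; split; lra.
  by rewrite -[leRHS]lnK ?posrE// ler_expR; lra.
rewrite lebesgue_rV_cube; last by rewrite divr_ge0// ltW.
rewrite (_ : 2 * (r / 2) = r); last by field.
rewrite -EFinM lee_fin -ler_pdivlMr// => h.
have {}h : (ln (f x) + ln c) / 2 <= ln (I / r ^+ n).
  by rewrite -[leLHS]expRK ler_ln ?posrE ?expR_gt0// divr_gt0.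
by rewrite -[leLHS]lnK ?posrE// ler_expR; lra.
Qed.

Lemma sum_disjoint_indic (T : Type) (A : nat -> set T) (N : nat) (x : T) :
  (forall j k, A j x -> A k x -> j = k) -> \sum_(j < N) \1_(A j) x <= 1 :> R.
Proof.
move=> H; have [[j Aj]|nA] := pselect (exists j : 'I_N, A j x).
  rewrite (bigD1 j)//= big1 ?addr0; first by rewrite indicE; case: (_ \in _).
  move=> k kj; rewrite indicE memNset// => Ak; move/eqP: kj; apply.
  by apply: val_inj; exact: H Ak Aj.
by rewrite big1// => j _; rewrite indicE memNset// => Aj; apply: nA; exists j.
Qed.

(* Interpolating between a far point and the cube gives disjoint cubes on which
   [c / e <= f]; their number is bounded by the integral of [f]. *)
Lemma log_concave_small_far : exists2 R0, 0 < R0 &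
  forall x i, R0 <= `|x ord0 i - b ord0 i| -> f x <= c * expR (-1).
Proof.
have rn : 0 < r ^+ n by rewrite exprn_gt0.
pose m := c * expR (-1); have m0 : 0 < m by rewrite mulr_gt0 ?expR_gt0.
have [N NI] : exists N, I < N.+1%:R * (m * r ^+ n).
  have mr : 0 < m * r ^+ n by rewrite mulr_gt0.
  exists (Num.truncn (I / (m * r ^+ n))); rewrite -ltr_pdivrMr//.
  by rewrite truncnS_gt.
have N0 : 0 < N.+1%:R :> R by rewrite ltr0n.
(* Consecutive centres differ by at least 2 r in coordinate i, since the parameters are spaced by 1
   / (2 (N + 1)); cubes of side r are then disjoint. *)
exists (4 * N.+1%:R * r); first by rewrite !mulr_gt0.
move=> x i xi; rewrite leNgt; apply/negP => fxm.
have fx : 0 < f x by exact: lt_trans fxm.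
have mE : ln m = ln c - 1 by rewrite lnM ?posrE ?expR_gt0// expRK.
have lnfx : ln c - 1 <= ln (f x) by rewrite -mE ler_ln ?posrE// ltW.
pose th (j : nat) : R := j%:R / (2 * N.+1%:R).
have th01 (j : 'I_N.+1) : 0 <= th j <= 1 / 2.
  rewrite /th divr_ge0//= ler_pdivrMr ?mulr_gt0// mulrA (_ : 1 / 2 * 2 = 1) ?mul1r ?ler_nat.
    exact/ltnW/ltn_ord.
  by field.
pose Q j := cube (b + th j *: (x - b)) (r / 2).
have Qf (j : 'I_N.+1) y : Q j y -> m <= f y.
  move=> yc; have [|fy h] := @log_concave_interp x y (th j) fx (th01 j).
    move=> k; have := yc k; rewrite !mxE => /andP[? ?].
    by rewrite ler_norml; apply/andP; split; lra.
  rewrite -ler_ln ?posrE// mE; apply: le_trans h.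
  case/andP: (th01 j) => t0 t1; have := ler_wpM2l t0 lnfx; lra.
have Qdisj y j k : Q j y -> Q k y -> j = k.
  wlog jk : j k / (j <= k)%N.
    by move=> H; case: (leqP j k) => [|/ltnW] jk Qj Qk; [|apply/esym]; exact: H.
  move=> Qj Qk; apply/eqP; rewrite eqn_leq jk /= leqNgt; apply/negP => jltk.
  have := Qj i; have := Qk i; rewrite !mxE => /andP[q1 q2] /andP[q3 q4].
  have : `|(th k - th j) * (x ord0 i - b ord0 i)| <= r.
    by rewrite ler_norml; apply/andP; split; lra.
  apply/negP; rewrite -ltNge normrM.
  have tjk : (2 * N.+1%:R)^-1 <= `|th k - th j|.
    rewrite -mulrBl normrM [X in _ <= _ * X]gtr0_norm ?invr_gt0 ?mulr_gt0//.
    rewrite ler_peMl ?invr_ge0 ?mulr_ge0//.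
    rewrite -natrB// normr_nat ler1n subn_gt0//.
  apply: (@lt_le_trans _ _ ((2 * N.+1%:R)^-1 * (4 * N.+1%:R * r))).
    have -> : (2 * N.+1%:R)^-1 * (4 * N.+1%:R * r) = 2 * r by field; rewrite gt_eqF.
    by move: r0 => r0'; lra.
  by apply: ler_pM => //; rewrite ?invr_ge0 ?mulr_ge0// ltW.
have mQ j : measurable (Q j) by exact: measurable_cube.
have mI (j : 'I_N.+1) : measurable_fun setT (fun y : V => (m * \1_(Q j) y)%:E : \bar R).
  by apply/measurable_EFinP; exact: measurable_funM.
have I0 (j : 'I_N.+1) (y : V) : setT y -> (0 <= (m * \1_(Q j) y)%:E :> \bar R)%E.
  by move=> _; rewrite lee_fin mulr_ge0// ltW.
have : (\int[lam]_y \sum_(j < N.+1) (m * \1_(Q j) y)%:E <= I%:E)%E.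
  rewrite -log_concave_EFin; apply: ge0_nonmeasurable_ae_le_integral.
  - by move=> y; apply: sume_ge0 => j _; exact: I0.
  - by move=> y; rewrite lee_fin log_concave_ge0.
  apply: aeW => y; rewrite sumEFin lee_fin -mulr_sumr.
  have [[j Qj]|nQ] := pselect (exists j : 'I_N.+1, Q j y).
    apply: le_trans (Qf j y Qj); rewrite ler_piMr ?(ltW m0)//.
    exact: (@sum_disjoint_indic _ Q _ y (Qdisj y)).
  rewrite big1 ?mulr0 ?log_concave_ge0// => j _.
  by rewrite indicE memNset// => Qj; apply: nQ; exists j.
rewrite ge0_integral_sum//.
have vol (j : 'I_N.+1) : (\int[lam]_y (m * \1_(Q j) y)%:E = (m * r ^+ n)%:E)%E.
  have mI' : measurable_fun setT (fun v : V => (\1_(Q j) v)%:E : \bar R).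
    by apply/measurable_EFinP.
  rewrite (ge0_integralZl_EFin lam measurableT (fun x _ => _) mI' (ltW m0)); last first.
    by move=> y _; rewrite lee_fin.
  have lQ : lam (Q j) = (r ^+ n)%:E.
    rewrite [LHS]lebesgue_rV_cube; last by rewrite divr_ge0// ltW.
    by congr (_ ^+ _)%:E; field.
  rewrite (integral_indic lam measurableT (mQ j)) setIT.
  exact: (congr1 (fun z => m%:E * z)%E lQ).
rewrite (eq_bigr (fun=> (m * r ^+ n)%:E)); last by move=> j _; exact: vol.
rewrite sumEFin lee_fin sumr_const card_ord -mulr_natl.
by move=> /(lt_le_trans NI); rewrite ltxx.
Qed.

(** At distance R0 from b in some coordinate, ln f is already at most ln c - 1; concavity along the
    segment from b to x extends this to a linear decrease. Averaging the n coordinate bounds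
    produces [norm1], whence the rate 1 / (n R0). *)
Lemma log_concave_decay : (1 <= n)%N ->
  exists C a, [/\ 0 <= C, 0 < a & forall x, f x <= C * expR (- (a * norm1 x))].
Proof.
move=> n1; have [S S0 fS] := log_concave_bounded.
have [R0 R00 far] := log_concave_small_far.
have n0 : 0 < n%:R :> R by rewrite ltr0n.
(* The second entry covers the points closer than R0, where the subtracted quotient is at most 1. *)
pose C1 := Num.max (ln c) (ln S + 1).
have coord x i : 0 < f x -> ln (f x) <= C1 - `|x ord0 i - b ord0 i| / R0.
  move=> fx; set w := `|_|.
  have [wR|wR] := leP R0 w; last first.
    have : ln (f x) <= ln S by rewrite ler_ln ?posrE.
    have : w / R0 <= 1 by rewrite ler_pdivrMr// mul1r ltW.
    have : ln S + 1 <= C1 by rewrite le_max lexx orbT.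
    lra.
  have w0 : 0 < w by exact: lt_le_trans wR.
  pose th := R0 / w.
  have th0 : 0 < th by rewrite divr_gt0.
  have th01 : 0 <= th <= 1 by rewrite ltW//= ler_pdivrMr// mul1r.
  have cb : c <= f b by apply: cubef => k; rewrite gerBl lerDl ltW.
  have fb : 0 < f b by exact: lt_le_trans cb.
  have [fy h] := log_concave_ln fx fb th01.
  have small : f (th *: x + (1 - th) *: b) <= c * expR (-1).
    apply: (far _ i); rewrite !mxE.
    rewrite (_ : _ - _ = th * (x ord0 i - b ord0 i)); last by ring.
    by rewrite normrM gtr0_norm// -/w divfK// gt_eqF.
  have lns : ln (f (th *: x + (1 - th) *: b)) <= ln c - 1.
    rewrite (_ : ln c - 1 = ln (c * expR (-1))); last first.
      by rewrite lnM ?posrE ?expR_gt0// expRK.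
    by rewrite ler_ln ?posrE// mulr_gt0 ?expR_gt0.
  have lncb : ln c <= ln (f b) by rewrite ler_ln ?posrE.
  have t1' : 0 <= 1 - th by case/andP: th01 => _; lra.
  have h2 := ler_wpM2l t1' lncb.
  have h3 : th * ln (f x) <= th * (ln c - w / R0).
    have -> : th * (ln c - w / R0) = th * ln c - 1.
      by rewrite /th; field; rewrite !gt_eqF.
    lra.
  rewrite ler_pM2l// in h3; apply: (le_trans h3).
  by rewrite lerD2r le_max lexx.
pose a := (n%:R * R0)^-1.
have a0 : 0 < a by rewrite invr_gt0 mulr_gt0.
exists (expR (C1 + a * norm1 b)), a; split=> [||x]; [exact: expR_ge0|exact: a0|].
have [fx|fx] := ltP 0 (f x); last first.
  by rewrite (le_trans fx)// mulr_ge0 ?expR_ge0.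
rewrite -expRD -[leLHS]lnK ?posrE// ler_expR.
have h : n%:R * ln (f x) <= n%:R * C1 - norm1 (x - b) / R0.
  have : \sum_(i < n) ln (f x) <= \sum_(i < n) (C1 - `|x ord0 i - b ord0 i| / R0).
    by apply: ler_sum => i _; exact: coord.
  rewrite sumrB !sumr_const card_ord -(mulr_natl (ln _)) -(mulr_natl C1) -mulr_suml.
  by rewrite (_ : \sum_i _ = norm1 (x - b))//; apply: eq_bigr => i _; rewrite !mxE.
have h2 : norm1 x <= norm1 (x - b) + norm1 b.
  by rewrite -{1}(subrK b x) norm1D.
rewrite -(ler_pM2l n0); apply: (le_trans h).
have -> : n%:R * (C1 + a * norm1 b - a * norm1 x) = n%:R * C1 - (norm1 x - norm1 b) / R0.
  by rewrite /a; field; rewrite !gt_eqF.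
by rewrite lerD2l lerN2 ler_pM2r ?invr_gt0//; lra.
Qed.

End decay.
End log_concave_decay.

(** * Removing the regularization *)

Section envelope_integral.
Context {R : realType}.
Variable n : nat.
Local Notation V := 'rV[R]_n.
Local Notation lam := (lebesgue_rV R n).
Implicit Types (x y b k : V) (s t c r : R).

Lemma mul_le_sqr (a A w : R) : 1 <= A ->
  a * w - A * (w ^+ 2 / 2) <= a ^+ 2 - A * (w ^+ 2 / 2) / 2.
Proof.
move=> A1; have h1 := sqr_ge0 (a - w / 2); have h2 := sqr_ge0 w.
have h3 : w ^+ 2 <= A * w ^+ 2 by rewrite ler_peMl.
have e : (a - w / 2) ^+ 2 = a ^+ 2 - a * w + w ^+ 2 / 4 by field.
rewrite e in h1; move: h1 h2 h3; rewrite mulrA.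
move: (w ^+ 2) (a ^+ 2) (a * w) => p q u; move: (A * p) => v.
lra.
Qed.

(** Half of the quadratic term pays for the linear one; the other half is kept to make the error
    from distant points small. *)
Lemma norm1_le_halfsq (a A : R) x : 1 <= A ->
  a * norm1 x - A * halfsq x <= n%:R * a ^+ 2 - A * halfsq x / 2.
Proof.
move=> A1; rewrite halfsqE /norm1 !mulr_sumr mulr_suml -!sumrB.
have -> : n%:R * a ^+ 2 = \sum_(i < n) a ^+ 2 :> R.
  by rewrite sumr_const card_ord mulr_natl.
rewrite -sumrB; apply: ler_sum => i _.
by have := mul_le_sqr a `|x ord0 i| A1; rewrite real_normK ?num_real.
Qed.

Lemma integral_expR_norm1Z (a : R) : 0 < a -> exists2 J : R, 0 <= J &
  (\int[lam]_x (expR (- (a * norm1 x)))%:E = J%:E)%E.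
Proof.
move=> a0.
have m1 : measurable_fun setT (fun x : V => (expR (- norm1 x))%:E : \bar R).
  by case/integrableP: (@integrable_expR_norm1 R n).
have -> : (\int[lam]_x (expR (- (a * norm1 x)))%:E =
    \int[lam]_x (expR (- norm1 (a *: x + 0)))%:E)%E.
  apply: eq_integral => x _; congr (expR (- _))%:E.
  rewrite /norm1 mulr_sumr; apply: eq_bigr => i _.
  by rewrite !mxE addr0 normrM gtr0_norm.
rewrite (@ge0_integral_affine_rV R n a 0 (fun x => (expR (- norm1 x))%:E)) ?gt_eqF//.
have fin := integrable_fin_num measurableT (@integrable_expR_norm1 R n).
exists (`|a| ^- n * fine (\int[lam]_x (expR (- norm1 x))%:E)); last first.
  by rewrite EFinM fineK.
rewrite mulr_ge0 ?invr_ge0 ?exprn_ge0//.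
by apply: fine_ge0; apply: integral_ge0 => x _; rewrite lee_fin expR_ge0.
Qed.

Variable f : V -> R.
Hypothesis lcf : log_concave f.
Hypothesis intf : lebesgue_integrable f.
Hypothesis f_gt0 : 0 < \int[lam]_x f x.
Local Notation I := (\int[lam]_x f x).

Variables (c r S C a : R) (b : V).
Hypotheses (c0 : 0 < c) (r0 : 0 < r) (S0 : 0 < S) (C0 : 0 < C) (a0 : 0 < a).
Hypothesis cubef : forall x, cube b r x -> c <= f x.
Hypothesis fS : forall x, f x <= S.
Hypothesis fC : forall x, f x <= C * expR (- (a * norm1 x)).

(** No continuity of f at the boundary of its support is available, so f k is compared with f at a
    point moved towards b. That point is a convex combination of k and a point z of the cube, with
    weight d on z, and costs a factor at most (S / c)^d. *)
Lemma log_concave_near d x k : 0 < d < 1 -> 0 < f k ->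
  (forall i, `|x ord0 i - k ord0 i| <= d * r) ->
  f k <= expR (d * ln (S / c)) * f ((1 - d) *: x + d *: b).
Proof.
move=> /andP[d0 d1] fk H; pose z := b + ((1 - d) / d) *: (x - k).
have cz : c <= f z.
  apply: cubef => i; have := H i; rewrite !mxE.
  move: (x ord0 i - _) => w; rewrite ler_norml => /andP[w1 w2].
  have e : w = d * (w / d) by field; rewrite gt_eqF.
  have w1' : - r <= w / d by rewrite -(ler_pM2l d0) -e; lra.
  have w2' : w / d <= r by rewrite -(ler_pM2l d0) -e.
  have -> : (1 - d) / d * w = (1 - d) * (w / d) by ring.
  by apply/andP; split; move: (w / d) w1' w2' => v; nra.
have fz : 0 < f z by exact: lt_le_trans cz.
have -> : (1 - d) *: x + d *: b = (1 - d) *: k + (1 - (1 - d)) *: z.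
  by apply/rowP => i; rewrite !mxE; field; rewrite gt_eqF.
have d01 : 0 <= 1 - d <= 1 by apply/andP; split; lra.
have [fw h] := log_concave_ln lcf fk fz d01.
rewrite -[leLHS]lnK ?posrE// -[X in _ * X]lnK ?posrE// -expRD ler_expR.
rewrite ln_div ?posrE//.
have lc : ln c <= ln (f z) by rewrite ler_ln ?posrE.
have lS : ln (f k) <= ln S by rewrite ler_ln ?posrE.
have := ler_wpM2l (ltW d0) lc; have := ler_wpM2l (ltW d0) lS.
move: h; move: (ln (f k)) (ln (f z)) (ln (f _)) (ln c) (ln S) => p1 p2 p3 p4 p5.
lra.
Qed.

(** The contribution of points k farther than d r from x in some coordinate: e^(-A (d r)^2 / 4)
    comes from half of the quadratic term, and the other half trades the decay at k for the decay at
    x. *)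
Definition envelope_error (A d : R) : R :=
  C * expR (n%:R * a ^+ 2) * expR (- (A * ((d * r) ^+ 2 / 4))).

Lemma envelope_pointwise A d x k : 1 <= A -> 0 < d < 1 -> 0 < f k ->
  f k * expR (- (A * halfsq (x - k))) <=
  expR (d * ln (S / c)) * f ((1 - d) *: x + d *: b) +
  envelope_error A d * expR (- (a * norm1 x)).
Proof.
move=> A1 d01 fk; have A0 : 0 < A by exact: lt_le_trans A1.
have err0 : 0 <= envelope_error A d * expR (- (a * norm1 x)).
  by rewrite /envelope_error !mulr_ge0 ?expR_ge0// ltW.
have [H|] := pselect (forall i, `|x ord0 i - k ord0 i| <= d * r).
  apply: (@le_trans _ _ (f k)).
    by rewrite ler_piMr ?(ltW fk)// -expR0 ler_expR oppr_le0 mulr_ge0 ?halfsq_ge0// ltW.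
  by apply: le_trans (log_concave_near d01 fk H) _; rewrite lerDl.
move=> /existsNP[i /negP]; rewrite -ltNge => xi.
apply: (@le_trans _ _ (envelope_error A d * expR (- (a * norm1 x)))); last first.
  by rewrite lerDr mulr_ge0 ?expR_ge0// log_concave_ge0.
apply: (@le_trans _ _ (C * expR (- (a * norm1 k)) * expR (- (A * halfsq (x - k))))).
  by rewrite ler_wpM2r ?expR_ge0.
rewrite /envelope_error -!mulrA ler_wpM2l ?(ltW C0)// -!expRD ler_expR.
have h1 := norm1_le_halfsq a (x - k) A1.
have h2 : a * norm1 x <= a * norm1 (x - k) + a * norm1 k.
  by rewrite -mulrDr ler_wpM2l ?(ltW a0)// -[X in norm1 X](subrK k) norm1D.
have h3 : A * ((d * r) ^+ 2 / 4) <= A * halfsq (x - k) / 2.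
  rewrite -mulrA ler_wpM2l ?(ltW A0)//.
  have : (d * r) ^+ 2 / 2 <= halfsq (x - k).
    rewrite halfsqE (bigD1 i)//=; apply: (@le_trans _ _ ((x - k) ord0 i ^+ 2 / 2)).
      rewrite !mxE ler_wpM2r// -[leRHS]real_normK ?num_real// ler_sqr ?nnegrE//.
        exact: ltW.
      by case/andP: d01 => d0 _; rewrite mulr_ge0// ltW.
    by rewrite lerDl sumr_ge0// => j _; rewrite divr_ge0// sqr_ge0.
  move: (halfsq _) ((d * r) ^+ 2) => p q; lra.
move: h1 h2 h3; move: (norm1 x) (norm1 k) (norm1 (x - k)) (halfsq _) => p1 p2 p3 p4.
lra.
Qed.

Lemma integral_log_concave_affine d : 0 < d < 1 ->
  exists2 g : V -> R, measurable_fun setT g /\ (forall x, 0 <= g x) &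
  {ae lam, forall x, f ((1 - d) *: x + d *: b) = g x} /\
  (\int[lam]_x (g x)%:E = (((1 - d) ^+ n)^-1 * I)%:E)%E.
Proof.
move=> /andP[d0 d1]; have [g ig fg] := intf.
have d1' : 0 < 1 - d by lra.
have mg : measurable_fun setT g by apply/measurable_EFinP; case/integrableP: ig.
pose g1 x := Num.max (g x) 0.
have mg1 : measurable_fun setT g1 by apply: measurable_maxr.
have g10 x : 0 <= g1 x by rewrite le_max lexx orbT.
have fg1 : {ae lam, forall x, f x = g1 x}.
  apply: filterS fg => x fgx; rewrite /g1 -fgx; apply/esym/max_idPl.
  exact: log_concave_ge0.
exists (fun x => g1 ((1 - d) *: x + d *: b)); split.
- exact: (measurableT_comp mg1 (measurable_affine_rV (1 - d) (d *: b))).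
- by [].
- by apply: (negligible_affine_rV (d *: b) _ fg1); rewrite gt_eqF.
have mg1' : measurable_fun setT (fun x : V => (g1 x)%:E : \bar R).
  by apply/measurable_EFinP.
rewrite (@ge0_integral_affine_rV R n (1 - d) (d *: b) (fun x => (g1 x)%:E)) ?gt_eqF//.
rewrite gtr0_norm// EFinM -log_concave_EFin//; congr (_ * _)%E.
by apply/esym/nonmeasurable_ae_eq_integral; apply: filterS fg1 => x ->.
Qed.

(** h stands for e^(-envelope) on a truncated support and enters only through the bounds it
    satisfies. This makes A independent of the truncation, which tends to infinity first. *)
Lemma envelope_integral_le (e : R) : 0 < e -> exists2 A, 1 <= A &
  forall h : V -> R, measurable_fun setT h -> (forall x, 0 <= h x) ->
    (forall x B, 0 < B ->
       (forall k, 0 < f k -> f k * expR (- (A * halfsq (x - k))) <= B) -> h x <= B) ->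
    (\int[lam]_x (h x)%:E <= (I + e)%:E)%E.
Proof.
move=> e0; have [J J0 JE] := integral_expR_norm1Z a0.
pose s := ln (S / c).
have s0 : 0 <= s.
  have cS : c <= S.
    by apply: le_trans (fS b); apply: cubef => k; rewrite gerBl lerDl ltW.
  by rewrite ln_ge0// ler_pdivlMr// mul1r.
(* Chosen so that e^(t (s + n)) <= 1 + e / (2 I), where s and n account for the factor (S / c)^d and
   the Jacobian of the contraction. *)
pose t := ln (1 + e / 2 / I) / (s + n%:R + 1).
have sn : 0 < s + n%:R + 1 by rewrite ltr_wpDl// addr_ge0.
have t0 : 0 < t.
  by rewrite divr_gt0// ln_gt0// ltrDl !divr_gt0.
have et1 : 0 < expR (- t) < 1 by rewrite expR_gt0 expR_lt1 oppr_lt0.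
(* The Jacobian (1 - d)^(-n) is then exactly e^(t n), and d <= t. *)
pose d := 1 - expR (- t).
have d01 : 0 < d < 1 by rewrite /d; case/andP: et1 => h1 h2; apply/andP; split; lra.
have dt : d <= t by rewrite /d; have := expR_ge1Dx (- t); move: (expR _) => p; lra.
pose q := (d * r) ^+ 2 / 4.
have q0 : 0 < q.
  by case/andP: d01 => d0 _; rewrite divr_gt0// exprn_gt0// mulr_gt0.
pose D := C * expR (n%:R * a ^+ 2).
have D0 : 0 < D by rewrite mulr_gt0// expR_gt0.
(* From e^(A q) >= 1 + A q, the integrated error D J e^(-A q) is at most e / 2. *)
pose A := 1 + D * J / (e / 2) / q.
have A1 : 1 <= A.
  have e20 : 0 <= e / 2 by rewrite divr_ge0// ltW.
  by rewrite lerDl; apply: divr_ge0 (ltW q0); apply: divr_ge0 e20; rewrite mulr_ge0// ltW.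
have A0 : 0 < A by exact: lt_le_trans A1.
have errJ : envelope_error A d * J <= e / 2.
  rewrite /envelope_error -/D -/q mulrAC.
  have e20 : 0 < e / 2 by rewrite divr_gt0.
  rewrite expRN -ler_pdivlMr ?invr_gt0 ?expR_gt0// invrK -ler_pdivrMl// [leLHS]mulrC.
  apply: le_trans (expR_ge1Dx _); rewrite /A mulrDl divfK ?gt_eqF// mul1r.
  by rewrite addrA lerDr addr_ge0// ltW.
have main : expR (d * s) * (((1 - d) ^+ n)^-1 * I) <= I + e / 2.
  have -> : 1 - d = expR (- t) by rewrite /d; ring.
  rewrite -expRM_natr -expRN mulrA -expRD.
  have h : d * s + - (- t * n%:R) <= ln (1 + e / 2 / I).
    apply: (@le_trans _ _ (t * (s + n%:R + 1))); last by rewrite divfK ?gt_eqF.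
    have := ler_wpM2r s0 dt; move: t0; move: (n%:R) => m; nra.
  apply: (@le_trans _ _ ((1 + e / 2 / I) * I)); last first.
    by rewrite mulrDl mul1r divfK ?gt_eqF.
  rewrite ler_wpM2r ?(ltW f_gt0)//.
  by rewrite -[leRHS]lnK ?ler_expR// posrE addr_gt0// !divr_gt0.
exists A => // h mh h0 H.
have [g [mg g0] [fg gE]] := integral_log_concave_affine d01.
have err0 : 0 < envelope_error A d by rewrite /envelope_error mulr_gt0 ?expR_gt0.
pose G x := (expR (d * s) * g x)%:E + (envelope_error A d * expR (- (a * norm1 x)))%:E : \bar R.
apply: (@le_trans _ _ (\int[lam]_x ((expR (d * s) * g x)%:E +
    (envelope_error A d * expR (- (a * norm1 x)))%:E))%E).
  apply: ge0_nonmeasurable_ae_le_integral.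
  - by move=> x; rewrite lee_fin.
  - by move=> x; rewrite adde_ge0// lee_fin mulr_ge0 ?expR_ge0// ltW.
  apply: filterS fg => x fgx; rewrite -EFinD lee_fin; apply: H.
    by rewrite ltr_wpDl// ?mulr_ge0 ?expR_ge0// mulr_gt0// expR_gt0.
  by move=> k fk; rewrite -fgx; exact: envelope_pointwise.
have mE : measurable_fun setT (fun x : V => (expR (- (a * norm1 x)))%:E : \bar R).
  apply/measurable_EFinP; apply: measurableT_comp => //; apply: measurableT_comp => //.
  by apply: measurable_funM => //; exact: measurable_norm1.
have mg' : measurable_fun setT (fun x : V => (g x)%:E : \bar R) by apply/measurable_EFinP.
rewrite (ge0_integralD lam measurableT); first last.
- under eq_fun do rewrite EFinM.
  by apply: emeasurable_funM.
- by move=> x _; rewrite lee_fin mulr_ge0 ?expR_ge0// ltW.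
- under eq_fun do rewrite EFinM.
  by apply: emeasurable_funM.
- by move=> x _; rewrite lee_fin mulr_ge0 ?expR_ge0.
under eq_integral do rewrite EFinM.
rewrite (ge0_integralZl_EFin lam measurableT _ mg' (expR_ge0 _)); last first.
  by move=> x _; rewrite lee_fin.
under [X in (_ + X)%E]eq_integral do rewrite EFinM.
rewrite (ge0_integralZl_EFin lam measurableT _ mE (ltW err0)); last first.
  by move=> x _; rewrite lee_fin expR_ge0.
rewrite gE JE -!EFinM -EFinD lee_fin.
move: main errJ; move: (I) (expR _ * _) (_ * J) => p1 p2 p3; lra.
Qed.

End envelope_integral.

(** * The lower bound for log-concave functions *)

Section mahler_limit.
Context {R : realType}.
Variable n : nat.
Local Notation V := 'rV[R]_n.
Local Notation lam := (lebesgue_rV R n).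
Implicit Types (x y b k : V).

Lemma polar_ge (f : V -> R) y (B : R) :
  (forall x, 0 <= f x) ->
  (forall x, 0 < f x -> B <= expR (- dotmul_rV x y) / f x) -> (B%:E <= polar f y)%E.
Proof.
move=> f0 H; apply: le_ereal_inf_tmp => _ [x _ <-].
have /orP[/eqP <-|fx] : (0 == f x) || (0 < f x) by rewrite -le_eqVlt.
  by rewrite inve0 gt0_muley ?leey// lte_fin expR_gt0.
by rewrite inver gt_eqF// -EFinM lee_fin H.
Qed.

Lemma polar_ge0 (f : V -> R) y : (forall x, 0 <= f x) -> (0 <= polar f y)%E.
Proof. by move=> f0; apply: polar_ge => // x fx; rewrite divr_ge0 ?expR_ge0// ltW. Qed.

Lemma polar_le (f : V -> R) x y : 0 < f x ->
  (polar f y <= (expR (- dotmul_rV x y) / f x)%:E)%E.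
Proof.
move=> fx; apply: ereal_inf_lbound; exists x => //.
by rewrite inver gt_eqF// -EFinM.
Qed.

Hypothesis n1 : (1 <= n)%N.
Hypothesis slicing : strong_slicing (R := R) n.
Variable f : V -> R.
Hypothesis lcf : log_concave f.
Hypothesis intf : lebesgue_integrable f.
Hypothesis f_gt0 : 0 < \int[lam]_x f x.
Local Notation I := (\int[lam]_x f x).

Definition truncated_support (j : nat) : set V :=
  [set x | 0 < f x /\ forall i, `|x ord0 i| <= j%:R].

Definition potential x : R := - ln (f x).

Section truncation.
Variables (S : R) (b : V) (N : nat) (A : R).
Hypothesis S0 : 0 < S.
Hypothesis fS : forall x, f x <= S.
Hypothesis fb : 0 < f b.
Hypothesis bN : forall i, `|b ord0 i| <= N%:R.
Hypothesis A0 : 0 < A.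
Local Notation K j := (truncated_support (N + j)).
Local Notation al j := (envelope (K j) potential A).
Local Notation be j := (envelope_conj (K j) potential A).

Lemma support_base j : K j b.
Proof. by split=> // i; rewrite (le_trans (bN i))// ler_nat leq_addr. Qed.

Lemma support_bound j k i : K j k -> `|k ord0 i| <= (N + j)%:R.
Proof. by case. Qed.

Lemma potential_ge j k : K j k -> - ln S <= potential k.
Proof. by move=> [fk _]; rewrite lerN2 ler_ln ?posrE. Qed.

Lemma support_convex j x y s : K j x -> K j y -> 0 <= s <= 1 -> K j (s *: x + (1 - s) *: y).
Proof.
move=> [fx Kx] [fy Ky] s01; split; first by have [] := log_concave_ln lcf fx fy s01.
move=> i; rewrite !mxE; case/andP: s01 => s0 s1; have s1' : 0 <= 1 - s by lra.
apply: (le_trans (ler_normD _ _)); rewrite !normrM (ger0_norm s0) (ger0_norm s1').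
have := ler_wpM2l s0 (Kx i); have := ler_wpM2l s1' (Ky i).
move: ((N + j)%:R : R) (`|x ord0 i|) (`|y ord0 i|) => M p1 p2; lra.
Qed.

Lemma convex_potential j x y s : K j x -> K j y -> 0 <= s <= 1 ->
  potential (s *: x + (1 - s) *: y) <= s * potential x + (1 - s) * potential y.
Proof.
move=> [fx _] [fy _] s01; have [_] := log_concave_ln lcf fx fy s01.
rewrite /potential; move: (ln _) (ln _) (ln _) => p1 p2 p3; lra.
Qed.

Lemma mahler_truncated j : expR 1 ^+ n <=
  partition_function (al j) * partition_function (be j).
Proof.
have h := mahler_envelope n1 slicing (ler0n _ (N + j)) (support_base j) (@support_bound j)
  (@potential_ge j) A0 (@support_convex j) (@convex_potential j).
have Za : 0 < partition_function (al j).
  apply: partition_gt0.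
    exact: (measurable_envelope (support_base j) (@support_bound j) (@potential_ge j) A0).
  exact: (superlinear_envelope (support_base j) (@support_bound j) (@potential_ge j) A0).
have Zb : 0 < partition_function (be j).
  apply: partition_gt0.
    exact: (measurable_envelope_conj (support_base j) (@support_bound j) A (@potential_ge j)).
  exact: (superlinear_envelope_conj (support_base j) (@support_bound j) (@potential_ge j) A0).
rewrite -expRM_natr mul1r -[leRHS]lnK ?posrE ?mulr_gt0// ler_expR.
by rewrite lnM ?posrE.
Qed.

Lemma envelope_conj_monotone i j y : (i <= j)%N -> be i y <= be j y.
Proof.
move=> ij; rewrite lerD2r.
apply: (conj_on_le (support_base i) (@support_bound i) (@potential_ge i)) => k Kk.
apply: (conj_on_ge (support_base j) (@support_bound j) (@potential_ge j)).
case: Kk => fk Kk; split=> // l; apply: le_trans (Kk l) _.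
by rewrite ler_nat leq_add2l.
Qed.

(** The weights e^(-be j) decrease in j and are dominated by the one for j = 0. Their limit h is a
    Borel minorant of [polar f]: any x with f x > 0 eventually enters the truncations, and the
    quadratic term only decreases h. *)
Lemma truncated_conj_polar :
  exists2 h : V -> R, measurable_fun setT h /\ (forall y, 0 <= h y) &
  (forall y, ((h y)%:E <= polar f y)%E) /\
  (partition_function (be j))%:E @[j --> \oo] --> (\int[lam]_y (h y)%:E)%E.
Proof.
pose F j y := expR (- be j y).
have mbe j := measurable_envelope_conj (support_base j) (@support_bound j) A (@potential_ge j).
have sbe j := superlinear_envelope_conj (support_base j) (@support_bound j) (@potential_ge j) A0.
have mF j : measurable_fun setT (F j).
  apply: measurableT_comp => //; apply: measurableT_comp => //; exact: mbe.
have Fmono y : nonincreasing_seq (F ^~ y).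
  by move=> i j ij; rewrite ler_expR lerN2; exact: envelope_conj_monotone.
have Fcvg y : cvgn (F ^~ y).
  apply: nonincreasing_is_cvgn => //; exists 0 => _ [j _ <-]; exact: expR_ge0.
pose h y := limn (F ^~ y).
have mh : measurable_fun setT h.
  apply: (@measurable_fun_cvg _ _ _ _ F) => // y _; exact: Fcvg.
have h0 y : 0 <= h y.
  by apply: limr_ge => //; apply: nearW => j; exact: expR_ge0.
exists h; split => //.
  move=> y; apply: polar_ge; first exact: log_concave_ge0.
  move=> x fx.
  have [j xj] : exists j : nat, norm1 x <= j%:R.
    by exists (Num.truncn (norm1 x)).+1; rewrite ltW// truncnS_gt.
  have Kx : K j x.
    split=> // i; apply: (@le_trans _ _ (norm1 x)).
      by rewrite /norm1 (bigD1 i)//= lerDl sumr_ge0.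
    by rewrite (le_trans xj)// ler_nat leq_addl.
  apply: (le_trans (nonincreasing_cvgn_ge (Fmono y) (Fcvg y) j)).
  rewrite -[X in _ / X]lnK ?posrE// -expRN -expRD ler_expR.
  have := conj_on_ge (support_base j) (@support_bound j) (@potential_ge j) y Kx.
  have : 0 <= halfsq y / A by rewrite divr_ge0 ?halfsq_ge0// ltW.
  rewrite /envelope_conj /potential.
  move: (conj_on _ _ y) (halfsq y / A) (dotmul_rV x y) (ln (f x)) => p1 p2 p3 p4; lra.
have ZE j : (partition_function (be j))%:E = (\int[lam]_y (F j y)%:E)%E.
  rewrite /partition_function /Rintegral fineK//.
  exact: (integrable_fin_num measurableT (integrable_expRN (mbe j) (sbe j))).
rewrite (_ : (fun j => (partition_function (be j))%:E) =
    fun j => (\int[lam]_y (EFin \o F j) y)%E); last by apply/funext => j; rewrite ZE.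
have [//|||||_ _ //] := @dominated_convergence _ V R lam setT measurableT
  (fun j => EFin \o F j) (EFin \o h) (EFin \o F 0).
- by move=> j; apply/measurable_EFinP.
- exact/measurable_EFinP.
- by apply: aeW => y _; apply: cvg_EFin; [exact: nearW|exact: Fcvg].
- exact: (integrable_expRN (mbe 0) (sbe 0)).
apply: aeW => y j _; rewrite /= lee_fin ger0_norm ?expR_ge0//; exact: Fmono.
Qed.

End truncation.

(** For fixed e, the envelope side is at most I + e uniformly in the truncation, so j tends to
    infinity on the conjugate side alone. Then e tends to 0. *)
Lemma mahler_log_concave : ((expR 1 ^+ n)%:E <= mahler_product f)%E.
Proof.
have [c [b [r [c0 r0 cubef]]]] := superlevel_contains_cube lcf intf f_gt0.
have [S S0 fS] := log_concave_bounded lcf intf f_gt0 c0 r0 cubef.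
have [C [a [C0 a0 fC]]] := log_concave_decay lcf intf f_gt0 c0 r0 cubef n1.
have fb : 0 < f b.
  by apply: (lt_le_trans c0); apply: cubef => k; rewrite gerBl lerDl ltW.
have C1 : 0 < C + 1 by rewrite ltr_wpDl.
have fC1 x : f x <= (C + 1) * expR (- (a * norm1 x)).
  by apply: (le_trans (fC x)); rewrite ler_wpM2r ?expR_ge0// lerDl.
have [N bN] : exists N : nat, forall i, `|b ord0 i| <= N%:R.
  exists (Num.truncn (norm1 b)).+1 => i; apply: (@le_trans _ _ (norm1 b)).
    by rewrite /norm1 (bigD1 i)//= lerDl sumr_ge0.
  by rewrite ltW// truncnS_gt.
rewrite /mahler_product log_concave_EFin//.
set P := (\int[lam]_y polar f y)%E.
have P0 : (0 <= P)%E.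
  by apply: integral_ge0 => y _; apply: polar_ge0; exact: log_concave_ge0.
have main e : 0 < e -> ((expR 1 ^+ n)%:E <= (I + e)%:E * P)%E.
  move=> e0.
  have [A A1 H] := envelope_integral_le lcf intf f_gt0 c0 r0 S0 C1 a0 cubef fS fC1 e0.
  have A0 : 0 < A by exact: lt_le_trans A1.
  have Ie : 0 < I + e by rewrite addr_gt0.
  have [h [mh h0] [hP hcvg]] := truncated_conj_polar S0 fS fb bN A0.
  apply: (@le_trans _ _ ((I + e)%:E * \int[lam]_y (h y)%:E)%E); last first.
    apply: lee_pmul => //; first by rewrite lee_fin ltW.
      by apply: integral_ge0 => y _; rewrite lee_fin.
    apply: ge0_nonmeasurable_ae_le_integral; last exact: aeW.
      by move=> y; rewrite lee_fin.
    by move=> y; apply: polar_ge0; exact: log_concave_ge0.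
  rewrite muleC -lee_pdivrMr//.
  have <- := cvg_lim _ hcvg => //.
  apply: lime_ge; first by apply/cvg_ex; eexists; exact: hcvg.
  apply: nearW => j; rewrite lee_fin ler_pdivrMr//.
  have := mahler_truncated S0 fS fb bN A0 j => /le_trans; apply.
  rewrite mulrC; apply: ler_wpM2l.
    by apply: fine_ge0; apply: integral_ge0 => x _; rewrite lee_fin expR_ge0.
  have Kb := support_base fb bN j; have pge := @potential_ge S N S0 fS j.
  pose Kr := @support_bound N j.
  have mal := measurable_envelope Kb Kr pge A0.
  have sal := superlinear_envelope Kb Kr pge A0.
  rewrite -lee_fin /partition_function /Rintegral fineK; last first.
    exact: (integrable_fin_num measurableT (integrable_expRN mal sal)).
  apply: H => [|x|x B B0 HB]; last 2 first.
  - exact: expR_ge0.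
  (* If e^(-envelope) exceeded B, a near-minimizer k of the envelope would violate the assumed bound
     at k. *)
  - rewrite leNgt; apply/negP => BH.
    have e1 : 0 < - ln B - envelope (truncated_support (N + j)) potential A x.
      by rewrite subr_gt0 ltrNr -[X in _ < X]expRK ltr_ln ?posrE ?expR_gt0.
    have [k [fk Kk]] := envelope_approx Kb Kr pge A0 x e1.
    apply/negP; rewrite -leNgt addrC subrK /potential.
    have := HB k fk; rewrite -{1}[f k]lnK ?posrE// -expRD.
    rewrite -[leRHS]lnK ?posrE// ler_expR.
    move: (A * _) (ln (f k)) (ln B) => p1 p2 p3; lra.
  apply: measurableT_comp => //; exact: measurableT_comp.
case: P P0 main => [p p0 main|_ _|//]; last first.
  by rewrite gt0_muley ?lte_fin// leey.
rewrite -EFinM lee_fin; apply/ler_addgt0Pl => e e0.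
have p1 : 0 < p + 1 by rewrite ltr_wpDl.
(* The error e is multiplied by the integral p of the polar; p + 1 also covers p = 0. *)
have /main : 0 < e / (p + 1) by rewrite divr_gt0.
rewrite -EFinM lee_fin mulrDl => /le_trans; apply.
rewrite [leRHS]addrC lerD2l mulrAC ler_pdivrMr// ler_pM2l// lerDl//.
Qed.

End mahler_limit.

Section translation.
Context {R : realType}.
Variable n : nat.
Local Notation V := 'rV[R]_n.
Local Notation lam := (lebesgue_rV R n).
Implicit Types (f : V -> R) (z : V).

Lemma translateE f z : translate f z = fun x => f (1 *: x + - z).
Proof. by apply/funext => x; rewrite /translate scale1r. Qed.

Lemma log_concave_translate f z : log_concave f -> log_concave (translate f z).
Proof.
case=> phi [phiNy cphi fE]; exists (fun x => phi (x - z)); split.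
- by move=> x; exact: phiNy.
- move=> x y t t01; rewrite (_ : _ - z = t *: (x - z) + (1 - t) *: (y - z)).
    exact: cphi.
  by apply/rowP => i; rewrite !mxE; ring.
by move=> x; rewrite /translate fE.
Qed.

Lemma ge0_integral_translate (F : V -> \bar R) z : measurable_fun setT F ->
  (forall x, (0 <= F x)%E) ->
  (\int[lam]_x F (1 *: x + - z)%R = \int[lam]_x F x)%E.
Proof.
move=> mF F0; rewrite (@ge0_integral_affine_rV R n 1 (- z) F)// ?oner_eq0//.
by rewrite normr1 expr1n invr1 mul1e.
Qed.

Lemma lebesgue_integrable_translate f z :
  lebesgue_integrable f -> lebesgue_integrable (translate f z).
Proof.
move=> [g /integrableP[mg ig] fg]; rewrite translateE.
have mg' : measurable_fun setT g by apply/measurable_EFinP.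
have ma := measurable_affine_rV (1 : R) (- z).
exists (fun x => g (1 *: x + - z)); last first.
  by apply: (negligible_affine_rV _ _ fg); exact: oner_neq0.
apply/integrableP; split.
  by apply/measurable_EFinP; exact: (measurableT_comp mg' ma).
rewrite (@ge0_integral_translate (fun x => `|(g x)%:E|%E) z)//.
exact: measurableT_comp.
Qed.

Lemma Rintegral_translate f z : (forall x, 0 <= f x) -> lebesgue_integrable f ->
  \int[lam]_x translate f z x = \int[lam]_x f x.
Proof.
move=> f0 [g /integrableP[mg ig] fg]; rewrite translateE /Rintegral.
have mg' : measurable_fun setT g by apply/measurable_EFinP.
pose g1 x := Num.max (g x) 0.
have mg1 : measurable_fun setT (fun x => (g1 x)%:E : \bar R).
  by apply/measurable_EFinP; exact: measurable_maxr.
have fg1 : {ae lam, forall x, f x = g1 x}.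
  by apply: filterS fg => x fgx; rewrite /g1 -fgx; apply/esym/max_idPl.
congr fine; transitivity (\int[lam]_x (g1 (1 *: x + - z)%R)%:E)%E.
  apply: nonmeasurable_ae_eq_integral.
  have := negligible_affine_rV (- z) (oner_neq0 R) fg1.
  by apply: filterS => x ->.
rewrite (@ge0_integral_translate (fun x => (g1 x)%:E) z)//; last first.
  by move=> x; rewrite lee_fin le_max lexx orbT.
by apply/esym/nonmeasurable_ae_eq_integral; apply: filterS fg1 => x ->.
Qed.

Lemma mahler_inf_ge f : (1 <= n)%N -> strong_slicing (R := R) n ->
  log_concave f -> lebesgue_integrable f -> 0 < \int[lam]_x f x ->
  ((expR 1 ^+ n)%:E <= mahler_inf f)%E.
Proof.
move=> n1 slicing lcf intf f_gt0; apply: le_ereal_inf_tmp => _ [z _ <-].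
apply: mahler_log_concave => //.
- exact: log_concave_translate.
- exact: lebesgue_integrable_translate.
by rewrite Rintegral_translate//; exact: log_concave_ge0.
Qed.

End translation.

(** * The extremal function *)

Section shifted_exponential.
Context {R : realType}.
Local Notation leb := (@lebesgue_measure R).
Implicit Types (x a b c : R).

Lemma is_derive_quadratic_expRN a b c x :
  is_derive x 1 (fun x : R => - ((a * x ^+ 2 + b * x + c) * expR (- x)))
    ((a * x ^+ 2 + b * x + c - (2 * a * x + b)) * expR (- x)).
Proof.
have d1 : is_derive x 1 (fun x : R => expR (- x)) (- expR (- x)).
  have := @is_derive1_comp R (@expR R) (@GRing.opp R) x (expR (- x)) (-1).
  by rewrite mulrN1; apply.
have d2 : is_derive x 1 (fun x : R => a * x ^+ 2 + b * x + c) (2 * a * x + b).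
  apply: is_derive_eq.
  rewrite /GRing.scale /=; ring.
apply: is_derive_eq; rewrite /GRing.scale /=; ring.
Qed.

Lemma quadratic_expRN_cvg0 a b c :
  - ((a * x ^+ 2 + b * x + c) * expR (- x)) @[x --> +oo] --> (0 : R).
Proof.
apply/cvgr0Pnorm_le => e e0.
(* The weights 8, 2 and 1 come from bounding x^2, x and 1 by multiples of e^(x / 2). *)
pose M := 8 * `|a| + 2 * `|b| + `|c| + 1.
have M0 : 0 < M.
  rewrite /M; have := normr_ge0 a; have := normr_ge0 b; have := normr_ge0 c; lra.
near=> x.
have x0 : 0 <= x by near: x; apply: nbhs_pinfty_ge; rewrite num_real.
have xM : 2 * ln (M / e) <= x by near: x; apply: nbhs_pinfty_ge; rewrite num_real.
have q : `|a * x ^+ 2 + b * x + c| <= M * expR (x / 2).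
  have h1 := sqr_le_expR_half x; have h2 := normr_le_expR_half x.
  rewrite (ger0_norm x0) in h1 h2.
  have h3 : 1 <= expR (x / 2) by rewrite -expR0 ler_expR divr_ge0.
  have := ler_wpM2l (normr_ge0 a) h1; have := ler_wpM2l (normr_ge0 b) h2.
  have := ler_wpM2l (normr_ge0 c) h3.
  have := ler_normD (a * x ^+ 2 + b * x) c; have := ler_normD (a * x ^+ 2) (b * x).
  rewrite (normrM a) (normrM b) (ger0_norm x0) (ger0_norm (sqr_ge0 x)) /M.
  move: (`|_ + c|) (`|_ + b * x|) (`|a|) (`|b|) (`|c|) h3 => p1 p2 p3 p4 p5.
  move: (expR _) => E; move: (x ^+ 2) => y; lra.
rewrite normrN normrM [X in _ * X]ger0_norm ?expR_ge0//.
apply: (@le_trans _ _ (M * expR (x / 2) * expR (- x))).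
  by rewrite ler_wpM2r ?expR_ge0.
rewrite -mulrA -expRD -ler_pdivlMl// -[leRHS]lnK ?posrE ?mulr_gt0 ?invr_gt0//.
rewrite ler_expR .
have -> : M^-1 * e = (M / e)^-1 by rewrite invf_div mulrC.
rewrite lnV ?posrE ?divr_gt0//; move: (ln _) xM => l; lra.
Unshelve. all: by end_near.
Qed.


Lemma continuous_quadratic_expRN a b c :
  continuous (fun x : R => - ((a * x ^+ 2 + b * x + c) * expR (- x))).
Proof.
move=> x; have [d _] := is_derive_quadratic_expRN a b c x.
exact/differentiable_continuous/derivable1_diffP.
Qed.

(** This is e times the density of a centred exponential variable of variance 1; [f0] is the product
    of n copies. *)
Definition shifted_exp x : R := expR (- x) * \1_[set x | -1 <= x] x.

Lemma measurable_shifted_exp : measurable_fun setT shifted_exp.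
Proof.
apply: measurable_funM; first by apply: measurableT_comp.
apply: measurable_indic; rewrite (_ : mkset _ = `[-1, +oo[%classic).
  exact: measurable_itv.
by apply/seteqP; split => x /=; rewrite in_itv/= andbT.
Qed.

Lemma shifted_exp_ge0 x : 0 <= shifted_exp x.
Proof. by rewrite mulr_ge0 ?expR_ge0. Qed.

(** With q the quadratic polynomial, -q e^(-x) is an antiderivative of (q - q') e^(-x) that vanishes
    at +oo; the boundary term at -1 is q(-1) e. *)
Lemma integral_quadratic_shifted_exp a b c :
  (forall x, -1 <= x -> 0 <= a * x ^+ 2 + b * x + c - (2 * a * x + b)) ->
  (\int[leb]_x ((a * x ^+ 2 + b * x + c - (2 * a * x + b)) * shifted_exp x)%:E =
   ((a - b + c) * expR 1)%:E)%E.
Proof.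
move=> H.
pose F x : R := - ((a * x ^+ 2 + b * x + c) * expR (- x)).
pose f x : R := (a * x ^+ 2 + b * x + c - (2 * a * x + b)) * expR (- x).
have cf : continuous f.
  rewrite (_ : f = fun x => - ((- a * x ^+ 2 + (2 * a - b) * x + (b - c)) * expR (- x))).
    exact: continuous_quadratic_expRN.
  by apply/funext => x; rewrite /f; ring.
have dF (x : R) : is_derive x 1 F (f x) by exact: is_derive_quadratic_expRN.
rewrite (_ : (fun x => _) = (EFin \o f) \_ `[-1, +oo[%classic); last first.
  apply/funext => x; rewrite patchE /shifted_exp indicE.
  have -> : (x \in [set x | -1 <= x]) = (x \in `[-1, +oo[%classic).
    by apply/idP/idP; rewrite !inE /= in_itv/= andbT.
  by case: ifP => _; rewrite ?mulr1 ?mulr0 // mulr0.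
rewrite -integral_mkcond.
rewrite [LHS](@ge0_continuous_FTC2y R f F (-1) 0).
- rewrite -EFinB /F; congr (_%:E); rewrite !opprK; ring.
- by move=> x /H h; rewrite mulr_ge0 ?expR_ge0.
- exact: continuous_subspaceT.
- exact: quadratic_expRN_cvg0.
- by move=> x _; have [] := dF x.
- by apply: cvg_at_right_filter; exact: continuous_quadratic_expRN.
by move=> x _; rewrite derive1E; exact: derive_val.
Qed.

(** The powers of x + 1 are nonnegative on the support, unlike those of x, so their integrals are
    computed first and then recombined. *)
Lemma integrable_shifted_exp_moment (k : nat) : (k <= 2)%N ->
  leb.-integrable setT (EFin \o (fun x => x ^+ k * shifted_exp x)) /\
  \int[leb]_x (x ^+ k * shifted_exp x) = if k == 1%N then 0 else expR 1.
Proof.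
have mw := measurable_shifted_exp.
pose p k x : R := (x + 1) ^+ k.
have int (v : R) (i : nat) (ie : (\int[leb]_x (p i x * shifted_exp x)%:E = v%:E)%E) :
    leb.-integrable setT (EFin \o (fun x => p i x * shifted_exp x)) /\
    \int[leb]_x (p i x * shifted_exp x) = v.
  split; last by rewrite /Rintegral ie.
  apply/integrableP; split.
    apply/measurable_EFinP; apply: measurable_funM => //.
    by apply: measurable_funX; exact: measurable_funD.
  suff E : (fun x => `|(p i x * shifted_exp x)%:E|%E) = fun x => (p i x * shifted_exp x)%:E.
    by rewrite [ltLHS](congr1 (fun F => integral leb setT F) E) ie ltry.
  apply/funext => x; congr (_%:E).
  rewrite /shifted_exp indicE; case: (boolP (x \in _)); last by rewrite !mulr0 normr0.
  rewrite inE mulr1 /= => x1; rewrite ger0_norm// mulr_ge0 ?expR_ge0// exprn_ge0//; lra.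
(* The triples (0, 0, 1), (0, 1, 2) and (1, 4, 5) solve q - q' = (x + 1)^k for k = 0, 1, 2. *)
have [|i0 e0] := int (expR 1) 0%N.
  have := @integral_quadratic_shifted_exp 0 0 1.
  rewrite (_ : (0 - 0 + 1) * expR 1 = expR 1); last by ring.
  move=> <- => [|x _]; last by lra.
  by apply: eq_integral => x _; congr (_%:E); rewrite /p; ring.
have [|i1 e1] := int (expR 1) 1%N.
  have := @integral_quadratic_shifted_exp 0 1 2.
  rewrite (_ : (0 - 1 + 2) * expR 1 = expR 1); last by ring.
  move=> <- => [|x x1]; last by lra.
  by apply: eq_integral => x _; congr (_%:E); rewrite /p; ring.
have [|i2 e2] := int (2 * expR 1) 2%N.
  have := @integral_quadratic_shifted_exp 1 4 5.
  rewrite (_ : (1 - 4 + 5) * expR 1 = 2 * expR 1); last by ring.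
  move=> <- => [|x x1]; last first.
    by rewrite (_ : _ - _ = (x + 1) ^+ 2) ?sqr_ge0//; ring.
  by apply: eq_integral => x _; congr (_%:E); rewrite /p; ring.
have comb (G H : R -> R) (v : R) : leb.-integrable setT (EFin \o G) ->
    leb.-integrable setT (EFin \o H) ->
    leb.-integrable setT (EFin \o (fun x => G x + v * H x)) /\
    \int[leb]_x (G x + v * H x) = \int[leb]_x G x + v * \int[leb]_x H x.
  move=> iG iH; have iaH : leb.-integrable setT (EFin \o (fun x => v * H x)).
    by apply: eq_integrable (integrableZl measurableT v iH).
  split; last by rewrite RintegralD// RintegralZl.
  by apply: eq_integrable (integrableD measurableT iG iaH).
case: k => [|[|[|//]]] _ /=.
- split.
    by apply: eq_integrable i0.
  by rewrite -e0; apply: eq_Rintegral.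
- have [j1 h1] := comb _ _ (-1) i1 i0.
  have E x : p 1%N x * shifted_exp x + -1 * (p 0%N x * shifted_exp x) = x ^+ 1 * shifted_exp x.
    by rewrite /p; ring.
  split; first by apply: eq_integrable j1 => // x _; rewrite /= E.
  transitivity (\int[leb]_x (p 1%N x * shifted_exp x + -1 * (p 0%N x * shifted_exp x))).
    by apply: eq_Rintegral => x _; rewrite E.
  by rewrite h1 e0 e1; ring.
have [j1 h1] := comb _ _ (-2) i2 i1.
have [j2 h2] := comb _ _ 1 j1 i0.
have E x : p 2%N x * shifted_exp x + -2 * (p 1%N x * shifted_exp x) +
    1 * (p 0%N x * shifted_exp x) = x ^+ 2 * shifted_exp x.
  by rewrite /p; ring.
split; first by apply: eq_integrable j2 => // x _; rewrite /= E.
rewrite e2 e1 in h1; rewrite h1 e0 in h2.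
have -> : expR 1 = 2 * expR 1 + -2 * expR 1 + 1 * expR 1 :> R by ring.
by rewrite -h2; apply: eq_Rintegral => x _; rewrite E.
Qed.

End shifted_exponential.

Section extremal_function.
Context {R : realType}.
Variable n : nat.
Local Notation V := 'rV[R]_n.
Local Notation lam := (lebesgue_rV R n).
Local Notation leb := (@lebesgue_measure R).
Local Notation f0 := (f0 : V -> R).
Implicit Types (x y z : V).

Lemma f0E x : f0 x = \prod_(i < n) shifted_exp (x ord0 i).
Proof.
rewrite /f0 -sumrN expR_sum big_split/=; congr (_ * _).
have [H|/existsNP[i Hi]] := pselect (forall i, -1 <= x ord0 i).
  rewrite indicE mem_set// big1// => i _.
  by rewrite indicE mem_set//; exact: H.
rewrite indicE memNset; last by move=> H; apply: Hi; exact: H.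
by rewrite (bigD1 i)//= indicE memNset// mul0r.
Qed.

Lemma f0_ge0 x : 0 <= f0 x.
Proof. by rewrite mulr_ge0 ?expR_ge0. Qed.

Lemma f0_supp x : (forall i, -1 <= x ord0 i) -> f0 x = expR (- \sum_i x ord0 i).
Proof. by move=> H; rewrite /f0 indicE mem_set ?mulr1. Qed.

Lemma f0_supp0 x i : x ord0 i < -1 -> f0 x = 0.
Proof.
move=> xi; rewrite /f0 indicE memNset ?mulr0// => /(_ i).
by rewrite leNgt xi.
Qed.

Lemma f0_moment (e : 'I_n -> nat) : (forall i, e i <= 2)%N ->
  lam.-integrable setT (EFin \o (fun x => (\prod_i x ord0 i ^+ e i) * f0 x)) /\
  \int[lam]_x ((\prod_i x ord0 i ^+ e i) * f0 x) =
  \prod_i (if e i == 1%N then 0 else expR 1).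
Proof.
move=> e2; pose g i (t : R) : R := t ^+ e i * shifted_exp t.
have ig i : leb.-integrable setT (EFin \o g i).
  exact: (proj1 (integrable_shifted_exp_moment (e2 i))).
have E x : \prod_i g i (x ord0 i) = (\prod_i x ord0 i ^+ e i) * f0 x.
  by rewrite f0E -big_split.
split.
  by apply: eq_integrable (integrable_prod_coord ig) => // x _; rewrite /= E.
transitivity (\int[lam]_x \prod_i g i (x ord0 i)).
  by apply: eq_Rintegral => x _; rewrite E.
rewrite integral_prod_coord//; apply: eq_bigr => i _.
exact: (proj2 (integrable_shifted_exp_moment (e2 i))).
Qed.

Lemma prod_expn_eq x (i : 'I_n) : \prod_k x ord0 k ^+ (k == i) = x ord0 i.
Proof.
rewrite (bigD1 i)//= eqxx expr1 big1 ?mulr1// => k /negPf ->.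
by rewrite expr0.
Qed.

Lemma integral_f0 : lam.-integrable setT (EFin \o f0) /\
  \int[lam]_x f0 x = expR 1 ^+ n.
Proof.
have [i1 i2] := @f0_moment (fun=> 0%N) (fun=> isT).
have E x : (\prod_i x ord0 i ^+ 0) * f0 x = f0 x.
  by rewrite big1 ?mul1r// => i _; rewrite expr0.
split; first by apply: eq_integrable i1 => // x _; rewrite /= E.
transitivity (\int[lam]_x ((\prod_i x ord0 i ^+ 0) * f0 x)).
  by apply: eq_Rintegral => x _; rewrite E.
by rewrite i2 prodr_const card_ord.
Qed.

Lemma integral_coord_f0 i :
  lam.-integrable setT (EFin \o (fun x => x ord0 i * f0 x)) /\
  \int[lam]_x (x ord0 i * f0 x) = 0.
Proof.
have [|i1 i2] := @f0_moment (fun k => (k == i) : nat); first by move=> k; case: eqP.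
split; first by apply: eq_integrable i1 => // x _; rewrite /= prod_expn_eq.
transitivity (\int[lam]_x ((\prod_k x ord0 k ^+ (k == i)) * f0 x)).
  by apply: eq_Rintegral => x _; rewrite prod_expn_eq.
by rewrite i2 (bigD1 i)//= eqxx mul0r.
Qed.

Lemma integral_coord2_f0 i j :
  \int[lam]_x (x ord0 i * x ord0 j * f0 x) = if i == j then expR 1 ^+ n else 0.
Proof.
have [|_ i2] := @f0_moment (fun k => (k == i) + (k == j))%N.
  by move=> k; case: eqP; case: eqP.
transitivity (\int[lam]_x ((\prod_k x ord0 k ^+ ((k == i) + (k == j))) * f0 x)).
  apply: eq_Rintegral => x _; congr (_ * _).
  under eq_bigr do rewrite exprD.
  by rewrite big_split/= !prod_expn_eq.
rewrite i2; have [<-|ij] := eqVneq i j.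
  rewrite (eq_bigr (fun=> expR 1)) ?prodr_const ?card_ord// => k _.
  by case: (k == i).
by rewrite (bigD1 i)//= eqxx (negPf ij) mul0r.
Qed.

Let Z0 : expR 1 ^+ n != 0 :> R.
Proof. by rewrite gt_eqF// exprn_gt0// expR_gt0. Qed.

Lemma cov_f0 : cov f0 = 1%:M.
Proof.
have [_ If0] := integral_f0.
have bar0 : bar f0 = 0.
  apply/rowP => i; rewrite !mxE; have [_ ->] := integral_coord_f0 i.
  by rewrite mul0r.
apply/matrixP => i j; rewrite /cov bar0 mulmx0 subr0 !mxE integral_coord2_f0 If0.
by case: eqP => _; rewrite ?divff// mul0r.
Qed.

(** On the support ln f0 is minus the sum of the coordinates, and each coordinate has integral 0
    against f0. *)
Lemma entropy_f0 : entropy f0 = 0.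
Proof.
have E x : f0 x * ln (f0 x) = - \sum_i (x ord0 i * f0 x).
  rewrite -mulr_suml; have [H|/existsNP[i /negP]] := pselect (forall i, -1 <= x ord0 i).
    by rewrite (f0_supp H) expRK mulrN mulrC.
  by rewrite -ltNge => /f0_supp0 ->; rewrite mul0r mulr0 oppr0.
have [i1 i2] : lam.-integrable setT (EFin \o (fun x => \sum_i (x ord0 i * f0 x))) /\
    \int[lam]_x (\sum_i (x ord0 i * f0 x)) = 0.
  elim: (index_enum _) => [|i r [i1 i2]].
    split.
      apply: eq_integrable (integrable0 lam setT) => // x _.
      by rewrite /= big_nil.
    transitivity (\int[lam]_x (0 : R)).
      by apply: eq_Rintegral => x _; rewrite big_nil.
    by rewrite /Rintegral integral0.
  have [j1 j2] := integral_coord_f0 i; split.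
    apply: eq_integrable (integrableD measurableT j1 i1) => // x _.
    by rewrite /= big_cons EFinD.
  transitivity (\int[lam]_x (x ord0 i * f0 x + \sum_(i <- r) (x ord0 i * f0 x))).
    by apply: eq_Rintegral => x _; rewrite big_cons.
  by rewrite RintegralD// j2 i2 addr0.
rewrite /entropy (_ : \int[lam]_x _ = 0) ?mul0r ?oppr0//.
transitivity (\int[lam]_x (-1 * \sum_i (x ord0 i * f0 x))).
  by apply: eq_Rintegral => x _; rewrite E mulN1r.
by rewrite RintegralZl// i2 mulr0.
Qed.

Lemma isotropic_constant_f0 : (1 <= n)%N -> isotropic_constant f0 = 1 / expR 1.
Proof.
move=> n1; have [_ If0] := integral_f0.
rewrite /isotropic_constant cov_f0 det1 powR1 mulr1 entropy_f0 oppr0 expR0 If0 !div1r.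
rewrite -expRM_natr mul1r -!expRN /powR gt_eqF ?expR_gt0// expRK.
by rewrite mulrN mulVf// pnatr_eq0 -lt0n.
Qed.

(** [f0] is its own polar up to a reflection and the factor e^(-n). Off the support of the reflected
    function the bound is 0. *)
Lemma polar_translate_f0_ge z y :
  ((expR (- dotmul_rV z y) * (expR 1 ^+ n)^-1 * f0 (- y))%:E
    <= polar (translate f0 z) y)%E.
Proof.
have [H|/existsNP[i /negP]] := pselect (forall i, -1 <= (- y) ord0 i); last first.
  rewrite -ltNge => /f0_supp0 ->; rewrite mulr0; apply: polar_ge0 => x.
  exact: f0_ge0.
apply: polar_ge => [x|x fx]; first exact: f0_ge0.
have Hx i : -1 <= (x - z) ord0 i.
  rewrite leNgt; apply/negP => /f0_supp0 h.
  by move: fx; rewrite /translate h ltxx.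
rewrite /translate (f0_supp Hx) (f0_supp H) -expRM_natr mul1r -!expRN -!expRD ler_expR.
rewrite opprK.
rewrite -subr_ge0.
(* The gap between the exponents factors coordinatewise, and both factors are nonnegative on the
   supports. *)
have -> : - dotmul_rV x y + \sum_i (x - z) ord0 i -
   (- dotmul_rV z y + - n%:R + - \sum_i (- y) ord0 i) =
   \sum_(i < n) ((x - z) ord0 i + 1) * (1 - y ord0 i).
  rewrite (_ : n%:R = \sum_(i < n) 1); last by rewrite sumr_const card_ord.
  rewrite /dotmul_rV !opprD !opprK -!sumrN -!big_split/= .
  by apply: eq_bigr => i _; rewrite !mxE; ring.
apply: sumr_ge0 => i _; have := H i; have := Hx i; rewrite !mxE => h1 h2.
by rewrite mulr_ge0//; lra.
Qed.

(** If y has no coordinate above 1, the corner (-1, ..., -1) gives equality in the exponents. If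
    some y_i > 1, letting x_i grow with the others at -1 drives the quotient to 0. *)
Lemma polar_f0_le y : (polar f0 y <= ((expR 1 ^+ n)^-1 * f0 (- y))%:E)%E.
Proof.
have [H|/existsNP[i /negP]] := pselect (forall i, -1 <= (- y) ord0 i).
  pose x : V := const_mx (-1).
  have Hx i : -1 <= x ord0 i by rewrite mxE.
  have fx : 0 < f0 x by rewrite f0_supp// expR_gt0.
  apply: (le_trans (polar_le y fx)); rewrite lee_fin (f0_supp Hx) (f0_supp H).
  rewrite -expRM_natr mul1r -!expRN -!expRD ler_expR le_eqVlt; apply/orP; left.
  apply/eqP; rewrite opprK.
  rewrite (_ : n%:R = \sum_(i < n) 1); last by rewrite sumr_const card_ord.
  rewrite /dotmul_rV -!sumrN -!big_split/=.
  by apply: eq_bigr => i _; rewrite !mxE; ring.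
rewrite -ltNge => /[dup] yi /f0_supp0 ->; rewrite mulr0.
rewrite mxE in yi.
apply/lee_addgt0Pr => e e0; rewrite add0e.
pose x (t : R) : V := \row_k (if k == i then t else -1).
pose c : R := \sum_(k < n | k != i) (y ord0 k - 1).
pose t : R := Num.max 0 ((c - ln e) / (y ord0 i - 1)).
have yi0 : 0 < y ord0 i - 1 by lra.
have Hx k : -1 <= x t ord0 k.
  rewrite mxE; case: eqP => // _; have : 0 <= t by rewrite le_max lexx.
  lra.
have fx : 0 < f0 (x t) by rewrite f0_supp// expR_gt0.
apply: (le_trans (polar_le y fx)); rewrite lee_fin (f0_supp Hx).
rewrite -expRN -expRD opprK -[leRHS]lnK ?posrE// ler_expR.
have -> : - dotmul_rV (x t) y + \sum_k x t ord0 k = c - t * (y ord0 i - 1).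
  rewrite /dotmul_rV -sumrN -big_split/= (bigD1 i)//= /c addrC; congr (_ + _).
    by apply: eq_bigr => k /negPf ki; rewrite !mxE ki; ring.
  by rewrite !mxE eqxx; ring.
have : (c - ln e) / (y ord0 i - 1) <= t by rewrite le_max lexx orbT.
by rewrite ler_pdivrMr//; move: (ln e) (t * _) => p q; lra.
Qed.

End extremal_function.

Section extremal_mahler.
Context {R : realType}.
Variable n : nat.
Local Notation V := 'rV[R]_n.
Local Notation lam := (lebesgue_rV R n).
Local Notation leb := (@lebesgue_measure R).
Local Notation f0 := (f0 : V -> R).
Implicit Types (x y z : V).

Lemma tilted_shifted_exp_ge (a : R) :
  ((expR 1)%:E <= \int[leb]_t (expR (a * t) * shifted_exp t)%:E)%E.
Proof.
have [i0 e0] := @integrable_shifted_exp_moment R 0 isT.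
have [i1 e1] := @integrable_shifted_exp_moment R 1 isT.
set J := (\int[leb]_t _)%E.
have J0 : (0 <= J)%E.
  by apply: integral_ge0 => t _; rewrite lee_fin mulr_ge0 ?expR_ge0 ?shifted_exp_ge0.
(* An infinite J is trivial; finiteness gives the integrability used in comparing e^(a t) with 1 + a
   t. *)
have [|Joo] := leP +oo%E J; first by rewrite leye_eq => /eqP ->; rewrite leey.
have mw : measurable_fun setT (fun t : R => expR (a * t) * shifted_exp t).
  apply: measurable_funM; last exact: measurable_shifted_exp.
  by apply: measurableT_comp => //; exact: measurable_funM.
have iJ : leb.-integrable setT (EFin \o (fun t => expR (a * t) * shifted_exp t)).
  apply/integrableP; split; first exact: (proj2 (measurable_EFinP _ _) mw).
  suff E : (fun t => `|(expR (a * t) * shifted_exp t)%:E|%E) =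
      fun t => (expR (a * t) * shifted_exp t)%:E.
    by rewrite [ltLHS](congr1 (fun F => integral leb setT F) E).
  apply/funext => t; congr (_%:E).
  by rewrite ger0_norm// mulr_ge0 ?expR_ge0 ?shifted_exp_ge0.
have iaH : leb.-integrable setT (EFin \o (fun t => a * (t ^+ 1 * shifted_exp t))).
  by apply: eq_integrable (integrableZl measurableT a i1).
have <- : (\int[leb]_t (t ^+ 0 * shifted_exp t + a * (t ^+ 1 * shifted_exp t))%:E =
    (expR 1)%:E)%E.
  rewrite -[LHS]fineK; last first.
    exact: (integrable_fin_num measurableT (integrableD measurableT i0 iaH)).
  congr (_%:E); transitivity (\int[leb]_t (t ^+ 0 * shifted_exp t) +
      a * \int[leb]_t (t ^+ 1 * shifted_exp t)).
    by rewrite -RintegralZl// -RintegralD.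
  by rewrite e0 e1 mulr0 addr0.
apply: le_integral => //; first exact: (integrableD measurableT i0 iaH).
move=> t _; rewrite lee_fin expr0 expr1 mul1r mulrA -{1}[shifted_exp t]mul1r -mulrDl.
by rewrite ler_wpM2r ?shifted_exp_ge0// expR_ge1Dx.
Qed.

Lemma tilted_f0_ge z :
  ((expR 1 ^+ n)%:E <= \int[lam]_x (expR (dotmul_rV z x) * f0 x)%:E)%E.
Proof.
pose g (i : 'I_n) (t : R) : R := expR (z ord0 i * t) * shifted_exp t.
have E x : expR (dotmul_rV z x) * f0 x = \prod_i g i (x ord0 i).
  by rewrite f0E /dotmul_rV expR_sum -big_split.
under eq_integral do rewrite E.
rewrite ge0_integral_prod_coord.
- rewrite (_ : expR 1 ^+ n = \prod_(i < n) expR 1); last first.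
    by rewrite prodr_const card_ord.
  rewrite -prodEFin.
  suff /andP[] : (0 <= \prod_(i < n) (expR 1 : R)%:E <=
      \prod_(i < n) \int[leb]_x (g i x)%:E)%E by [].
  elim/big_ind2: _ => [|a b c d /andP[a0 ab] /andP[c0 cd]|i _].
  + by rewrite lexx lee_fin ler01.
  + by rewrite mule_ge0//= lee_pmul.
  + by rewrite lee_fin expR_ge0/= tilted_shifted_exp_ge.
- move=> i; apply: measurable_funM; last exact: measurable_shifted_exp.
  by apply: measurableT_comp => //; exact: measurable_funM.
- by move=> i t; rewrite /g mulr_ge0 ?expR_ge0 ?shifted_exp_ge0.
Qed.

Lemma integral_translate_f0 z :
  (\int[lam]_x (translate f0 z x)%:E = (expR 1 ^+ n)%:E)%E.
Proof.
have [i0 e0] := @integral_f0 R n.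
have m0 : measurable_fun setT (EFin \o f0) by case/integrableP: i0.
rewrite translateE (@ge0_integral_translate R n (EFin \o f0) z)//; last first.
  by move=> x; rewrite lee_fin f0_ge0.
rewrite -e0 /Rintegral fineK//; exact: (integrable_fin_num measurableT i0).
Qed.

Lemma integral_reflect (F : V -> R) : measurable_fun setT F -> (forall x, 0 <= F x) ->
  (\int[lam]_y (F (- y))%:E = \int[lam]_y (F y)%:E)%E.
Proof.
move=> mF F0; transitivity (\int[lam]_y ((EFin \o F) (-1 *: y + 0)%R))%E.
  by apply: eq_integral => y _; rewrite /= scaleN1r addr0.
rewrite (@ge0_integral_affine_rV R n (-1) 0 (EFin \o F)).
- by rewrite normrN1 expr1n invr1 mul1e.
- by rewrite oppr_eq0 oner_eq0.
- exact/measurable_EFinP.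
- by move=> x; rewrite lee_fin.
Qed.

Lemma measurable_f0 : measurable_fun setT f0.
Proof. by have [/integrableP[/measurable_EFinP]] := @integral_f0 R n. Qed.

Lemma mahler_inf_f0 : mahler_inf f0 = (expR 1 ^+ n)%:E.
Proof.
have mf := measurable_f0.
have Z0 : 0 < expR 1 ^+ n :> R by rewrite exprn_gt0// expR_gt0.
apply/eqP; rewrite eq_le; apply/andP; split.
  apply: (@le_trans _ _ (mahler_product (translate f0 0))).
    by apply: ereal_inf_lbound; exists 0.
  rewrite /mahler_product integral_translate_f0 -[leRHS]mule1.
  rewrite lee_pmul2l ?fin_numE ?lte_fin//.
  rewrite (_ : translate f0 0 = f0); last by apply/funext => x; rewrite /translate subr0.
  apply: (@le_trans _ _ (\int[lam]_y ((expR 1 ^+ n)^-1 * f0 (- y))%:E)%E).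
    apply: ge0_nonmeasurable_ae_le_integral; last exact/aeW/polar_f0_le.
      by move=> y; apply: polar_ge0 => x; exact: f0_ge0.
    by move=> y; rewrite lee_fin mulr_ge0 ?f0_ge0// invr_ge0 ltW.
  rewrite (integral_reflect (F := fun y => (expR 1 ^+ n)^-1 * f0 y)).
  - under eq_integral do rewrite EFinM.
    rewrite (ge0_integralZl_EFin lam measurableT).
    + rewrite (_ : (\int[lam]_x (f0 x)%:E)%E = (expR 1 ^+ n)%:E).
        by rewrite -EFinM mulVf ?gt_eqF.
      rewrite -(integral_translate_f0 0).
      by apply: eq_integral => x _; rewrite /translate subr0.
    + by move=> x _; rewrite lee_fin f0_ge0.
    + exact/measurable_EFinP.
    + by rewrite invr_ge0 ltW.
  - exact: measurable_funM.
  - by move=> x; rewrite mulr_ge0 ?f0_ge0// invr_ge0 ltW.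
apply: le_ereal_inf_tmp => _ [z _ <-].
rewrite /mahler_product integral_translate_f0 -[leLHS]mule1.
rewrite lee_pmul2l ?fin_numE ?lte_fin//.
have mg : measurable_fun setT (fun x => expR (dotmul_rV z x) * f0 x).
  apply: measurable_funM => //; apply: measurableT_comp => //; exact: measurable_dotmul.
have g0 x : 0 <= expR (dotmul_rV z x) * f0 x by rewrite mulr_ge0 ?f0_ge0// expR_ge0.
(* Written at -y so that a reflection turns the minorant of the polar into the exponentially tilted
   integral of [f0]. *)
apply: (@le_trans _ _ (\int[lam]_y ((expR 1 ^+ n)^-1 *
    (expR (dotmul_rV z (- y)) * f0 (- y)))%:E)%E); last first.
  apply: ge0_nonmeasurable_ae_le_integral.
  - by move=> y; rewrite lee_fin mulr_ge0// invr_ge0 ltW.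
  - by move=> y; apply: polar_ge0 => x; exact: f0_ge0.
  apply: aeW => y; apply: le_trans (polar_translate_f0_ge z y).
  by rewrite lee_fin dotmul_rVNr mulrA [X in X * f0 _]mulrC.
rewrite (integral_reflect (F := fun y => (expR 1 ^+ n)^-1 * (expR (dotmul_rV z y) * f0 y))).
- under eq_integral do rewrite EFinM.
  rewrite (ge0_integralZl_EFin lam measurableT).
  + rewrite -[leLHS](_ : ((expR 1 ^+ n)^-1 * expR 1 ^+ n)%:E = _); last first.
      by rewrite mulVf ?gt_eqF.
    rewrite EFinM lee_pmul2l ?fin_numE ?lte_fin ?invr_gt0//; exact: tilted_f0_ge.
  + by move=> x _; rewrite lee_fin.
  + exact/measurable_EFinP.
  + by rewrite invr_ge0 ltW.
- exact: measurable_funM.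
- by move=> x; rewrite mulr_ge0// invr_ge0 ltW.
Qed.

End extremal_mahler.

Theorem corollary1p1 (R : realType) (n : nat) (hn : (1 <= n)%N) :
  [/\ isotropic_constant (f0 : 'rV[R]_n -> R) = 1 / expR 1,
      mahler_inf (f0 : 'rV[R]_n -> R) = (expR 1 ^+ n)%:E
    & (forall f : 'rV[R]_n -> R,
         log_concave f -> lebesgue_integrable f ->
         0 < \int[lebesgue_rV R n]_x f x ->
         isotropic_constant f <= isotropic_constant (f0 : 'rV[R]_n -> R)) ->
      (forall f : 'rV[R]_n -> R,
         log_concave f -> lebesgue_integrable f ->
         0 < \int[lebesgue_rV R n]_x f x ->
         (mahler_inf (f0 : 'rV[R]_n -> R) <= mahler_inf f)%E)].
Proof.
have iso := @isotropic_constant_f0 R n hn.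
split; [exact: iso|exact: mahler_inf_f0|].
rewrite iso mahler_inf_f0 => H f lcf intf f_gt0; apply: mahler_inf_ge => // g lcg intg g0.
by rewrite -div1r; exact: H.
Qed.
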